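(* Let $G=(V,w,m,d)$ be a salami where $d=d_0$ is the combinatorial distance. Suppose there is $\varepsilon>0$ such that $w(x,y)\ge\varepsilon$ for all $(x,y)\in E$. Then: (i) $(V,d_0)$ is quasi-isometric to the line $\mathbb{R}$; (ii) the real vector space $\{u\in\mathbb{R}^V:\Delta u=0\}$ of all harmonic functions has finite dimension; (iii) the space of subexponentially growing harmonic functions, $\{u\in\mathbb{R}^V:\Delta u=0,\ \max_{B_r(x_0)}|u|=e^{o(r)}\text{ as }r\to\infty\}$ (for any fixed $x_0\in V$), is two-dimensional.
   Context: A graph $G=(V,w,m,d_0)$ consists of a countable set $V$, a symmetric function $w:V\times V\to[0,\infty)$ vanishing on the diagonal, a function $m:V\to(0,\infty)$; write $x\sim y$ if $w(x,y)>0$, $E=\{(x,y):w(x,y)>0\}$, $E(X,Y)=E\cap(X\times Y)$, $m(X)=\sum_{x\in X}m(x)$. The graph is locally finite (every vertex has finitely many neighbours) and connected; $d_0(x,y)=\inf\{n:x=x_0\sim\dots\sim x_n=y\}$ is the combinatorial distance, and $B_r(x)=\{y:d_0(x,y)\le r\}$. Laplacian: $\Delta f(x)=\frac1{m(x)}\sum_y w(x,y)(f(y)-f(x))$. $Lip(1)=\{f\in\mathbb{R}^V: f(y)-f(x)\le d_0(x,y)\ \forall x,y\}$. Ollivier curvature for $x\ne y$: $\kappa(x,y)=\frac1{d_0(x,y)}\inf\{\Delta f(x)-\Delta f(y): f\in Lip(1),\ f(y)-f(x)=d_0(x,y)\}$. Non-negative Ollivier curvature means $\kappa(x,y)\ge0$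 for all $x\sim y$. A salami partition is a triple $(X,Y,K)$ with $V=X\,\dot\cup\,Y\,\dot\cup\,K$ (disjoint), $K$ finite, $E(X,Y)=\emptyset$, $m(X)=m(Y)=\infty$. A salami (with distance $d_0$) is a connected, locally finite graph with non-negative Ollivier curvature admitting a salami partition. The condition $\max_{B_r(x_0)}|u|=e^{o(r)}$ means: for every $\delta>0$, $\max_{B_r(x_0)}|u|\le e^{\delta r}$ for all sufficiently large $r$ (in particular $u=0$ is allowed). *)

(* Defs.v *)
From HB Require Import structures.
From mathcomp Require Import all_boot all_order all_algebra.
From mathcomp Require Import all_classical all_reals all_analysis.

Set Implicit Arguments.
Unset Strict Implicit.
Unset Printing Implicit Defensive.

Import Order.TTheory GRing.Theory Num.Theory.
Import numFieldNormedType.Exports.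

Local Open Scope classical_set_scope.
Local Open Scope ring_scope.

Record graph (R : realType) (V : countType) := Graph {
  weight : V -> V -> R;
  vmeas : V -> R;
  weight_ge0 : forall x y, 0 <= weight x y;
  weight_sym : forall x y, weight x y = weight y x;
  weight_diag : forall x, weight x x = 0;
  vmeas_gt0 : forall x, 0 < vmeas x
}.

Section Graph.
Context (R : realType) (V : countType) (G : graph R V).

Definition adj : rel V := fun x y => 0 < weight G x y.

Definition edges : set (V * V) := [set e | adj e.1 e.2].

Definition edges_between (X Y : set V) : set (V * V) := edges `&` (X `*` Y).

Definition set_mass (X : set V) : \bar R := \esum_(x in X) (vmeas G x)%:E.

Definition locally_finite : Prop := forall x, finite_set [set y | adj x y].

Definition walk (n : nat) (x y : V) : Prop :=
  exists s : seq V, [/\ size s = n, path adj x s & last x s = y].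

Definition connected_graph : Prop := forall x y, exists n, walk n x y.

(* The value 0 for vertices not joined by a walk is a junk value; it does not
   occur in a connected graph. *)
Definition dist (x y : V) : nat :=
  match pselect (exists n, `[< walk n x y >]) with
  | left h => ex_minn h
  | right _ => 0%N
  end.

Definition gball (x : V) (r : R) : set V := [set y | (dist x y)%:R <= r].

(* In a locally finite graph the summand has finite support, so the sum over
   the whole vertex set is a finite sum. *)
Definition laplacian (f : V -> R) (x : V) : R :=
  (vmeas G x)^-1 * \sum_(y \in [set: V]) weight G x y * (f y - f x).

Definition Lip1 : set (V -> R) :=
  [set f | forall x y, f y - f x <= (dist x y)%:R].

(* In a connected, locally finite graph the set below is nonempty (take
   f = dist x) and bounded below, so that the real infimum is the genuine one. *)
Definition ollivier_curvature (x y : V) : R :=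
  (dist x y)%:R^-1 *
  inf [set laplacian f x - laplacian f y
      | f in [set f | Lip1 f /\ f y - f x = (dist x y)%:R]].

Definition nonneg_ollivier_curvature : Prop :=
  forall x y, adj x y -> 0 <= ollivier_curvature x y.

Definition salami_partition (X Y K : set V) : Prop :=
  [/\ X `|` Y `|` K = [set: V],
      [/\ X `&` Y = set0, X `&` K = set0 & Y `&` K = set0],
      finite_set K,
      edges_between X Y = set0 &
      set_mass X = +oo%E /\ set_mass Y = +oo%E].

Definition salami : Prop :=
  [/\ connected_graph, locally_finite, nonneg_ollivier_curvature &
      exists X Y K, salami_partition X Y K].

(* Functions are typed V -> R^o only to make V -> R a vector space over R. *)
Definition harmonic_functions : set (V -> R^o) :=
  [set u | forall x, laplacian u x = 0].

(* The balls of a connected, locally finite graph are finite, and they are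
   nonempty for r >= 0, so that this supremum is a maximum. *)
Definition ball_max (u : V -> R) (x0 : V) (r : R) : R :=
  sup [set `|u x| | x in gball x0 r].

Definition subexponential_functions (x0 : V) : set (V -> R^o) :=
  [set u | forall delta : R, 0 < delta ->
     \forall r \near +oo, ball_max u x0 r <= expR (delta * r)].

End Graph.

(* S is a linear subspace of dimension n: it is the span of n linearly
   independent vectors. *)
Definition has_dim (R : realType) (L : lmodType R) (S : set L) (n : nat) : Prop :=
  exists b : 'I_n -> L,
    (forall c : 'I_n -> R, \sum_i c i *: b i = 0 -> forall i, c i = 0) /\
    S = [set \sum_i c i *: b i | c in [set: 'I_n -> R]].

Definition finite_dim (R : realType) (L : lmodType R) (S : set L) : Prop :=
  exists n, has_dim S n.

Definition quasi_isometry (R : realType) (A B : Type)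
    (dA : A -> A -> R) (dB : B -> B -> R) (f : A -> B) : Prop :=
  exists a b c : R, [/\ 1 <= a, 0 <= b, 0 <= c,
    forall x y, a^-1 * dA x y - b <= dB (f x) (f y) <= a * dA x y + b &
    forall z, exists x, dB (f x) z <= c].

Definition quasi_isometric (R : realType) (A B : Type)
    (dA : A -> A -> R) (dB : B -> B -> R) : Prop :=
  exists f : A -> B, quasi_isometry dA dB f.

(* Main.v *)
(* Fix a partition [V = X + Y + K]. A fixed point argument for the heat flow of
   1-Lipschitz functions on [K], extended with maximal slope upwards over [X] and
   downwards over [Y], gives a 1-Lipschitz [f] that is harmonic on [K],
   superharmonic on [X] and subharmonic on [Y]: non-negative curvature makes the
   Laplacian decrease along lines of full gradient, and infinite mass forces the
   additive constant to vanish. The flux of [f] through its levels is monotone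
   away from [K] and, as every vertex of [X] has a neighbour one unit below, it
   bounds the number of vertices in unit slabs. With the maximum principle this
   bounds the dimension of the space of harmonic functions. A limit of such
   functions, for [K] exhausting [V], is a 1-Lipschitz harmonic function [h] of
   positive flux, and comparing the fluxes of these functions for different
   partitions excludes a third end.

   If some slab in [X] were disconnected, the double cover of the graph obtained
   by cutting one piece of the slab at mid height would again have non-negative
   curvature, but four ends of infinite mass; if the cover is disconnected, the
   graph itself has a third end or a dead end, and the latter would absorb too
   much flux far out. So slabs have bounded diameter and [f] is a quasi-isometry.

   The energy of a harmonic function of zero flux in a band [|f| <= n] is bounded
   by its oscillation on the two boundary slabs, hence by its energy near their
   boundary. It therefore grows exponentially unless it vanishes, and subtracting
   a multiple of [h] from a subexponential harmonic function leaves a constant. *)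
Require Import Defs.
From mathcomp Require Import all_boot all_order all_algebra.
From mathcomp Require Import all_classical all_reals all_analysis.
From mathcomp Require Import finmap ring lra.

Set Implicit Arguments.
Unset Strict Implicit.
Unset Printing Implicit Defensive.

Import Order.TTheory GRing.Theory Num.Theory.
Import numFieldNormedType.Exports.

Local Open Scope classical_set_scope.
Local Open Scope ring_scope.

(** * Distance *)

(** Flux is paired with a cutoff of an end instead of a single level set: two cutoffs of the same
    end differ by a finitely supported function, so comparing their fluxes is Green's formula on a
    finite set, whatever the growth of the functions. Each edge is counted in both orders, whence
    the factors 2. An edge of full gradient contributes at least [2 * eps]; this quantum is what the
    lower weight bound buys. It turns bounded flux into bounded vertex counts and makes the two
    inequalities for a third end contradictory.

    The heat flow is replaced by one explicit Euler step whose length only has to suit the finite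
    set [K], so unbounded rates cause no trouble.

    Slabs have half-width 15 because curvature at an edge is tested with walks reaching distance 6,
    and the cut must look trivial on every ball of that size. The energy grows in steps of 30, the
    full width of a slab.

    In the energy estimate the test function may take different constants on the two ends; zero flux
    is exactly what makes these constants free. *)

Section Distance.
Context (R : realType) (V : countType) (G : graph R V).
Context (conn : connected_graph G).

Lemma adjC x y : adj G x y = adj G y x.
Proof. by rewrite /adj weight_sym. Qed.

Lemma adj_irr x : adj G x x = false.
Proof. by rewrite /adj weight_diag ltxx. Qed.

Lemma walk0 x : walk G 0 x x.
Proof. by exists [::]. Qed.

Lemma walk1 x y : adj G x y -> walk G 1 x y.
Proof. by move=> xy; exists [:: y]; rewrite /= xy. Qed.

Lemma walk_cat n m x y z : walk G n x y -> walk G m y z -> walk G (n + m) x z.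
Proof.
move=> [s [<- ps ls]] [t [<- pt lt]]; exists (s ++ t).
by rewrite size_cat cat_path last_cat ls ps pt lt.
Qed.

Lemma walkS n x z : walk G n.+1 x z <-> exists2 y, adj G x y & walk G n y z.
Proof.
split=> [[[|y s] []]//= [sn] /andP[xy ys] ls|[y xy yz]].
  by exists y => //; exists s.
by rewrite -add1n; apply: walk_cat yz; exact: walk1.
Qed.

Lemma walk_sym n x y : walk G n x y -> walk G n y x.
Proof.
elim: n x y => [|n IH] x y.
  by move=> [[|z s] []//= _ _ <-]; exact: walk0.
move=> /walkS[z xz zy]; rewrite -addn1; apply: walk_cat (IH _ _ zy) _.
by apply: walk1; rewrite adjC.
Qed.

Lemma walk_dist x y : walk G (dist G x y) x y.
Proof.
rewrite /dist; case: pselect => [h|nh].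
  by case: ex_minnP => n /asboolP.
by case: nh; have [n xy] := conn x y; exists n; exact/asboolP.
Qed.

Lemma dist_le_walk n x y : walk G n x y -> (dist G x y <= n)%N.
Proof.
move=> xy; rewrite /dist; case: pselect => [h|//].
by case: ex_minnP => m _; apply; exact/asboolP.
Qed.

Lemma distxx x : dist G x x = 0%N.
Proof. by apply/eqP; rewrite -leqn0; exact/dist_le_walk/walk0. Qed.

Lemma dist0_eq x y : dist G x y = 0%N -> x = y.
Proof. by move=> d0; have := walk_dist x y; rewrite d0 => -[[|z s] []]. Qed.

Lemma dist_sym x y : dist G x y = dist G y x.
Proof.
apply/eqP; rewrite eqn_leq; apply/andP.
by split; apply/dist_le_walk/walk_sym/walk_dist.
Qed.

Lemma dist_triangle y x z : (dist G x z <= dist G x y + dist G y z)%N.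
Proof. by apply: dist_le_walk; apply: walk_cat; exact: walk_dist. Qed.

Lemma dist_adj x y : adj G x y -> dist G x y = 1%N.
Proof.
move=> xy; apply/eqP; rewrite eqn_leq (dist_le_walk (walk1 xy)) lt0n.
by apply/eqP => /dist0_eq exy; rewrite exy adj_irr in xy.
Qed.

Lemma distS_next n x y : dist G x y = n.+1 ->
  exists2 z, adj G x z & dist G z y = n.
Proof.
move=> dn; have := walk_dist x y; rewrite dn => /walkS[z xz zy]; exists z => //.
apply/eqP; rewrite eqn_leq dist_le_walk //= -ltnS -dn.
by rewrite (leq_trans (dist_triangle z x y)) // (dist_adj xz).
Qed.

Lemma adj_ind (Q : V -> Prop) x0 : Q x0 ->
  (forall x y, adj G x y -> Q x -> Q y) -> forall x, Q x.
Proof.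
move=> Q0 QS x; have [n] := conn x x0; elim: n x => [|n IH] x.
  by move=> [[|z s] []//= _ _ ->].
by move=> /walkS[y xy /IH]; apply: QS; rewrite adjC.
Qed.

Lemma Lip1P (f : V -> R) :
  Lip1 G f <-> forall x y, adj G x y -> f y - f x <= 1.
Proof.
split=> [fL x y xy|fL x y]; first by rewrite (le_trans (fL x y)) ?dist_adj.
have := walk_dist x y; move: (dist G x y) => n.
elim: n x => [|n IH] x; first by move=> [[|z s] []//= _ _ ->]; rewrite subrr.
by move=> /walkS[z xz /IH zy]; have := fL _ _ xz; rewrite -natr1; lra.
Qed.

Lemma Lip1_normB (f : V -> R) x y : Lip1 G f -> `|f x - f y| <= (dist G x y)%:R.
Proof.
by move=> fL; rewrite ler_norml lerNl opprB fL/= (dist_sym x y) fL.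
Qed.

Lemma Lip1N (f : V -> R) : Lip1 G f -> Lip1 G (\- f).
Proof. by move=> fL x y; rewrite opprK addrC (dist_sym x y); exact: fL. Qed.

Lemma dist_triangleR (y x z : V) :
  (dist G x z)%:R <= (dist G x y)%:R + (dist G y z)%:R :> R.
Proof. by rewrite -natrD ler_nat dist_triangle. Qed.

Context (lfin : locally_finite G).

Lemma finite_ball x n : finite_set [set y | (dist G x y <= n)%N].
Proof.
elim: n => [|n IH].
  by apply: sub_finite_set (finite_set1 x) => y /=; rewrite leqn0 => /eqP/dist0_eq.
apply: (@sub_finite_set _ _ ([set y | (dist G x y <= n)%N] `|`
   \bigcup_(z in [set z | (dist G x z <= n)%N]) [set y | adj G z y])); last first.
  by rewrite finite_setU; split=> //; apply: bigcup_finite.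
move=> y /=; rewrite leq_eqVlt => /predU1P[dn|]; last by left.
right; move: dn; rewrite dist_sym => /distS_next[z yz zn].
by exists z => /=; [rewrite dist_sym zn|rewrite adjC].
Qed.

Lemma finite_ball_set (K : set V) (n : nat) : finite_set K ->
  finite_set [set y | exists2 x, K x & (dist G x y <= n)%N].
Proof.
move=> Kf; apply: (@sub_finite_set _ _
  (\bigcup_(x in K) [set y | (dist G x y <= n)%N])).
  by move=> y [x Kx xy]; exists x.
by apply: bigcup_finite => // x _; exact: finite_ball.
Qed.

End Distance.

(** * Flux *)

Section Flux.
Context (R : realType) (V : countType) (G : graph R V).
Context (conn : connected_graph G) (lfin : locally_finite G).

Local Notation w := (weight G).

Definition nbr (x : V) : {fset V} := fset_set [set y | adj G x y].

Lemma in_nbr x y : (y \in nbr x) = adj G x y.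
Proof.
by rewrite /nbr in_fset_set //; apply/idP/idP => [/set_mem|/mem_set].
Qed.

Lemma weight_nadj x y : ~~ adj G x y -> w x y = 0.
Proof. by rewrite /adj lt_neqAle weight_ge0 andbT negbK => /eqP <-. Qed.

(** The operator $m\Delta$. Green's formula does not see the measure, which reenters through
    curvature and infinite mass. *)
Definition mlap (g : V -> R) (x : V) : R :=
  \sum_(y <- nbr x) w x y * (g y - g x).

Lemma mlap_sum (Z : {fset V}) g x :
    (forall y, adj G x y -> g y != g x -> y \in Z) ->
  mlap g x = \sum_(y <- Z) w x y * (g y - g x).
Proof.
move=> gZ; pose F y := w x y * (g y - g x).
rewrite /mlap -/(F _).
rewrite (@big_fset_incl _ _ _ _ (nbr x) (nbr x `|` Z)%fset) ?fsubsetUl //.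
  rewrite -(@big_fset_incl _ _ _ _ Z (nbr x `|` Z)%fset) ?fsubsetUr // => y.
  rewrite inE => /orP[|-> //]; rewrite in_nbr => xy yZ.
  have [->|/gZ] := eqVneq (g y) (g x); first by rewrite subrr mulr0.
  by move=> /(_ xy); rewrite (negPf yZ).
by move=> y _; rewrite in_nbr => /weight_nadj ->; rewrite mul0r.
Qed.

Lemma laplacian_mlap g x : laplacian G g x = (vmeas G x)^-1 * mlap g x.
Proof.
rewrite /laplacian /mlap; congr (_ * _).
rewrite [RHS](_ : _ = \sum_(y \in [set` nbr x]) w x y * (g y - g x)).
  apply/esym/fsbig_widen => // y [_ /=]; rewrite in_nbr => /negP /weight_nadj ->.
  by rewrite mul0r.
by rewrite fsbig_finite // set_fsetK.
Qed.

Lemma mlap_ext g h x : g =1 h -> mlap g x = mlap h x.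
Proof. by move=> gh; apply: eq_bigr => y _; rewrite !gh. Qed.

Lemma mlapD g h x : mlap (fun z => g z + h z) x = mlap g x + mlap h x.
Proof. by rewrite -big_split; apply: eq_bigr => y _ /=; ring. Qed.

Lemma mlapZ a g x : mlap (fun z => a * g z) x = a * mlap g x.
Proof. by rewrite big_distrr; apply: eq_bigr => y _ /=; ring. Qed.

Lemma mlapN g x : mlap (fun z => - g z) x = - mlap g x.
Proof. by rewrite -mulN1r -mlapZ; apply: mlap_ext => z; rewrite mulN1r. Qed.

Lemma mlap_cst c x : mlap (fun=> c) x = 0.
Proof. by apply: big1 => y _; rewrite subrr mulr0. Qed.

Lemma mlap_addcst g c x : mlap (fun z => g z + c) x = mlap g x.
Proof. by rewrite mlapD mlap_cst addr0. Qed.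

Definition energy (Z : {fset V}) (T g : V -> R) : R :=
  \sum_(x <- Z) \sum_(y <- Z) w x y * ((T y - T x) * (g y - g x)).

Lemma energyC Z T g : energy Z T g = energy Z g T.
Proof. by apply: eq_bigr => x _; apply: eq_bigr => y _; rewrite mulrCA mulrC -mulrA. Qed.

(** Summation by parts; the 2 appears because every edge occurs in both orders. *)
Lemma energy_parts Z T g : energy Z T g =
  - (2 * \sum_(x <- Z) g x * \sum_(y <- Z) w x y * (T y - T x)).
Proof.
pose F x y := w x y * (T y - T x) * g x.
have E1 : \sum_(x <- Z) g x * (\sum_(y <- Z) w x y * (T y - T x)) =
    \sum_(x <- Z) \sum_(y <- Z) F x y.
  by apply: eq_bigr => x _; rewrite mulrC big_distrl.
have E2 : energy Z T g = \sum_(x <- Z) \sum_(y <- Z) (- F y x - F x y).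
  apply: eq_bigr => x _; apply: eq_bigr => y _.
  by rewrite /F (weight_sym G y x); ring.
rewrite E1 E2; under eq_bigr do rewrite big_split /=.
rewrite big_split /= exchange_big /=.
have -> : \sum_(x <- Z) \sum_(y <- Z) - F x y = - \sum_(x <- Z) \sum_(y <- Z) F x y.
  by rewrite -sumrN; apply: eq_bigr => x _; rewrite sumrN.
by rewrite mulr2n mulrDl mul1r opprD.
Qed.

(** A cutoff of an infinite end has infinite support but varies along finitely many edges only, and
    these suffice to make the flux a finite sum. Symmetry of [adj] puts both ends of such an edge
    into [Z]. *)
Definition grad_in (T : V -> R) (Z : {fset V}) : Prop :=
  forall x y, adj G x y -> T x != T y -> x \in Z.

Definition fingrad (T : V -> R) : Prop := exists Z, grad_in T Z.

Lemma grad_inS T Z Z' : (Z `<=` Z')%fset -> grad_in T Z -> grad_in T Z'.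
Proof. by move=> /fsubsetP ZZ' TZ x y xy Txy; apply/ZZ'/(TZ x y). Qed.

Lemma grad_in_sym T Z x y : grad_in T Z -> adj G x y -> T x != T y -> y \in Z.
Proof. by move=> TZ xy Txy; apply: (TZ y x); rewrite 1?adjC 1?eq_sym. Qed.

(* Twice the flow of the gradient of [g] through the level sets of the
   cutoff [T], integrated over the levels. *)
Definition flux (T g : V -> R) : R :=
  - (2 * \sum_(x \in [set: V]) g x * mlap T x).

Lemma flux_energy Z T g : grad_in T Z -> flux T g = energy Z T g.
Proof.
move=> TZ; rewrite energy_parts /flux; congr (- (_ * _)).
rewrite [RHS](_ : _ = \sum_(x \in [set` Z]) g x * mlap T x).
  apply/esym/fsbig_widen => // x [_ /= /negP xZ].
  rewrite /mlap big1_fset ?mulr0 // => y; rewrite in_nbr => xy _.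
  have [->|/eqP Txy] := eqVneq (T x) (T y); first by rewrite subrr mulr0.
  by case/negP: xZ; apply: (TZ x y) => //; exact/eqP.
rewrite fsbig_finite // set_fsetK; apply: eq_bigr => x _; congr (_ * _).
rewrite (@mlap_sum Z) // => y xy Txy.
by apply: grad_in_sym TZ xy _; rewrite eq_sym.
Qed.

Definition supp_in (T : V -> R) (Z : {fset V}) : Prop :=
  forall x, T x != 0 -> x \in Z.

Lemma supp_fingrad T Z : supp_in T Z -> fingrad T.
Proof.
move=> TZ; exists (Z `|` \bigcup_(z <- Z) nbr z)%fset => x y xy Txy; rewrite inE.
have [Tx0|/TZ ->//] := eqVneq (T x) 0; apply/orP; right.
apply/bigfcupP; exists y; last by rewrite in_nbr adjC.
by rewrite andbT; apply: TZ; rewrite -Tx0 eq_sym.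
Qed.

(** For finitely supported [T] the Laplacian can be moved to [g]; comparisons between two cutoffs
    reduce to this. *)
Lemma flux_supp T Z g : supp_in T Z ->
  flux T g = - (2 * \sum_(x <- Z) T x * mlap g x).
Proof.
move=> TZ; pose Z' := (Z `|` \bigcup_(z <- Z) nbr z)%fset.
have ZZ' : (Z `<=` Z')%fset by apply: fsubsetUl.
have nZ' x y : T x != 0 -> adj G x y -> y \in Z'.
  move=> /TZ xZ xy; rewrite inE; apply/orP; right.
  by apply/bigfcupP; exists x; rewrite ?xZ // in_nbr.
rewrite (@flux_energy Z'); last first.
  move=> x y xy Txy; have [Tx0|/TZ] := eqVneq (T x) 0; last exact/fsubsetP.
  by apply: (nZ' y); rewrite 1?adjC // -Tx0 eq_sym.
rewrite energyC energy_parts; congr (- (_ * _)).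
rewrite (@big_fset_incl _ _ _ _ Z Z') //; last first.
  move=> x _ xZ; have [->|/TZ] := eqVneq (T x) 0; first by rewrite mul0r.
  by rewrite (negPf xZ).
apply: eq_bigr => x _; have [->|Tx] := eqVneq (T x) 0; first by rewrite !mul0r.
by congr (_ * _); rewrite (@mlap_sum Z') // => y xy _; exact: nZ' xy.
Qed.

Lemma fingrad2 T1 T2 : fingrad T1 -> fingrad T2 ->
  exists2 Z, grad_in T1 Z & grad_in T2 Z.
Proof.
move=> [Z1 h1] [Z2 h2]; exists (Z1 `|` Z2)%fset.
  by apply: grad_inS h1; exact: fsubsetUl.
by apply: grad_inS h2; exact: fsubsetUr.
Qed.

Lemma grad_inD T1 T2 Z : grad_in T1 Z -> grad_in T2 Z ->
  grad_in (fun x => T1 x + T2 x) Z.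
Proof.
move=> h1 h2 x y xy; have [e1|/h1 ?] := eqVneq (T1 x) (T1 y); last by auto.
have [e2|/h2 ?] := eqVneq (T2 x) (T2 y); last by auto.
by rewrite e1 e2 eqxx.
Qed.

Lemma grad_inN T Z : grad_in T Z -> grad_in (fun x => - T x) Z.
Proof. by move=> h x y xy; rewrite eqr_opp; exact: h. Qed.

Lemma fingradD T1 T2 : fingrad T1 -> fingrad T2 ->
  fingrad (fun x => T1 x + T2 x).
Proof.
by move=> h1 h2; have [Z ? ?] := fingrad2 h1 h2; exists Z; exact: grad_inD.
Qed.

Lemma fingradN T : fingrad T -> fingrad (fun x => - T x).
Proof. by move=> [Z TZ]; exists Z; exact: grad_inN. Qed.

Lemma fluxDl T1 T2 g : fingrad T1 -> fingrad T2 ->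
  flux (fun x => T1 x + T2 x) g = flux T1 g + flux T2 g.
Proof.
move=> h1 h2; have [Z Z1 Z2] := fingrad2 h1 h2.
rewrite !(@flux_energy Z) //; last exact: grad_inD.
rewrite -big_split; apply: eq_bigr => x _; rewrite -big_split.
by apply: eq_bigr => y _ /=; ring.
Qed.

Lemma fluxNl T g : fingrad T -> flux (fun x => - T x) g = - flux T g.
Proof.
move=> [Z Z1]; rewrite !(@flux_energy Z) //; last exact: grad_inN.
rewrite -sumrN; apply: eq_bigr => x _; rewrite -sumrN.
by apply: eq_bigr => y _ /=; ring.
Qed.

Lemma fluxDr T g1 g2 : fingrad T ->
  flux T (fun x => g1 x + g2 x) = flux T g1 + flux T g2.
Proof.
move=> [Z Z1]; rewrite !(@flux_energy Z) //.
rewrite -big_split; apply: eq_bigr => x _; rewrite -big_split.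
by apply: eq_bigr => y _ /=; ring.
Qed.

Lemma fluxZr T a g : fingrad T -> flux T (fun x => a * g x) = a * flux T g.
Proof.
move=> [Z Z1]; rewrite !(@flux_energy Z) //.
rewrite big_distrr; apply: eq_bigr => x _; rewrite big_distrr.
by apply: eq_bigr => y _ /=; ring.
Qed.

Lemma fingradZ a T : fingrad T -> fingrad (fun x => a * T x).
Proof.
move=> [Z TZ]; exists Z => x y xy aT; apply: TZ xy _.
by apply: contra_neq aT => ->.
Qed.

Lemma fluxZl a T g : fingrad T -> flux (fun x => a * T x) g = a * flux T g.
Proof.
move=> [Z TZ]; rewrite (flux_energy g TZ) (@flux_energy Z).
  rewrite big_distrr; apply: eq_bigr => x _; rewrite big_distrr.
  by apply: eq_bigr => y _ /=; ring.
by move=> x y xy aT; apply: TZ xy _; apply: contra_neq aT => ->.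
Qed.

Lemma fluxNr T g : fingrad T -> flux T (fun x => - g x) = - flux T g.
Proof.
move=> h; rewrite -mulN1r -fluxZr //; congr (flux _).
by apply/funext => x; rewrite mulN1r.
Qed.

Lemma flux_cstr T c : fingrad T -> flux T (fun=> c) = 0.
Proof.
move=> [Z Z1]; rewrite !(@flux_energy Z) //; apply: big1 => x _.
by apply: big1 => y _; rewrite subrr !mulr0.
Qed.

Lemma flux_cstl c g : flux (fun=> c) g = 0.
Proof.
rewrite (@flux_energy fset0); last by move=> x y _; rewrite eqxx.
exact: big_seq_fset0.
Qed.

Definition endset (X K : set V) : Prop :=
  [/\ finite_set K, forall x, X x -> ~ K x &
      forall x y, X x -> adj G x y -> X y \/ K y].

Definition cutoff (X : set V) (T : V -> R) : Prop :=
  [/\ forall x, 0 <= T x <= 1, forall x, ~ X x -> T x = 0 &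
      finite_set [set x | X x /\ T x <> 1]].

Lemma cutoff_fingrad X K T : endset X K -> cutoff X T -> fingrad T.
Proof.
move=> [Kf XK nX] [_ T0 T1].
set F := K `|` [set x | X x /\ T x <> 1].
have Ff : finite_set F by rewrite finite_setU.
have Bf := finite_ball_set conn lfin 1 Ff.
exists (fset_set [set y | exists2 x, F x & (dist G x y <= 1)%N]) => x y xy /eqP Txy.
rewrite in_fset_set //; apply/mem_set => /=.
have Fx : F x -> exists2 z, F z & (dist G z x <= 1)%N by exists x; rewrite ?distxx.
have Fy : F y -> exists2 z, F z & (dist G z x <= 1)%N.
  by exists y => //; rewrite dist_sym // dist_adj.
have [Xx|nXx] := pselect (X x).
  have [Xy|Ky] := nX _ _ Xx xy; last by apply: Fy; left.
  have [Tx1|Tx1] := pselect (T x = 1); last by apply: Fx; right.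
  by apply: Fy; right; split=> // Ty1; apply: Txy; rewrite Tx1 Ty1.
have [Xy|nXy] := pselect (X y); last by case: Txy; rewrite !T0.
have yx : adj G y x by rewrite adjC.
by have [//|Kx] := nX _ _ Xy yx; apply: Fx; left.
Qed.

Lemma cutoff_diff_supp X T T' : cutoff X T -> cutoff X T' ->
  exists2 Z : {fset V}, supp_in (fun x => T x - T' x) Z & forall x, x \in Z -> X x.
Proof.
move=> [_ T0 T1] [_ T0' T1'].
have Ff : finite_set ([set x | X x /\ T x <> 1] `|` [set x | X x /\ T' x <> 1]).
  by rewrite finite_setU.
exists (fset_set ([set x | X x /\ T x <> 1] `|` [set x | X x /\ T' x <> 1])).
  move=> x Txx; rewrite in_fset_set //; apply/mem_set => /=.
  have [Xx|nXx] := pselect (X x); last by rewrite T0 // T0' // subrr eqxx in Txx.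
  have [Tx1|Tx1] := pselect (T x = 1); last by left.
  by right; split=> // Tx1'; rewrite Tx1 Tx1' subrr eqxx in Txx.
by move=> x; rewrite in_fset_set // => /set_mem -[[]|[]].
Qed.

(** Green's formula for the finitely supported, non-negative [T - T']: superharmonicity absorbs flux
    on the way out. *)
Lemma flux_mono X K T T' g : endset X K -> cutoff X T -> cutoff X T' ->
    (forall x, T' x <= T x) -> (forall x, X x -> mlap g x <= 0) ->
  flux T' g <= flux T g.
Proof.
move=> XK cT cT' TT' g0; have [Z TZ ZX] := cutoff_diff_supp cT cT'.
have fT := cutoff_fingrad XK cT; have fT' := cutoff_fingrad XK cT'.
rewrite -subr_ge0 -fluxNl // -fluxDl //; last exact: fingradN.
rewrite (flux_supp _ TZ) oppr_ge0 mulr_ge0_le0 // big_seq_cond.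
rewrite sumr_le0 // => x /andP[xZ _].
by rewrite mulr_ge0_le0 ?subr_ge0 ?TT' // g0 //; exact: ZX.
Qed.

Lemma flux_harmonic X K T T' g : endset X K -> cutoff X T -> cutoff X T' ->
    (forall x, X x -> mlap g x = 0) ->
  flux T' g = flux T g.
Proof.
move=> XK cT cT' g0; have [Z TZ ZX] := cutoff_diff_supp cT cT'.
have fT := cutoff_fingrad XK cT; have fT' := cutoff_fingrad XK cT'.
apply/esym/eqP; rewrite -subr_eq0 -fluxNl // -fluxDl //; last exact: fingradN.
rewrite (flux_supp _ TZ) oppr_eq0 mulf_eq0 big_seq_cond big1 ?eqxx ?orbT //.
by move=> x /andP[/ZX Xx _]; rewrite g0 ?mulr0.
Qed.

Lemma cutoff_indic X : cutoff X \1_X.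
Proof.
split=> [x|x nXx|]; rewrite ?indicE.
- by case: (x \in X); rewrite ?lexx ler01.
- by rewrite memNset.
- apply: sub_finite_set (finite_set0 _) => x [Xx].
  by rewrite indicE mem_set.
Qed.

Lemma cutoff_sub X X' T : cutoff X' T -> X' `<=` X ->
  finite_set (X `\` X') -> cutoff X T.
Proof.
move=> [T01 T0 T1] X'X fX; split=> // [x nXx|].
  by apply: T0 => /X'X.
apply: (@sub_finite_set _ _ ((X `\` X') `|` [set x | X' x /\ T x <> 1])).
  move=> x [Xx Tx]; have [X'x|nX'x] := pselect (X' x); [by right|by left].
by rewrite finite_setU.
Qed.

(** All terms being non-negative, a single edge may be kept, and it occurs in both orders. *)
Lemma flux_ge_term T g (x0 y0 : V) : fingrad T ->
    (forall x y, adj G x y -> 0 <= (T y - T x) * (g y - g x)) ->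
    adj G x0 y0 -> T x0 != T y0 ->
  2 * (w x0 y0 * ((T y0 - T x0) * (g y0 - g x0))) <= flux T g.
Proof.
move=> [Z TZ] h0 xy Txy; rewrite (flux_energy _ TZ) /energy.
have xZ := TZ _ _ xy Txy; have yZ := grad_in_sym TZ xy Txy.
pose F x y := w x y * ((T y - T x) * (g y - g x)); rewrite -!/(F _ _).
have F0 x y : 0 <= F x y.
  rewrite /F; have [xy'|/weight_nadj ->] := boolP (adj G x y); last by rewrite mul0r.
  by rewrite mulr_ge0 ?weight_ge0 // h0.
have Fs x y : F x y = F y x by rewrite /F weight_sym; ring.
have rowge x y : y \in Z -> F x y <= \sum_(y <- Z) F x y.
  by move=> yZ'; rewrite (big_fsetD1 y) //= lerDl sumr_ge0.
have xy0 : x0 != y0 by apply: contraNneq Txy => ->.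
have y0Z : y0 \in (Z `\ x0)%fset by rewrite in_fsetD1 eq_sym xy0.
rewrite (big_fsetD1 x0) // (@big_fsetD1 _ _ _ _ y0 (Z `\ x0)%fset) //.
have := rowge x0 y0 yZ; have := rowge y0 x0 xZ; rewrite (Fs y0 x0).
have : 0 <= \sum_(j <- ((Z `\ x0) `\ y0)%fset) \sum_(y <- Z) F j y.
  by apply: sumr_ge0 => j _; apply: sumr_ge0.
rewrite /F /=; lra.
Qed.

End Flux.

(** * Functions of maximal slope *)

Lemma finite_set_bound (R : realType) (V : choiceType) (K : set V) (f : V -> R) :
  finite_set K -> exists B : R, forall k, K k -> `|f k| <= B.
Proof.
move=> Kf; exists (\sum_(k <- fset_set K) `|f k|) => k Kk.
rewrite (big_fsetD1 k) /=; last by rewrite in_fset_set //; exact/mem_set.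
by rewrite lerDl sumr_ge0.
Qed.

Lemma finite_argmin (R : realType) (V : choiceType) (K : set V) (F : V -> R) k0 :
  finite_set K -> K k0 -> exists2 k, K k & forall l, K l -> F k <= F l.
Proof.
move=> Kf Kk0.
have k0K : k0 \in fset_set K by rewrite in_fset_set //; exact/mem_set.
pose i0 : fset_set K := [` k0K]%fset.
case: (@Order.TotalTheory.arg_minP _ _ _ i0 xpredT (fun i => F (val i)) isT) => i _ imin.
exists (val i); first by have := valP i; rewrite in_fset_set // => /set_mem.
move=> l Kl; have lK : l \in fset_set K by rewrite in_fset_set //; exact/mem_set.
exact: (imin [` lK]%fset isT).
Qed.

Section Slope.
Context (R : realType) (V : countType) (G : graph R V).
Context (conn : connected_graph G) (lfin : locally_finite G).

Local Notation w := (weight G).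
Local Notation fl := (flux G).

(* The functions rising with maximal slope along [X] away from the finite
   set [K]. *)
Definition slope (f : V -> R) (X K : set V) : Prop :=
  [/\ Lip1 G f, endset G X K &
      forall x, X x -> exists2 k, K k & f x = f k + (dist G x k)%:R].

(** The first step of a geodesic from [x] to the point of [K] that determines [f x] loses at least
    1, and the Lipschitz bound forbids losing more. *)
Lemma slope_down f X K x : slope f X K -> X x ->
  exists y, [/\ adj G x y, X y \/ K y & f y = f x - 1].
Proof.
move=> [fL [Kf XK nX] fX] Xx; have [k Kk fx] := fX x Xx.
case dn : (dist G x k) => [|n].
  by move: Kk; rewrite -(dist0_eq conn dn) => /(XK _ Xx).
have [y xy yk] := distS_next conn dn; exists y; split=> //; first exact: nX Xx xy.
move: fx (fL k y) ((Lip1P conn f).1 fL _ _ xy) ((Lip1P conn f).1 fL y x).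
rewrite adjC => + + + /(_ xy); rewrite dn (dist_sym conn k) yk -natr1; lra.
Qed.

(** Unit descents terminate because [f] is bounded below on [X] by its bound on the finite set
    [K]. *)
Lemma slope_ind f X K (Q : V -> Prop) : slope f X K ->
    (forall k, K k -> Q k) ->
    (forall x y, X x -> adj G x y -> X y \/ K y -> f y = f x - 1 -> Q y -> Q x) ->
  forall x, X x -> Q x.
Proof.
move=> sf QK QX x Xx; have [fL [Kf XK nX] fX] := sf.
have [B fB] := finite_set_bound f Kf.
have fXB z : X z -> - B <= f z.
  move=> /fX[k /fB]; rewrite ler_norml => /andP[Bk _] ->.
  by rewrite (le_trans Bk) // lerDl.
have [n fn] : exists n : nat, f x + B < n%:R.
  exists (Num.bound (f x + B)); apply: archi_boundP.
  by rewrite -lerBlDr sub0r fXB.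
elim: n x Xx fn => [|n IH] x Xx fn.
  by have := fXB x Xx; lra.
have [y [xy XKy fy]] := slope_down sf Xx.
apply: (QX x y) => //; case: XKy => [Xy|/QK//].
by apply: IH => //; rewrite fy; move: fn; rewrite -natr1; lra.
Qed.

Lemma slope_sublevel f X K M : slope f X K -> finite_set [set x | X x /\ f x <= M].
Proof.
move=> [fL [Kf XK nX] fX]; have [B fB] := finite_set_bound f Kf.
apply: sub_finite_set (finite_ball_set conn lfin (Num.bound `|M + B|) Kf).
move=> x [Xx fM]; have [k Kk fx] := fX x Xx; exists k => //.
rewrite -(ler_nat R) dist_sym //.
have := archi_boundP (normr_ge0 (M + B)).
have := fB k Kk; rewrite ler_norml => /andP[Bk _].
have := ler_norm (M + B); lra.
Qed.

Definition clamp (n t : R) : R := Num.min (Num.max t 0) n.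

(** The part of [f] between the heights [r] and [r + n]. For [n = 1] it is a cutoff, and [clampS]
    splits it into [n] such cutoffs; this is how linear growth in [n] arises. *)
Definition level (X : set V) (f : V -> R) (n r : R) (x : V) : R :=
  \1_X x * clamp n (f x - r).

Lemma level_in X f n r x : X x -> level X f n r x = clamp n (f x - r).
Proof. by move=> Xx; rewrite /level indicE mem_set // mul1r. Qed.

Lemma level_out X f n r x : ~ X x -> level X f n r x = 0.
Proof. by move=> Xx; rewrite /level indicE memNset // mul0r. Qed.

Lemma clampP n t : 0 <= n ->
  [\/ t <= 0 /\ clamp n t = 0, [/\ 0 <= t, t <= n & clamp n t = t] |
      n <= t /\ clamp n t = n].
Proof.
move=> n0; rewrite /clamp; case: (leP t 0) => t0; first by constructor 1; rewrite min_l.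
case: (leP t n) => tn; first by constructor 2; rewrite // ltW.
by constructor 3; rewrite ltW.
Qed.

Lemma clampS (n : nat) t : clamp n.+1%:R t = clamp n%:R t + clamp 1 (t - n%:R).
Proof.
have n0 : 0 <= n%:R :> R by [].
rewrite -natr1; have n1 : 0 <= n%:R + 1 :> R by rewrite addr_ge0.
case: (clampP t n1) => [[? ->]|[? ? ->]|[? ->]];
case: (clampP t n0) => [[? ->]|[? ? ->]|[? ->]];
case: (clampP (t - n%:R) ler01) => [[? ->]|[? ? ->]|[? ->]]; lra.
Qed.

Lemma clamp_homo n t s : 0 <= n -> t <= s -> clamp n t <= clamp n s.
Proof.
move=> n0 ts.
case: (clampP t n0) => [[? ->]|[? ? ->]|[? ->]];
case: (clampP s n0) => [[? ->]|[? ? ->]|[? ->]]; lra.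
Qed.

Lemma clamp_lip n t s : 0 <= n -> t <= s -> clamp n s - clamp n t <= s - t.
Proof.
move=> n0 ts.
case: (clampP t n0) => [[? ->]|[? ? ->]|[? ->]];
case: (clampP s n0) => [[? ->]|[? ? ->]|[? ->]]; lra.
Qed.

Lemma clamp_ge0 n t : 0 <= n -> 0 <= clamp n t.
Proof. by move=> n0; case: (clampP t n0) => [[? ->]|[? ? ->]|[? ->]]. Qed.

Lemma clamp_le n t : 0 <= n -> clamp n t <= n.
Proof. by move=> n0; case: (clampP t n0) => [[? ->]|[? ? ->]|[? ->]]. Qed.

Lemma level0 X f r : level X f 0 r = fun=> 0.
Proof.
apply/funext => x; rewrite /level.
rewrite /clamp min_r ?mulr0 //; first by rewrite le_max lexx orbT.
Qed.

Lemma level_cutoff f X K r : slope f X K -> cutoff X (level X f 1 r).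
Proof.
move=> sf; split=> [x|x|].
- have [Xx|Xx] := pselect (X x); last by rewrite level_out // lexx ler01.
  by rewrite level_in // clamp_ge0 ?clamp_le.
- exact: level_out.
- apply: sub_finite_set (slope_sublevel (r + 1) sf) => x /= [Xx].
  rewrite level_in // => cx; split=> //.
  by case: (@clampP 1 (f x - r)) => // [[]|[]|[]//]; lra.
Qed.

Lemma level_gradn f X K (n : nat) r : slope f X K -> fingrad G (level X f n%:R r).
Proof.
move=> sf; have [_ e _] := sf; elim: n => [|n IH].
  by exists fset0 => x y _; rewrite level0 eqxx.
have -> : level X f n.+1%:R r = (fun x => level X f n%:R r x + level X f 1 (r + n%:R) x).
  by apply/funext => x; rewrite /level clampS mulrDr opprD addrA.
by apply: fingradD => //; apply: cutoff_fingrad e _ => //; exact: level_cutoff sf.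
Qed.

Lemma flux_levelS f X K g (n : nat) r : slope f X K ->
  fl (level X f n.+1%:R r) g = fl (level X f n%:R r) g + fl (level X f 1 (r + n%:R)) g.
Proof.
move=> sf; have [_ e _] := sf.
rewrite -fluxDl //; last 2 first.
- exact: level_gradn sf.
- by apply: cutoff_fingrad e _ => //; exact: level_cutoff sf.
congr flux; apply/funext => x.
by rewrite /level clampS mulrDr opprD addrA.
Qed.

Definition degree (x : V) : R := \sum_(y <- nbr G x) w x y.

Lemma degree_ge0 x : 0 <= degree x.
Proof. by apply: sumr_ge0 => y _; exact: weight_ge0. Qed.

Lemma mlap_le_degree g x : (forall y, adj G x y -> g y - g x <= 1) ->
  mlap G g x <= degree x.
Proof.
move=> g1; rewrite /mlap /degree !big_seq; apply: ler_sum => y.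
by rewrite in_nbr // => xy; rewrite ler_piMr ?weight_ge0 ?g1.
Qed.

Lemma mlap_le0 g x : (forall y, adj G x y -> g y <= g x) -> mlap G g x <= 0.
Proof.
move=> g1; rewrite /mlap big_seq sumr_le0 // => y.
by rewrite in_nbr // => xy; rewrite mulr_ge0_le0 ?weight_ge0 ?subr_le0 ?g1.
Qed.

Lemma mlap_le g h x : (forall y, adj G x y -> g y - g x <= h y - h x) ->
  mlap G g x <= mlap G h x.
Proof.
move=> gh; rewrite /mlap !big_seq; apply: ler_sum => y.
by rewrite in_nbr // => xy; rewrite ler_wpM2l ?weight_ge0 ?gh.
Qed.

Lemma mlap_eq g h x : (forall y, adj G x y -> g y - g x = h y - h x) ->
  mlap G g x = mlap G h x.
Proof.
move=> gh; rewrite /mlap !big_seq; apply: eq_bigr => y.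
by rewrite in_nbr // => xy; rewrite gh.
Qed.

Lemma flux_sum Z T g : grad_in G T Z ->
  fl T g = - (2 * \sum_(x <- Z) g x * mlap G T x).
Proof.
move=> TZ; rewrite (flux_energy lfin g TZ) energy_parts; congr (- (_ * _)).
rewrite big_seq [RHS]big_seq; apply: eq_bigr => x xZ; congr (_ * _).
rewrite (@mlap_sum _ _ _ lfin Z) // => y xy Txy.
by apply: grad_in_sym TZ xy _; rewrite eq_sym.
Qed.

(* Above height [r + 1] the level function is superharmonic; below, the bound
   does not depend on [n]. *)
Lemma slope_mlap_level f X K (n : nat) r x : slope f X K ->
    (forall x, X x -> mlap G f x <= 0) -> (forall k, K k -> f k <= r - 1) ->
  [\/ mlap G (level X f n%:R r) x <= 0 /\ X x, mlap G (level X f n%:R r) x = 0 |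
      [/\ X x, f x <= r + 1 & mlap G (level X f n%:R r) x <= degree x]].
Proof.
move=> [fL [Kf XK nX] fX] f0 fK; have n0 : 0 <= n%:R :> R by [].
have fL1 := (Lip1P conn f).1 fL.
have [Xx|nXx] := pselect (X x); last first.
  constructor 2; rewrite -[RHS](mlap_cst G 0 x); apply: mlap_eq => y xy.
  rewrite (level_out _ _ _ nXx) !subr0.
  have [Xy|nXy] := pselect (X y); last exact: level_out.
  rewrite level_in //; have yx : adj G y x by rewrite adjC.
  have [//|/fK] := nX _ _ Xy yx; have := fL1 _ _ xy.
  by case: (clampP (f y - r) n0) => [[? ->]|[? ? ->]|[? ->]]; lra.
have [fr|fr] := leP (f x) (r + 1).
  constructor 3; split=> //; apply: mlap_le_degree => y xy.
  have [Xy|nXy] := pselect (X y).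
    rewrite !level_in //; have := fL1 _ _ xy.
    have [ft|ft] := leP (f x) (f y).
      by have := @clamp_lip n%:R (f x - r) (f y - r) n0; lra.
    by have := @clamp_homo n%:R (f y - r) (f x - r) n0; lra.
  rewrite (level_in _ _ _ Xx) (level_out _ _ _ nXy).
  by have := clamp_ge0 (f x - r) n0; lra.
constructor 1; split=> //.
case: (clampP (f x - r) n0) => [[]|[f1 f2 fE]|[f1 fE]]; first lra.
  apply: le_trans (f0 _ Xx); apply: mlap_le => y xy.
  have yx : adj G y x by rewrite adjC.
  have := fL1 _ _ yx; have [Xy|/fK] := nX _ _ Xx xy; last lra.
  rewrite !level_in // fE.
  by case: (clampP (f y - r) n0) => [[? ->]|[? ? ->]|[? ->]]; lra.
apply: mlap_le0 => y xy; rewrite (level_in _ _ _ Xx) fE.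
have [Xy|nXy] := pselect (X y); last by rewrite level_out.
by rewrite level_in // clamp_le.
Qed.

(* [D_n = level X f n r] is the sum of [n] cutoffs, so a gap between the fluxes
   would make the flux of [f - g + c >= 0] through [D_n] drop linearly in [n],
   whereas the previous lemma bounds it from below. *)
Lemma slope_compare f g X K (c al : R) : slope f X K ->
    (forall x, X x -> mlap G f x <= 0) ->
    (forall x, X x -> - c <= f x - g x) ->
    (forall T, cutoff X T -> al <= fl T g) ->
  forall T, cutoff X T -> al <= fl T f.
Proof.
move=> sf f0 fg gal T cT; rewrite leNgt; apply/negP => fal.
have [fL e fX] := sf; have [Kf XK nX] := e.
have [B1 fB1] := finite_set_bound f Kf.
have [_ _ T1] := cT; have [B2 fB2] := finite_set_bound f T1.
(* Above height [r] the cutoff [T] is 1, so each unit level function starting at [r] or higher lies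
   below [T]; [B1 + 1] keeps [K] one unit under [r]. *)
pose r := Num.max (B1 + 1) B2.
have rK k : K k -> f k <= r - 1.
  move=> /fB1; rewrite ler_norml => /andP[_ fk].
  by rewrite lerBrDr (le_trans _ (_ : B1 + 1 <= r)) ?lerD2r // le_max lexx.
have rT x : X x -> r < f x -> T x = 1.
  move=> Xx rx; apply: contrapT => Tx; move: rx; apply/negP; rewrite -leNgt.
  have := fB2 _ (conj Xx Tx); rewrite ler_norml => /andP[_ fx].
  by rewrite (le_trans fx) // le_max lexx orbT.
have levT s x : r <= s -> level X f 1 s x <= T x.
  move=> rs; have [T01 T0 _] := cT.
  have [Xx|nXx] := pselect (X x); last by rewrite level_out // T0.
  rewrite level_in //; case: (ltP r (f x)) => rx; first by rewrite rT // clamp_le.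
  case: (@clampP 1 (f x - s)) => // [[? ->]|[? ? ->]|[? ->]].
  - by case/andP: (T01 x).
  - by have /andP[] := T01 x; lra.
  - by have /andP[] := T01 x; lra.
pose u x := f x - g x + c.
have u0 x : X x -> 0 <= u x by rewrite /u => /fg; lra.
have upper (n : nat) : fl (level X f n%:R r) u <= n%:R * (fl T f - al).
  elim: n => [|n IH].
    by rewrite mul0r level0 flux_cstl.
  rewrite (flux_levelS _ _ _ sf) -natr1 mulrDl mul1r lerD //.
  have cl := level_cutoff (r + n%:R) sf; have fcl := cutoff_fingrad conn lfin e cl.
  rewrite /u !fluxDr // fluxNr // flux_cstr // addr0 lerB //; last exact: gal.
  by apply: flux_mono e cT cl _ f0 => // x; apply: levT; rewrite lerDl.
pose F := fset_set [set x | X x /\ f x <= r + 1].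
pose C := \sum_(x <- F) (if x \in F then u x * degree x else 0).
have lower (n : nat) : - (2 * C) <= fl (level X f n%:R r) u.
  have [Z0 gZ0] := level_gradn n r sf.
  have gZ : grad_in G (level X f n%:R r) (Z0 `|` F)%fset.
    by apply: grad_inS gZ0; exact: fsubsetUl.
  rewrite (flux_sum _ gZ) lerN2 ler_pM2l // /C.
  rewrite (@big_fset_incl _ _ _ _ F (Z0 `|` F)%fset) ?fsubsetUr //; last first.
    by move=> x _ /negPf ->.
  apply: ler_sum => x _; have xF : X x -> f x <= r + 1 -> x \in F.
    move=> Xx fx; rewrite /F in_fset_set; first exact/mem_set.
    exact: slope_sublevel sf.
  have FX : x \in F -> X x.
    by rewrite /F in_fset_set; [move/set_mem => []|exact: slope_sublevel sf].
  have rhs0 : 0 <= if x \in F then u x * degree x else 0.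
    by case: ifP => // /FX Xx; rewrite mulr_ge0 ?u0 ?degree_ge0.
  have [[m0 Xx]|->|[Xx fx m1]] := slope_mlap_level n x sf f0 rK.
  - by apply: le_trans rhs0; rewrite mulr_ge0_le0 ?u0.
  - by rewrite mulr0.
  - by rewrite xF // ler_wpM2l ?u0.
have d0 : 0 < al - fl T f by lra.
pose n := Num.bound (`|2 * C| / (al - fl T f)).
have : `|2 * C| / (al - fl T f) < n%:R by apply: archi_boundP; rewrite divr_ge0 // ltW.
rewrite ltr_pdivrMr // => nC.
have := le_trans (lower n) (upper n); have := ler_norm (2 * C); lra.
Qed.

(** Inside [X] the level function is nondecreasing in [f]; with [r] above [K] this persists across
    the edges from [X] to [K]. *)
Lemma level_grad_ge0 f X K n r a b : 0 <= n -> slope f X K ->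
    (forall k, K k -> f k <= r) -> adj G a b ->
  0 <= (level X f n r b - level X f n r a) * (f b - f a).
Proof.
move=> n0 [fL [Kf XK nX] fX] fK.
have mon a' b' : adj G a' b' -> X a' ->
    0 <= (level X f n r b' - level X f n r a') * (f b' - f a').
  move=> ab' Xa'; have [Xb|Kb] := nX _ _ Xa' ab'.
    rewrite !level_in //; have [fab|fab] := leP (f a') (f b').
      by rewrite mulr_ge0 ?subr_ge0 // clamp_homo // lerD2r.
    by rewrite mulr_le0 ?subr_le0 // ?clamp_homo ?lerD2r // ltW.
  rewrite (level_in _ _ _ Xa') level_out; last by move=> /XK.
  case: (clampP (f a' - r) n0) => [[? ->]|[? ? ->]|[? ->]].
  - by rewrite subrr mul0r.
  - by rewrite mulr_le0 //; have := fK _ Kb; lra.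
  - by rewrite mulr_le0 //; have := fK _ Kb; lra.
move=> ab; have [Xa|nXa] := pselect (X a); first exact: mon.
have [Xb|nXb] := pselect (X b); last by rewrite !level_out // subrr mul0r.
by rewrite -mulrNN !opprB; apply: mon; rewrite // adjC.
Qed.

Lemma flux_level_ge0 f X K r : slope f X K -> (forall k, K k -> f k <= r) ->
  0 <= fl (level X f 1 r) f.
Proof.
move=> sf fK; have [_ e _] := sf.
have [Z TZ] := cutoff_fingrad conn lfin e (level_cutoff r sf).
rewrite (flux_energy lfin _ TZ) /energy sumr_ge0 // => x _; rewrite sumr_ge0 // => y _.
have [xy|/weight_nadj ->] := boolP (adj G x y); last by rewrite mul0r.
by rewrite mulr_ge0 ?weight_ge0 // (level_grad_ge0 ler01 sf).
Qed.

(** Far out in the infinite set [X] there is a descending edge of slope 1, which alone contributes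
    [2 * eps]; monotonicity of the flux carries this back to [T]. *)
Lemma slope_flux_ge f X K (eps : R) : slope f X K ->
    (forall x, X x -> mlap G f x <= 0) -> (forall x y, adj G x y -> eps <= w x y) ->
    ~ finite_set X ->
  forall T, cutoff X T -> 2 * eps <= fl T f.
Proof.
move=> sf f0 weps Xinf T cT.
have [fL e fX] := sf; have [Kf XK nX] := e; have [T01 T0 T1] := cT.
have [B1 fB1] := finite_set_bound f Kf; have [B2 fB2] := finite_set_bound f T1.
have [x [Xx fx]] : exists x, X x /\ Num.max B1 B2 + 1 < f x.
  apply: contrapT => nx; apply: Xinf.
  apply: sub_finite_set (slope_sublevel (Num.max B1 B2 + 1) sf) => x Xx /=.
  by split=> //; rewrite leNgt; apply/negP => fx; apply: nx; exists x.
have [y [xy XKy fy]] := slope_down sf Xx.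
have gtB z : f y <= f z -> B1 < f z /\ B2 < f z.
  have : B1 <= Num.max B1 B2 by rewrite le_max lexx.
  have : B2 <= Num.max B1 B2 by rewrite le_max lexx orbT.
  by split; lra.
have Kf' z : K z -> f z < f y.
  move=> Kz; rewrite ltNge; apply/negP => /gtB[+ _].
  by have := fB1 z Kz; rewrite ler_norml => /andP[_]; lra.
have Xy : X y by case: XKy => // /Kf'; rewrite ltxx.
have fL1 := (Lip1P conn f).1 fL.
have cl := level_cutoff (f y) sf.
have /le_trans : 2 * eps <= fl (level X f 1 (f y)) f.
  apply: le_trans (_ :
    2 * (w y x * ((level X f 1 (f y) x - level X f 1 (f y) y) * (f x - f y))) <= _).
    rewrite !level_in // subrr ler_pM2l // (_ : f x - f y = 1); last by rewrite fy; lra.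
    rewrite /clamp !maxxx (max_l ler01) minxx min_l // subr0 !mulr1.
    by apply: weps; rewrite adjC.
  apply: flux_ge_term => //.
  - exact: cutoff_fingrad e cl.
  - by move=> a b; apply: level_grad_ge0 ler01 sf _ => k /Kf'/ltW.
  - by rewrite adjC.
  - rewrite !level_in // subrr (_ : f x - f y = 1); last by rewrite fy; lra.
    by rewrite /clamp !maxxx (max_l ler01) minxx min_l // eq_sym oner_eq0.
apply; apply: flux_mono e cT cl _ f0 => // z.
have [Xz|nXz] := pselect (X z); last by rewrite level_out // T0.
rewrite level_in //; have [fz|fz] := leP (f y) (f z).
  suff -> : T z = 1 by rewrite clamp_le.
  apply: contrapT => Tz; have := fB2 _ (conj Xz Tz).
  by rewrite ler_norml => /andP[_]; have [] := gtB z fz; lra.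
case: (@clampP 1 (f z - f y)) => // [[? ->]|[]|[]]; try lra.
by case/andP: (T01 z).
Qed.

End Slope.

(** * Compactness of pointwise bounded sequences *)

Section Cluster.
Context (R : realType) (V : choiceType).

(** Tychonoff's theorem. Approximation on finite sets by arbitrarily late terms is all that is
    needed, so no subsequence is extracted. *)
Lemma cluster_pointwise (M : V -> R) (u : nat -> V -> R) :
    (forall n x, `|u n x| <= M x) ->
  exists f : V -> R, forall (F : {fset V}) (e : R) (N : nat), 0 < e ->
    exists2 n, (N <= n)%N & forall x, x \in F -> `|u n x - f x| < e.
Proof.
move=> uM; pose PT := prod_topology (fun _ : V => R : topologicalType).
have cA : @compact PT [set f | forall x, `[- M x, M x]%classic (f x)].
  apply: (@tychonoff V (fun=> R : topologicalType) (fun x => `[- M x, M x]%classic)) => x.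
  exact: segment_compact.
have [f [_ fcl]] : [set f | forall x, `[- M x, M x]%classic (f x)] `&`
    @cluster PT ((u : nat -> PT) @ \oo) !=set0.
  apply: cA; exists 0%N => // n _ x /=.
  by rewrite in_itv /= -ler_norml.
exists f => F e N e0.
have Fn : @nbhs _ PT f [set g | forall x, x \in F -> `|g x - f x| < e].
  rewrite (_ : mkset _ = \bigcap_(x in [set` F]) [set g : PT | `|g x - f x| < e]).
    apply: filter_bigI => x xF.
    apply: (@proj_continuous V (fun=> R : topologicalType) x f [set y : R | `|y - f x| < e]).
    apply/nbhs_ballP; exists e => //= y /=.
    by rewrite /ball /= distrC.
  by apply/seteqP; split=> g /= h x xF; exact: h.
have uN : ((u : nat -> PT) @ \oo) (u @` [set n | (N <= n)%N]).
  by exists N => // n Nn; exists n.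
by have [_ [[n /= Nn <-] h]] := fcl _ _ uN Fn; exists n.
Qed.

End Cluster.

(** * Existence of balanced functions *)

Lemma geometric_small (R : realType) (a B e : R) : 0 <= a -> a < 1 -> 0 < e ->
  exists n, a ^+ n * B <= e.
Proof.
move=> a0 a1 e0; have an : `|a| < 1 by rewrite ger0_norm.
have eB : 0 < e / (`|B| + 1) by rewrite divr_gt0 // ltr_wpDl.
have /cvgrPdist_le/(_ _ eB)[N _ /(_ N (leqnn N))] := cvg_expr an.
rewrite sub0r normrN ger0_norm ?exprn_ge0 // ler_pdivlMr ?ltr_wpDl // => h.
exists N; apply: le_trans h; apply: ler_wpM2l; first exact: exprn_ge0.
by rewrite (le_trans (ler_norm B)) // lerDl.
Qed.

Section Curvature.
Context (R : realType) (V : countType) (G : graph R V).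
Context (conn : connected_graph G) (lfin : locally_finite G).

Local Notation lap := (laplacian G).
Local Notation d x y := ((dist G x y)%:R : R).

(** The form in which curvature is used. It is free of the infimum and can be verified directly on
    the double cover. *)
Definition curv_ge0 : Prop := forall f x y,
  Lip1 G f -> adj G x y -> f y - f x = 1 -> lap f y <= lap f x.

Lemma vmeasV_ge0 x : 0 <= (vmeas G x)^-1.
Proof. by rewrite invr_ge0 ltW // vmeas_gt0. Qed.

Lemma mlap_le_add f g x c : (forall y, adj G x y -> g y - g x <= f y - f x + c) ->
  mlap G g x <= mlap G f x + c * degree G x.
Proof.
move=> gf; rewrite /mlap /degree big_distrr -big_split /= !big_seq.
apply: ler_sum => y; rewrite in_nbr // => xy.
by rewrite (mulrC c) -mulrDr ler_wpM2l ?weight_ge0 ?gf.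
Qed.

Lemma ollivier_curv_ge0 : nonneg_ollivier_curvature G -> curv_ge0.
Proof.
move=> curv f x y fL xy fxy; have := curv x y xy.
rewrite /ollivier_curvature dist_adj // invr1 mul1r.
set S := (X in inf X) => S0; rewrite -subr_ge0; apply: le_trans S0 _.
apply: ge_inf; last by exists f => //; split; rewrite ?dist_adj.
(* The real [inf] is a lower bound only if the set is bounded below; the degrees bound the
   Laplacians of 1-Lipschitz functions. *)
exists (- (degree G x / vmeas G x) - degree G y / vmeas G y) => _ [g [gL _] <-].
have gL1 := (Lip1P conn g).1 gL.
rewrite !laplacian_mlap // lerB //.
  rewrite -mulNr [leLHS]mulrC ler_wpM2l ?vmeasV_ge0 //.
  rewrite lerNl -mlapN; apply: mlap_le_degree => // z xz.
  by rewrite opprK addrC gL1 // adjC.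
by rewrite [leLHS]mulrC ler_wpM2r ?vmeasV_ge0 //; apply: mlap_le_degree => // z; exact: gL1.
Qed.

Context (curv : curv_ge0).

(** A gradient that is full between [x] and [y] is full along every edge of a geodesic, so the
    inequalities for edges chain up. *)
Lemma lap_gradient f x y : Lip1 G f -> f y - f x = d x y -> lap f y <= lap f x.
Proof.
move=> fL; move dn : (dist G x y) => n; elim: n x dn => [|n IH] x dn fxy.
  by rewrite (dist0_eq conn dn).
have [z xz zy] := distS_next conn dn.
have := fL z y; have := (Lip1P conn f).1 fL _ _ xz; rewrite zy => h1 h2.
rewrite -natr1 in fxy.
apply: (le_trans (IH z zy _)); first lra.
by apply: curv xz _ => //; lra.
Qed.

Definition rate x : R := degree G x / vmeas G x.

Lemma rate_ge0 x : 0 <= rate x.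
Proof. by rewrite mulr_ge0 ?vmeasV_ge0 //; exact: degree_ge0. Qed.

Lemma lap_le_add f g x c : (forall y, adj G x y -> g y - g x <= f y - f x + c) ->
  lap g x <= lap f x + c * rate x.
Proof.
move=> /mlap_le_add gf; rewrite !laplacian_mlap // /rate mulrA [X in _ + X]mulrC -mulrDr.
by rewrite ler_wpM2l ?vmeasV_ge0.
Qed.

(* Lowering [f] near [x] by the defect [delta] produces a 1-Lipschitz function
   with full gradient between [x] and [y]. *)
Lemma lap_defect f x y : Lip1 G f ->
  lap f y - lap f x <= (d x y - (f y - f x)) * (rate x + rate y).
Proof.
move=> fL; set delta := d x y - (f y - f x).
have de0 : 0 <= delta by rewrite subr_ge0.
pose h z := f y - d x y + d x z; pose g z := Num.min (f z) (h z).
have gf z : g z <= f z by rewrite /g ge_min lexx.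
have fg z : f z - delta <= g z.
  by rewrite /g le_min /h /delta; have := fL x z; move: de0; rewrite /delta; lra.
have gx : g x = f x - delta.
  by rewrite /g /h /delta distxx min_r; move: de0; rewrite /delta; lra.
have gy : g y = f y by rewrite /g /h min_l; lra.
have gL : Lip1 G g.
  move=> a b; have gh : g b <= h b by rewrite /g ge_min lexx orbT.
  have := fL a b; have := gf b; have := dist_triangleR conn a x b; move: gh.
  rewrite /g; case: (leP (f a) (h a)) => _; rewrite /h; lra.
have := lap_gradient gL (x := x) (y := y); rewrite gx gy => /(_ _)/wrap[].
  by rewrite /delta; lra.
move=> gyx.
have h1 : lap g x <= lap f x + delta * rate x.
  by apply: lap_le_add => z _; rewrite gx; have := gf z; lra.
have h2 : lap f y <= lap g y + delta * rate y.
  by apply: lap_le_add => z _; rewrite gy; have := fg z; lra.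
rewrite mulrDr; lra.
Qed.

Section McShane.
Context (K : set V) (k0 : V).
Context (Kfin : finite_set K) (Kk0 : K k0).

(** The McShane extension, the largest 1-Lipschitz one when [f] is 1-Lipschitz on [K]. Finiteness of
    [K] makes the infimum a minimum, hence slope 1 towards some point of [K]. *)
Definition mcshane (f : V -> R) (x : V) : R := inf [set f k + d x k | k in K].

Lemma mcshane_le f x k : K k -> mcshane f x <= f k + d x k.
Proof.
move=> Kk; apply: ge_inf; last by exists k.
have [B fB] := finite_set_bound f Kfin; exists (- B) => _ [l Kl <-].
by have := fB l Kl; rewrite ler_norml => /andP[Bl _]; rewrite (le_trans Bl) // lerDl.
Qed.

Lemma mcshane_attained f x : exists2 k, K k & mcshane f x = f k + d x k.
Proof.
set F := fun k => f k + d x k.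
have [k Kk kmin] := finite_argmin F Kfin Kk0.
exists k => //; apply/eqP; rewrite eq_le mcshane_le //=.
by apply: lb_le_inf; [exists (F k); exists k|move=> _ [l Kl <-]; exact: kmin].
Qed.

Lemma mcshane_Lip1 f : Lip1 G (mcshane f).
Proof.
move=> x y; have [k Kk ->] := mcshane_attained f x.
have := mcshane_le f y Kk; have := dist_triangleR conn x y k.
rewrite (dist_sym conn y x); lra.
Qed.

Lemma mcshane_mono f g c x : (forall k, K k -> f k <= g k + c) ->
  mcshane f x <= mcshane g x + c.
Proof.
move=> fg; have [k Kk ->] := mcshane_attained g x.
by have := mcshane_le f x Kk; have := fg k Kk; lra.
Qed.

Definition LipK (f : V -> R) : Prop :=
  forall k l, K k -> K l -> f l - f k <= d k l.

Lemma mcshane_id f k : LipK f -> K k -> mcshane f k = f k.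
Proof.
move=> fL Kk; apply/eqP; rewrite eq_le; apply/andP; split.
  by have := mcshane_le f k Kk; rewrite distxx addr0.
have [l Kl ->] := mcshane_attained f k; have := fL l k Kl Kk.
by rewrite (dist_sym conn l k); lra.
Qed.

Context (X Y : set V).
Context (eX : endset G X K) (eY : endset G Y K) (XY : forall x, X x -> ~ Y x).

(** The term [- mcshane (\- f)] is the smallest 1-Lipschitz extension, as [mcshane f] is the
    largest. *)
Definition extend (f : V -> R) (x : V) : R :=
  if `[< Y x >] then - mcshane (\- f) x else mcshane f x.

Lemma extendY f x : Y x -> extend f x = - mcshane (\- f) x.
Proof. by move=> Yx; rewrite /extend asboolT. Qed.

Lemma extendNY f x : ~ Y x -> extend f x = mcshane f x.
Proof. by move=> Yx; rewrite /extend asboolF. Qed.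

Lemma LipKN f : LipK f -> LipK (\- f).
Proof. by move=> fL k l Kk Kl /=; rewrite (dist_sym conn k l); have := fL l k Kl Kk; lra. Qed.

Lemma extendK f k : LipK f -> K k -> extend f k = f k.
Proof.
move=> fL Kk; rewrite /extend asboolF; last by have [_ YK _] := eY => /YK.
by rewrite mcshane_id.
Qed.

Lemma extendN_id f k : LipK f -> K k -> - mcshane (\- f) k = f k.
Proof. by move=> fL Kk; rewrite mcshane_id ?opprK //; exact: LipKN. Qed.

(** Only edges matter, and an edge leaving [Y] ends in [K], where the two extensions agree. *)
Lemma extend_Lip1 f : LipK f -> Lip1 G (extend f).
Proof.
move=> fL; apply/Lip1P => // x y xy.
have [_ YK nY] := eY; have yx : adj G y x by rewrite adjC.
have hi := (Lip1P conn _).1 (mcshane_Lip1 f) _ _ xy.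
have lo : - mcshane (\- f) y - - mcshane (\- f) x <= 1.
  by have := (Lip1P conn _).1 (mcshane_Lip1 (\- f)) _ _ yx; lra.
have [Yx|nYx] := pselect (Y x); have [Yy|nYy] := pselect (Y y).
- by rewrite !extendY.
- have [//|Ky] := nY _ _ Yx xy; rewrite (extendNY _ nYy) (extendY _ Yx).
  by rewrite (mcshane_id fL Ky) -[X in X - _](extendN_id fL Ky).
- have [//|Kx] := nY _ _ Yy yx; rewrite (extendNY _ nYx) (extendY _ Yy).
  by rewrite (mcshane_id fL Kx) -[X in _ - X](extendN_id fL Kx).
- by rewrite !extendNY.
Qed.

Lemma extend_mono f g c x : (forall k, K k -> f k <= g k + c) ->
  extend f x <= extend g x + c.
Proof.
move=> fg; rewrite /extend; case: ifP => _; last exact: mcshane_mono.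
have := @mcshane_mono (\- g) (\- f) c x; move/(_ _)/wrap => -[k Kk|] /=; last lra.
by have := fg k Kk; lra.
Qed.

Lemma extend_slopeX f : LipK f -> slope G (extend f) X K.
Proof.
move=> fL; split=> [||x Xx]; [exact: extend_Lip1|exact: eX|].
have [k Kk e] := mcshane_attained f x; exists k => //.
by rewrite (extendK fL Kk) extendNY //; exact: XY.
Qed.

Lemma extend_slopeY f : LipK f -> slope G (\- extend f) Y K.
Proof.
move=> fL; split=> [||y Yy]; [exact/Lip1N/extend_Lip1|exact: eY|].
have [k Kk e] := mcshane_attained (\- f) y; exists k => //.
by rewrite /= (extendK fL Kk) extendY // opprK e.
Qed.

Context (s : R) (s_gt0 : 0 < s).
Context (s_small : forall x y, K x -> K y -> s * (rate x + rate y) <= 1).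

(** One explicit Euler step of the heat equation; [s_small] makes it preserve order and the
    Lipschitz bound on [K]. *)
Definition flow (f : V -> R) (x : V) : R := extend f x + s * lap (extend f) x.

(** By [lap_defect] and the choice of [s], the step raises a difference by at most the room left
    below the distance. *)
Lemma flow_LipK f : LipK f -> LipK (flow f).
Proof.
move=> fL k l Kk Kl; rewrite /flow.
have eL := extend_Lip1 fL.
have := lap_defect k l eL; have := s_small Kk Kl.
have : 0 <= d k l - (extend f l - extend f k) by rewrite subr_ge0.
set de := d k l - (extend f l - extend f k) => de0 s1.
move/(ler_wpM2l (ltW s_gt0)); rewrite mulrCA => h.
have : de * (s * (rate k + rate l)) <= de by rewrite ler_piMr.
move: h; rewrite mulrBr /de; lra.
Qed.

Lemma lap_add_le f c x : (forall y, f y <= c) ->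
  f x + s * lap f x <= f x + s * (rate x * (c - f x)).
Proof.
move=> fc; rewrite lerD2l ler_wpM2l ?(ltW s_gt0) //.
apply: le_trans (@lap_le_add (fun=> 0) f x (c - f x) _) _ => [y _|].
  by rewrite subrr add0r lerD2r.
by rewrite laplacian_mlap // mlap_cst mulr0 add0r mulrC.
Qed.

Lemma lapB f g x : lap (fun z => f z - g z) x = lap f x - lap g x.
Proof.
rewrite !laplacian_mlap // -mulrBr; congr (_ * _).
by rewrite (mlapD G f (fun z => - g z)) mlapN.
Qed.

(** Discrete maximum principle: [u <= c] bounds the Laplacian of [u] at [k] by [rate k * (c - u k)],
    and [s * rate k <= 1]. *)
Lemma flow_mono f g c k : (forall k, K k -> f k <= g k + c) -> K k ->
  flow f k <= flow g k + c.
Proof.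
move=> fg Kk; rewrite /flow.
pose u z := extend f z - extend g z.
have uc z : u z <= c by rewrite /u; have := extend_mono z fg; lra.
have := lap_add_le k uc; rewrite {2}/u lapB.
have : s * rate k <= 1.
  apply: le_trans (s_small Kk Kk); rewrite ler_pM2l // lerDl; exact: rate_ge0.
move=> /(ler_wpM2r (_ : 0 <= c - u k)); rewrite subr_ge0 => /(_ (uc k)).
by rewrite mul1r -mulrA mulrBr /u; lra.
Qed.

Lemma flow_eps f g e k : (forall k, K k -> `|f k - g k| <= e) -> K k ->
  `|flow f k - flow g k| <= e.
Proof.
move=> fg Kk; have fg1 l (Kl : K l) := fg l Kl.
rewrite ler_norml; apply/andP; split.
  have := @flow_mono g f e k; move/(_ _ Kk)/wrap => -[l Kl|]; last lra.
  by have := fg l Kl; rewrite ler_norml => /andP[]; lra.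
have := @flow_mono f g e k; move/(_ _ Kk)/wrap => -[l Kl|]; last lra.
by have := fg l Kl; rewrite ler_norml => /andP[]; lra.
Qed.

Lemma flow_shift f c k : K k -> flow (fun x => f x + c) k = flow f k + c.
Proof.
move=> Kk; apply/eqP; rewrite eq_le; apply/andP; split.
  exact: flow_mono.
have := @flow_mono f (fun x => f x + c) (- c) k; move/(_ _ Kk)/wrap => -[l Kl|]; lra.
Qed.

Lemma LipKZ a f : 0 <= a <= 1 -> LipK f -> LipK (fun x => a * f x).
Proof.
move=> /andP[a0 a1] fL k l Kk Kl; rewrite -mulrBr.
by apply: le_trans (ler_wpM2l a0 (fL _ _ Kk Kl)) _; rewrite ler_piMl.
Qed.

Fixpoint damped (a : R) (n : nat) : V -> R :=
  if n is n'.+1 then fun x => a * flow (damped a n') x else fun=> 0.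

Lemma damped_LipK a n : 0 <= a <= 1 -> LipK (damped a n).
Proof.
move=> a01; elim: n => [|n IH] /=; first by move=> k l _ _; rewrite subrr.
by apply: LipKZ a01 _; exact: flow_LipK.
Qed.

(* The damped flow is a contraction, hence its iterates are almost fixed; as
   [1 - a] is small, the undamped flow moves them by almost a constant. *)
Lemma almost_stationary e : 0 < e ->
  exists f, LipK f /\
    forall k, K k -> `|(flow f k - f k) - (flow f k0 - f k0)| <= e.
Proof.
move=> e0; have [B fB] := finite_set_bound (flow (fun=> 0)) Kfin.
have B0 : 0 <= B by apply: le_trans (fB k0 Kk0).
have [D dD] := finite_set_bound (fun k => d k0 k) Kfin.
have D0 : 0 <= D by apply: le_trans (dD k0 Kk0).
(* Damping by [1 - q] leaves a drift [q * flow], whose values on [K] differ from the one at [k0] by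
   at most [q * D <= e / 2]. *)
pose q := e / (2 * (D + e)).
have De : 0 < 2 * (D + e) by lra.
have q0 : 0 < q by rewrite divr_gt0.
have q1 : q < 1 by rewrite ltr_pdivrMr //; lra.
have qD : q * D <= e / 2.
  rewrite mulrAC ler_pdivrMr //; have := mulr_ge0 (ltW e0) (ltW e0); lra.
pose a := 1 - q; have a01 : 0 <= a <= 1 by rewrite /a; apply/andP; split; lra.
have step n k : K k -> `|damped a n.+1 k - damped a n k| <= a ^+ n * B.
  elim: n k => [|n IH] k Kk.
    rewrite /= subr0 mul1r normrM ger0_norm; last by case/andP: a01.
    apply: le_trans (ler_wpM2l _ (fB k Kk)) _; first by case/andP: a01.
    by rewrite ler_piMl //; case/andP: a01.
  rewrite [damped a n.+2]/= [damped a n.+1]/= -mulrBr normrM ger0_norm; last by case/andP: a01.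
  rewrite exprS -mulrA ler_wpM2l //; first by case/andP: a01.
  exact: flow_eps.
have [n nB] : exists n, a ^+ n * B <= e / 4.
  by apply: geometric_small; rewrite ?divr_gt0 // /a; lra.
have aL := damped_LipK n a01.
exists (damped a n); split=> // k Kk.
have split_flow l : flow (damped a n) l - damped a n l =
    q * flow (damped a n) l + (damped a n.+1 l - damped a n l).
  by rewrite /= /a; ring.
rewrite !split_flow.
have h1 := step n k Kk; have h2 := step n k0 Kk0.
have h3 : `|flow (damped a n) k - flow (damped a n) k0| <= D.
  have fL := flow_LipK aL; have := dD k Kk; rewrite ger0_norm // => dk.
  rewrite ler_norml; apply/andP; split.
    have := fL k k0 Kk Kk0; rewrite (dist_sym conn k k0); lra.
  have := fL k0 k Kk0 Kk; lra.
have h4 : `|q * (flow (damped a n) k - flow (damped a n) k0)| <= e / 2.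
  by rewrite normrM (gtr0_norm q0) (le_trans _ qD) // ler_pM2l.
move: h1 h2 h4; rewrite mulrBr !ler_norml => /andP[? ?] /andP[? ?] /andP[? ?].
apply/andP; split; lra.
Qed.

Lemma stationary : exists f, LipK f /\
  forall k, K k -> lap (extend f) k = lap (extend f) k0.
Proof.
have esn (n : nat) : 0 < n.+1%:R^-1 :> R by rewrite invr_gt0.
have [fs fsP] : {fs : nat -> V -> R & forall n, LipK (fs n) /\
    forall k, K k -> `|(flow (fs n) k - fs n k) - (flow (fs n) k0 - fs n k0)| <= n.+1%:R^-1}.
  by apply: (choice (fun n => almost_stationary (esn n))).
(* Subtracting the value at [k0] bounds the sequence by the distance to [k0]; the value 0 off [K] is
   harmless because the flow reads its argument on [K] only. *)
pose u n x := if `[< K x >] then fs n x - fs n k0 else 0.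
have uK n k : K k -> u n k = fs n k - fs n k0 by move=> Kk; rewrite /u asboolT.
have uM n x : `|u n x| <= d k0 x.
  rewrite /u; case: asboolP => [Kx|_]; last by rewrite normr0.
  have [fL _] := fsP n; rewrite ler_norml; apply/andP; split.
    have := fL x k0 Kx Kk0; rewrite (dist_sym conn x k0); lra.
  exact: fL.
have uflow n k : K k -> flow (u n) k = flow (fs n) k - fs n k0.
  move=> Kk; rewrite -(flow_shift _ _ Kk); apply/eqP; rewrite -subr_eq0 -normr_le0.
  by apply: flow_eps Kk => l Kl; rewrite uK // subrr normr0.
have [f fcl] := cluster_pointwise uM; exists f.
have fapp (e : R) (N : nat) : 0 < e -> exists2 n, (N <= n)%N & forall k, K k -> `|u n k - f k| <= e.
  move=> e0; have [n Nn h] := fcl (fset_set K) e N e0; exists n => // k Kk.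
  by apply/ltW/h; rewrite in_fset_set //; exact/mem_set.
have fL : LipK f.
  move=> k l Kk Kl; apply/ler_addgt0Pr => e e0.
  have [|n _ h] := fapp (e / 2) 0%N; first by rewrite divr_gt0.
  have := h k Kk; have := h l Kl; rewrite !ler_norml => /andP[? ?] /andP[? ?].
  by have [+ _] := fsP n => /(_ k l Kk Kl); move: (uK n k Kk) (uK n l Kl); lra.
split=> // k Kk.
suff : flow f k - f k = flow f k0 - f k0.
  rewrite /flow !extendK // ![f _ + _ - _]addrAC !subrr !add0r.
  by move/(mulfI (lt0r_neq0 s_gt0)).
suff small (e : R) : 0 < e -> `|flow f k - f k - (flow f k0 - f k0)| <= e.
  apply/eqP; rewrite -subr_eq0 -normr_le0; apply/ler_addgt0Pr => e e0.
  by rewrite add0r small.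
move=> e0; have [N NE] : exists N : nat, N.+1%:R^-1 <= e / 2.
  have [N] : exists N : nat, 2 / e < N%:R.
    by exists (Num.bound (2 / e)); apply: archi_boundP; rewrite divr_ge0 // ltW.
  rewrite ltr_pdivrMr // => h; exists N.
  rewrite -div1r ler_pdivrMr // -[N.+1%:R]natr1.
  lra.
(* Four errors of [e / 8], for value and flow at [k] and at [k0], and [e / 2] from the almost
   stationarity of [fs n]. *)
have [|n Nn h] := fapp (e / 8) N; first by rewrite divr_gt0.
have nE : n.+1%:R^-1 <= e / 2.
  by apply: le_trans NE; rewrite lef_pV2 ?posrE // ler_nat.
have [_ /(_ k Kk)] := fsP n; rewrite -[_ - fs n k](_ : flow (u n) k - u n k = _); last first.
  by rewrite uflow // uK //; lra.
rewrite -[_ - fs n k0](_ : flow (u n) k0 - u n k0 = _); last first.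
  by rewrite uflow // uK //; lra.
have := h k Kk; have := h k0 Kk0.
have := flow_eps h Kk; have := flow_eps h Kk0.
move: nE; move: n.+1%:R^-1 => q nE.
rewrite !ler_norml => /andP[? ?] /andP[? ?] /andP[? ?] /andP[? ?] /andP[? ?].
by apply/andP; split; lra.
Qed.

End McShane.

Definition inf_mass (X : set V) : Prop :=
  forall M : R, exists F : {fset V}, (forall x, x \in F -> X x) /\
    M <= \sum_(x <- F) vmeas G x.

(** If [C] were negative, the flux would drop by at least [2 * - C] times the mass of [F] between
    [\1_X] and a level beyond [F]. The outer flux is non-negative, so the mass of [X] would be
    bounded. *)
Lemma slope_mass f X K C : slope G f X K -> inf_mass X ->
  (forall x, X x -> lap f x <= C) -> 0 <= C.
Proof.
move=> sf mX fC; rewrite leNgt; apply/negP => C0.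
have [fL e fX] := sf; have [Kf _ _] := e.
have [F [FX FM]] := mX ((flux G \1_X f + 1) / (- C)).
have [B1 fB1] := finite_set_bound f Kf.
have [B2 fB2] := finite_set_bound f (finite_fset F).
pose r := Num.max B1 B2.
have r1 k : K k -> f k <= r.
  move=> /fB1; rewrite ler_norml => /andP[_ h].
  by rewrite (le_trans h) // le_max lexx.
have cl := level_cutoff conn lfin r sf; have c1 := @cutoff_indic R V X.
have fcl := cutoff_fingrad conn lfin e cl; have fc1 := cutoff_fingrad conn lfin e c1.
have [Z TZ ZX] := cutoff_diff_supp c1 cl.
have := flux_level_ge0 conn lfin sf r1.
suff : 2 * - C * (\sum_(x <- F) vmeas G x) <= flux G \1_X f - flux G (level X f 1 r) f.
  have : flux G \1_X f + 1 <= - C * \sum_(x <- F) vmeas G x.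
    by move: FM; rewrite ler_pdivrMr ?oppr_gt0 // mulrC.
  have : 0 <= \sum_(x <- F) vmeas G x by apply: sumr_ge0 => x _; apply/ltW/vmeas_gt0.
  have /ltW C0' : 0 < - C by lra.
  move/(mulr_ge0 C0'); rewrite -mulrA; lra.
rewrite -fluxNl // -fluxDl //; last exact: fingradN.
rewrite (flux_supp lfin _ TZ) -mulrA -mulrN ler_pM2l // -sumrN.
have lev x : x \in F -> level X f 1 r x = 0.
  move=> xF; rewrite level_in; last exact: FX.
  have := fB2 x xF; rewrite ler_norml => /andP[_ h].
  have fr : f x - r <= 0 by rewrite subr_le0 (le_trans h) // le_max lexx orbT.
  by case: (clampP (f x - r) ler01) => [[? ->]|[? ? ->]|[]]; lra.
have FZ : (F `<=` Z)%fset.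
  apply/fsubsetP => x xF; apply: TZ; rewrite lev // subr0 indicE mem_set ?oner_eq0 //.
  exact: FX.
have mC x : X x -> mlap G f x <= C * vmeas G x.
  move=> /fC; rewrite laplacian_mlap // ler_pdivrMl ?vmeas_gt0 // mulrC.
  by rewrite [C * _]mulrC.
rewrite mulr_sumr.
pose H x := if x \in F then - C * vmeas G x else 0.
apply: le_trans (_ : \sum_(x <- Z) H x <= _).
  rewrite -(@big_fset_incl _ _ _ _ F Z) // => [|x _ /negPf xF]; last by rewrite /H xF.
  by rewrite big_seq [leRHS]big_seq; apply: ler_sum => x xF; rewrite /H xF.
rewrite big_seq [leRHS]big_seq; apply: ler_sum => x /ZX Xx; rewrite /H.
have h1 := mC x Xx; have m0 := vmeas_gt0 G x.
case: ifP => [xF|_].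
  by rewrite lev // subr0 indicE mem_set // mul1r; lra.
have [T0 _ _] := cl; have /andP[_ l1] := T0 x.
rewrite -mulrN mulr_ge0 //; first by rewrite indicE mem_set // subr_ge0.
have : C * vmeas G x <= 0 by rewrite mulr_le0_ge0 // ltW.
lra.
Qed.

Definition balanced (f : V -> R) (X Y K : set V) : Prop :=
  [/\ slope G f X K, slope G (fun x => - f x) Y K,
      forall x, X x -> mlap G f x <= 0, forall y, Y y -> 0 <= mlap G f y &
      forall k, K k -> mlap G f k = 0].

(* The Laplacian of a stationary function is constant on [K]; the infinite mass
   of the two ends forces the constant to vanish. *)
Lemma exists_balanced X Y K : finite_set K -> K !=set0 -> endset G X K ->
    endset G Y K -> (forall x, X x -> ~ Y x) -> inf_mass X -> inf_mass Y ->
  exists f, balanced f X Y K.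
Proof.
move=> Kf [k0 Kk0] eX eY XY mX mY.
have [B rB] := finite_set_bound rate Kf.
have B0 : 0 <= B by apply: le_trans (rB k0 Kk0).
pose s : R := (2 * B + 1)^-1.
have s0 : 0 < s by rewrite invr_gt0; lra.
have ss x y : K x -> K y -> s * (rate x + rate y) <= 1.
  move=> /rB + /rB; rewrite !ger0_norm ?rate_ge0 // => hx hy.
  by rewrite mulrC ler_pdivrMr ?mul1r; lra.
have [g [gL gK]] := stationary Kf Kk0 eY s0 ss.
set f := extend K Y g in gK.
have sX : slope G f X K by exact: (extend_slopeX Kf Kk0 eX eY XY gL).
have sY : slope G (fun x => - f x) Y K by exact: (extend_slopeY Kf Kk0 eY gL).
have lapN h x : lap (fun z => - h z) x = - lap h x.
  by rewrite !laplacian_mlap // mlapN mulrN.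
(* The gradient from a suitable point of [K] to [x] is full, so [lap_gradient] carries the constant
   value on [K] outwards. *)
have lX x : X x -> lap f x <= lap f k0.
  have [fL _ fX] := sX; move=> /fX[k Kk fk]; rewrite -(gK k Kk).
  by apply: lap_gradient fL _; rewrite fk (dist_sym conn k x); lra.
have lY y : Y y -> lap (fun x => - f x) y <= - lap f k0.
  have [fL _ fY] := sY; move=> /fY[k Kk fk]; rewrite -(gK k Kk) -lapN.
  by apply: lap_gradient fL _; rewrite fk (dist_sym conn k y); lra.
have C0 : lap f k0 = 0.
  apply/eqP; rewrite eq_le (slope_mass sX mX lX) andbT -oppr_ge0.
  exact: slope_mass sY mY lY.
have m_lap x : mlap G f x = vmeas G x * lap f x.
  by rewrite laplacian_mlap // mulrA divff ?mul1r // gt_eqF ?vmeas_gt0.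
exists f; split=> // [x Xx|y Yy|k Kk]; rewrite m_lap.
- by rewrite pmulr_rle0 ?vmeas_gt0 // -C0 lX.
- by have := lY y Yy; rewrite lapN C0 oppr0 oppr_le0 => ?; rewrite pmulr_rge0 ?vmeas_gt0.
- by rewrite gK // C0 mulr0.
Qed.

End Curvature.

(** * Ends *)

Lemma ler_sum_fsubset (R : realType) (T : choiceType) (A B : {fset T}) (F : T -> R) :
  (A `<=` B)%fset -> (forall x, x \in B -> 0 <= F x) ->
  \sum_(x <- A) F x <= \sum_(x <- B) F x.
Proof.
move=> AB F0; pose H x := if x \in A then F x else 0.
have -> : \sum_(x <- A) F x = \sum_(x <- B) H x.
  rewrite -(@big_fset_incl _ _ _ _ A B) // => [|x _ /negPf xA]; last by rewrite /H xA.
  by rewrite big_seq [RHS]big_seq; apply: eq_bigr => x xA; rewrite /H xA.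
rewrite big_seq [leRHS]big_seq; apply: ler_sum => x xB; rewrite /H.
by case: ifP => // _; exact: F0.
Qed.

Lemma in_fset_setP (T : choiceType) (A : set T) x : finite_set A ->
  reflect (A x) (x \in fset_set A).
Proof. by move=> Af; rewrite in_fset_set //; apply: (iffP idP) => [/set_mem|/mem_set]. Qed.

Section Ends.
Context (R : realType) (V : countType) (G : graph R V).
Context (conn : connected_graph G) (lfin : locally_finite G).
Context (curv : curv_ge0 G).

Local Notation d x y := ((dist G x y)%:R : R).

Lemma inf_mass_diff (X F : set V) : inf_mass G X -> finite_set F ->
  inf_mass G (X `\` F).
Proof.
move=> mX Ff M; pose m0 := \sum_(x <- fset_set F) vmeas G x.
have [Z [ZX ZM]] := mX (M + m0).
exists (Z `\` fset_set F)%fset; split.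
  move=> x; rewrite in_fsetD => /andP[xF /ZX Xx]; split=> // Fx.
  by case/negP: xF; rewrite in_fset_set //; exact/mem_set.
rewrite -(lerD2r m0); apply: le_trans ZM _.
rewrite (big_fsetID _ (fun x => x \notin fset_set F)) /= lerD //.
  apply: ler_sum_fsubset => [|x _]; last exact/ltW/vmeas_gt0.
  by apply/fsubsetP => x; rewrite !inE /= => /andP[-> ->].
apply: ler_sum_fsubset => [|x _]; last exact/ltW/vmeas_gt0.
by apply/fsubsetP => x; rewrite !inE /= negbK => /andP[].
Qed.

Definition split2 (X Y K : set V) : Prop :=
  [/\ finite_set K, K !=set0, forall x, [\/ X x, Y x | K x],
      forall x, [/\ X x -> ~ Y x, X x -> ~ K x & Y x -> ~ K x] &
      forall x y, X x -> Y y -> ~ adj G x y].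

Lemma split2_sym X Y K : split2 X Y K -> split2 Y X K.
Proof.
move=> [Kf K0 XYK D E]; split=> // [x|x|x y Yx Xy].
- by case: (XYK x); [constructor 2|constructor 1|constructor 3].
- by have [XY XK YK] := D x; split=> // Yx Xx; exact: XY Yx.
- by rewrite adjC; exact: E.
Qed.

Lemma split2_endset X Y K : split2 X Y K -> endset G X K.
Proof.
move=> [Kf K0 XYK D E]; split=> // [x|x y Xx xy]; first by case: (D x).
by case: (XYK y) => [||]; [left|move=> Yy; case: (E x y)|right].
Qed.

Lemma split2_grow X Y K F : split2 X Y K -> finite_set F ->
  split2 (X `\` (K `|` F)) (Y `\` (K `|` F)) (K `|` F).
Proof.
move=> [Kf [k0 Kk0] XYK D E] Ff; split.
- by rewrite finite_setU.
- by exists k0; left.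
- move=> x; have [KFx|nKFx] := pselect ((K `|` F) x); first by constructor 3.
  by case: (XYK x) => [Xx|Yx|Kx]; [constructor 1|constructor 2|case: nKFx; left].
- move=> x; have [XY _ _] := D x.
  by split=> [[Xx _] [Yx _]|[_ ?] //|[_ ?] //]; exact: XY.
- by move=> x y [Xx _] [Yy _]; exact: E.
Qed.

Lemma inf_massS (X X' : set V) : X `<=` X' -> inf_mass G X -> inf_mass G X'.
Proof.
by move=> XX' mX M; have [Z [ZX ZM]] := mX M; exists Z; split=> // x /ZX; exact: XX'.
Qed.

Lemma inf_mass_infinite X : inf_mass G X -> ~ finite_set X.
Proof.
move=> mX Xf; have [Z [ZX]] := mX (\sum_(x <- fset_set X) vmeas G x + 1).
apply/negP; rewrite -ltNge ltr_pwDr //.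
apply: ler_sum_fsubset => [|x _]; last exact/ltW/vmeas_gt0.
by apply/fsubsetP => x /ZX Xx; exact/in_fset_setP.
Qed.

Lemma inf_mass_union X A B : (forall x, X x -> A x \/ B x) -> inf_mass G X ->
  inf_mass G A \/ inf_mass G B.
Proof.
move=> XAB mX; have [|nA] := pselect (inf_mass G A); first by left.
right=> M; have [MA hA] : exists MA, forall F : {fset V}, (forall x, x \in F -> A x) ->
    \sum_(x <- F) vmeas G x < MA.
  apply: contrapT => h; apply: nA => MA; apply: contrapT => h2; apply: h.
  exists MA => F FA; rewrite ltNge; apply/negP => hF; apply: h2; by exists F.
have [F [FX FM]] := mX (M + MA).
exists [fset x in F | ~~ `[< A x >]]%fset; split.
  by move=> x; rewrite !inE /= => /andP[/FX/XAB[Ax|//]]; rewrite asboolT.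
move: FM; rewrite (big_fsetID _ (fun x => `[< A x >])) /=.
have : \sum_(x <- [fset x in F | `[< A x >]]%fset) vmeas G x < MA.
  by apply: hA => x; rewrite !inE /= => /andP[_ /asboolP].
lra.
Qed.

Lemma small_eq0 (c D : R) : (forall e, 0 < e -> `|c| <= e * D) -> c = 0.
Proof.
move=> h; apply/eqP; rewrite -normr_le0; apply/ler_addgt0Pr => e e0; rewrite add0r.
have D1 : 0 < `|D| + 1 by rewrite ltr_wpDl.
apply: le_trans (h (e / (`|D| + 1)) _) _; first by rewrite divr_gt0.
rewrite -mulrA ler_piMr ?(ltW e0) // mulrC ler_pdivrMr // mul1r.
by rewrite (le_trans (ler_norm D)) // lerDl.
Qed.

Lemma mlap_norm g x e : `|g x| <= e -> (forall y, adj G x y -> `|g y| <= e) ->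
  `|mlap G g x| <= e * (2 * degree G x).
Proof.
move=> gx gy; rewrite /mlap /degree 2!big_distrr; apply: le_trans (ler_norm_sum _ _ _) _.
rewrite big_seq [leRHS]big_seq; apply: ler_sum => y /=; rewrite in_nbr // => /gy gy'.
rewrite normrM (ger0_norm (weight_ge0 _ _ _)) mulrA [leRHS]mulrC ler_wpM2l ?weight_ge0 //.
by apply: le_trans (ler_normB _ _) _; lra.
Qed.

Lemma energy_norm Z T g e : (forall x, 0 <= T x <= 1) ->
    (forall x, x \in Z -> `|g x| <= e) ->
  `|energy G Z T g| <= e * (2 * \sum_(x <- Z) \sum_(y <- Z) weight G x y).
Proof.
move=> T01 ge; rewrite /energy mulrA big_distrr; apply: le_trans (ler_norm_sum _ _ _) _.
rewrite big_seq [leRHS]big_seq; apply: ler_sum => x xZ.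
rewrite big_distrr; apply: le_trans (ler_norm_sum _ _ _) _.
rewrite big_seq [leRHS]big_seq; apply: ler_sum => y yZ /=.
rewrite !normrM (ger0_norm (weight_ge0 _ _ _)) [leRHS]mulrC ler_wpM2l ?weight_ge0 //.
have h1 : `|T y - T x| <= 1.
  have /andP[? ?] := T01 x; have /andP[? ?] := T01 y.
  by rewrite ler_norml; apply/andP; split; lra.
have h2 : `|g y - g x| <= e * 2.
  by apply: le_trans (ler_normB _ _) _; have := ge x xZ; have := ge y yZ; lra.
by apply: le_trans (ler_wpM2r (normr_ge0 _) h1) _; rewrite mul1r.
Qed.

(** The function [1 - T - T'] has finite support, so a harmonic function has no flux through it:
    what enters at one end leaves through the other. *)
Lemma flux_opp X X' K T T' h : endset G X K -> endset G X' K ->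
    (forall x, [\/ X x, X' x | K x]) -> (forall x, X x -> ~ X' x) ->
    cutoff X T -> cutoff X' T' -> (forall x, mlap G h x = 0) ->
  flux G T h + flux G T' h = 0.
Proof.
move=> eX eX' XXK XX' cT cT' h0.
have [Kf _ _] := eX; have [_ T0 T1] := cT; have [_ T0' T1'] := cT'.
have fT := cutoff_fingrad conn lfin eX cT; have fT' := cutoff_fingrad conn lfin eX' cT'.
pose F := K `|` ([set x | X x /\ T x <> 1] `|` [set x | X' x /\ T' x <> 1]).
have Ff : finite_set F by rewrite !finite_setU.
have supp : supp_in (fun x => 1 + - (T x + T' x)) (fset_set F).
  move=> x /eqP nz; apply/in_fset_setP => //.
  have [Xx|Xx'|Kx] := XXK x; last by left.
    right; left; split=> // Tx; apply: nz.
    by rewrite Tx T0' ?addr0 ?subrr //; exact: XX'.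
  right; right; split=> // Tx; apply: nz.
  by rewrite Tx T0 ?add0r ?subrr // => /XX'.
have fTT' := fingradD fT fT'.
have f1 : fingrad G (fun=> 1 : R) by exists fset0 => x y _; rewrite eqxx.
rewrite -fluxDl //; apply/eqP; rewrite -oppr_eq0 -fluxNl //.
rewrite -[X in X == 0]add0r -[X in X + _](flux_cstl lfin 1 h) -fluxDl //; last exact: fingradN.
rewrite (flux_supp lfin _ supp) oppr_eq0 mulf_eq0 big1 ?eqxx ?orbT //.
by move=> x _; rewrite h0 mulr0.
Qed.

Lemma slope_subset f X X' K : slope G f X K -> X' `<=` X -> endset G X' K ->
  slope G f X' K.
Proof. by move=> [fL _ fX] X'X e; split=> // x /X'X/fX. Qed.

(** [f] rises from [K] with slope 1 and [g] no faster, so the values on [K] bound [f - g] from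
    below. *)
Lemma slope_minus_bounded f g X K : slope G f X K -> Lip1 G g ->
  exists c : R, forall x, X x -> - c <= f x - g x.
Proof.
move=> [fL [Kf _ _] fX] gL; have [c hc] := finite_set_bound (fun x => f x - g x) Kf.
exists c => x /fX[k Kk ->]; have := hc k Kk; rewrite ler_norml => /andP[h _].
by have := gL k x; rewrite (dist_sym conn k x); lra.
Qed.

(* [h] is a limit of the balanced functions of an exhaustion of the graph by
   finite sets [Kn]; their flux through [Kn] does not drop below [al]. *)
Lemma exists_harmonic X Y K f : split2 X Y K -> inf_mass G X -> inf_mass G Y ->
    balanced G f X Y K ->
  exists h, [/\ Lip1 G h, forall x, mlap G h x = 0 &
    forall al : R, (forall T, cutoff X T -> al <= flux G T f) -> al <= flux G \1_X h].
Proof.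
move=> sXY mX mY [sf _ f0 _ _].
have [Kf [x0 Kx0] XYK D E] := sXY.
pose F n := [set x | x \in pmap (choice.unpickle : nat -> option V) (iota 0 n)].
have Ff n : finite_set (F n) by exact: finite_seq.
pose Kn n := K `|` F n.
have Knf n : finite_set (Kn n) by rewrite finite_setU.
have sn n := split2_grow sXY (Ff n).
have ex n : exists u, balanced G u (X `\` Kn n) (Y `\` Kn n) (Kn n).
  apply: exists_balanced => //.
  - by exists x0; left.
  - exact: split2_endset (sn n).
  - exact/split2_endset/split2_sym/sn.
  - by have [_ _ _ Dn _] := sn n => x; have [] := Dn x.
  - exact: inf_mass_diff.
  - exact: inf_mass_diff.
have [fs fsP] := choice ex.
pose u n x := fs n x - fs n x0.
have fsL n : Lip1 G (fs n) by have [[]] := fsP n.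
have uL n : Lip1 G (u n).
  by move=> x y; have := fsL n x y; rewrite /u; lra.
have uM n x : `|u n x| <= d x x0 by exact: Lip1_normB.
have u_mlap n x : mlap G (u n) x = mlap G (fs n) x.
  exact: (mlap_addcst G (fs n) (- fs n x0) x).
have u_harm n x : (choice.pickle x < n)%N -> mlap G (u n) x = 0.
  move=> xn; rewrite u_mlap; have [_ _ _ _] := fsP n; apply; right.
  rewrite /F /= mem_pmap; apply/mapP; exists (choice.pickle x).
    by rewrite mem_iota.
  by rewrite choice.pickleK.
have [h hcl] := cluster_pointwise uM; exists h.
have happ (Z : {fset V}) (e : R) N : 0 < e -> exists2 n, (N <= n)%N &
    forall x, x \in Z -> `|u n x - h x| <= e.
  by move=> e0; have [n Nn H] := hcl Z e N e0; exists n => // x /H/ltW.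
split.
- move=> x y; apply/ler_addgt0Pr => e e0.
  have [|n _ H] := happ [fset x; y]%fset (e / 2) 0%N; first by rewrite divr_gt0.
  have := H x; have := H y; rewrite !inE !eqxx orbT => /(_ isT) + /(_ isT).
  by have := uL n x y; rewrite !ler_norml => ? /andP[? ?] /andP[? ?]; lra.
- move=> x; apply: (@small_eq0 _ (2 * degree G x)) => e e0.
  have [n xn H] := happ (x |` nbr G x)%fset e (choice.pickle x).+1 e0.
  have -> : mlap G h x = - mlap G (fun z => u n z - h z) x.
    by rewrite (mlapD G (u n) (fun z => - h z)) u_harm // add0r mlapN opprK.
  rewrite normrN; apply: mlap_norm => [|y xy]; apply: H; rewrite !inE ?eqxx //.
  by rewrite in_nbr // xy orbT.
- move=> al hal.
  have eX := split2_endset sXY; have cX := @cutoff_indic R V X.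
  have [Z TZ] := cutoff_fingrad conn lfin eX cX.
  have fcX : fingrad G \1_X by exists Z.
  suff flu n : al <= flux G \1_X (u n).
    set C := 2 * \sum_(x <- Z) \sum_(y <- Z) weight G x y.
    have h1 (e : R) : 0 < e -> al <= flux G \1_X h + e * C.
      move=> e0; have [n _ H] := happ Z e 0%N e0.
      have := flu n; have [c01 _ _] := cX.
      have := @energy_norm Z \1_X (fun x => u n x - h x) e c01 H.
      rewrite -(flux_energy lfin _ TZ) fluxDr // fluxNr // ler_norml => /andP[_].
      by rewrite -/C; lra.
    rewrite -subr_le0; apply/ler_addgt0Pr => e e0; rewrite add0r.
    have C1 : 0 < `|C| + 1 by rewrite ltr_wpDl.
    have := h1 (e / (`|C| + 1)) (divr_gt0 e0 C1).
    have : e / (`|C| + 1) * C <= e.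
      rewrite -mulrA ler_piMr ?(ltW e0) // mulrC ler_pdivrMr // mul1r.
      by rewrite (le_trans (ler_norm C)) // lerDl.
    by move=> ? ?; lra.
  have [snX _ nX _ nK] := fsP n; have eXn := split2_endset (sn n).
  have XnX : X `\` Kn n `<=` X by move=> x [].
  have XXn : finite_set (X `\` (X `\` Kn n)).
    by apply: sub_finite_set (Knf n) => x [Xx nXx]; apply: contrapT => nKx; apply: nXx.
  have cXn : cutoff (X `\` Kn n) (\1_(X `\` Kn n) : V -> R) :=
    @cutoff_indic R V _.
  have -> : flux G \1_X (u n) = flux G \1_X (fs n).
    by rewrite /u fluxDr // flux_cstr // addr0.
  (* Beyond [Kn n] the bound passes from [f] to [fs n] by [slope_compare]; harmonicity of [fs n] on
     [Kn n] brings it back to [\1_X]. *)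
  apply: (@le_trans _ _ (flux G \1_(X `\` Kn n) (fs n))).
    have [c hc] := slope_minus_bounded snX (let: And3 fL _ _ := sf in fL).
    apply: slope_compare snX nX hc _ _ cXn => // T cT.
    by apply: hal; exact: cutoff_sub cT XnX XXn.
  apply: flux_mono eX cX _ _ _ => //.
  + exact: cutoff_sub cXn XnX XXn.
  + move=> x; rewrite !indicE; have [XKx|XKx] := boolP (x \in X `\` Kn n); last by [].
    by rewrite mem_set //; move/set_mem: XKx => [].
  + move=> x Xx; have [Kx|Kx] := pselect (Kn n x); first by rewrite nK.
    exact: nX.
Qed.

Lemma cutoff_mask (X A : set V) (T : V -> R) : cutoff X T -> A `<=` X ->
  cutoff A (fun x => \1_A x * T x).
Proof.
move=> [T01 T0 T1] AX; split.
- move=> x; rewrite indicE; case: (x \in A); rewrite ?mul1r //.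
  by rewrite mul0r lexx ler01.
- by move=> x nAx; rewrite indicE memNset // mul0r.
- apply: sub_finite_set T1 => x [Ax]; rewrite indicE mem_set // mul1r => Tx.
  by split=> //; exact: AX.
Qed.

Context (eps : R) (eps_gt0 : 0 < eps).
Context (weps : forall x y, adj G x y -> eps <= weight G x y).

(* The flux of [h1] dominates that of [f1] far out in [A] and [B]: at least the
   flux of [h2] into [A], and at least [2 * eps] into [B]. *)
Lemma three_ends_step A B C K f1 h1 h2 :
    endset G A K -> endset G B K -> endset G C K ->
    (forall x, A x -> ~ B x) -> (forall x, A x -> ~ C x) ->
    (forall x, [\/ A x, (C `|` B) x | K x]) ->
    endset G (C `|` B) K ->
    ~ finite_set B -> balanced G f1 (A `|` B) C K ->
    (forall al : R, (forall T, cutoff (A `|` B) T -> al <= flux G T f1) ->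
      al <= flux G \1_(A `|` B) h1) ->
    Lip1 G h2 -> (forall x, mlap G h2 x = 0) ->
  flux G \1_(C `|` B) h2 + 2 * eps <= flux G \1_(A `|` B) h1.
Proof.
move=> eA eB eC AB AC ABCK eCB Binf [sf _ f0 _ _] h1P h2L h20.
apply: h1P => T cT; have [_ T0 _] := cT.
have AU : A `<=` A `|` B by left.
have BU : B `<=` A `|` B by right.
have cA := cutoff_mask cT AU; have cB := cutoff_mask cT BU.
have fA := cutoff_fingrad conn lfin eA cA; have fB := cutoff_fingrad conn lfin eB cB.
have sA := slope_subset sf AU eA; have sB := slope_subset sf BU eB.
have -> : T = (fun x => \1_A x * T x + \1_B x * T x).
  apply/funext => x; have [Ax|nA] := pselect (A x).
    have nB := AB x Ax.
    by rewrite !indicE mem_set // memNset // mul1r mul0r addr0.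
  have [Bx|nB] := pselect (B x).
    by rewrite !indicE memNset // mem_set // mul1r mul0r add0r.
  by rewrite !indicE !memNset // !mul0r add0r T0 // => -[].
rewrite fluxDl // lerD //; last first.
  by apply: (slope_flux_ge conn lfin sB) => // x Bx; apply: f0; right.
(* On [A] the comparison function is [- h2], whose flux through [A] is by [flux_opp] that of [h2]
   through the other two ends. *)
have [c hc] := slope_minus_bounded sA (Lip1N conn h2L).
apply: (slope_compare conn lfin sA _ hc) => // [x Ax|T' cT'].
  by apply: f0; left.
have fT' := cutoff_fingrad conn lfin eA cT'.
rewrite (fluxNr lfin _ fT').
have := flux_opp eA eCB ABCK _ cT' (@cutoff_indic R V _) h20.
by move=> /(_ _)/wrap[x Ax [Cx|Bx]|e]; [exact: AC Ax Cx|exact: AB Ax Bx|lra].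
Qed.

(** With [A] and [C] exchanged, [three_ends_step] puts each of two fluxes at least [2 * eps] above
    the other. [B] is only asked to be infinite, since a piece of [X] above a level comes without
    control of its mass. *)
Lemma no_three_ends A B C K : finite_set K -> K !=set0 ->
    (forall x, [\/ A x, B x, C x | K x]) ->
    (forall x, A x -> [/\ ~ B x, ~ C x & ~ K x]) ->
    (forall x, B x -> ~ C x /\ ~ K x) -> (forall x, C x -> ~ K x) ->
    (forall x y, adj G x y -> [/\ ~ (A x /\ B y), ~ (A x /\ C y) & ~ (B x /\ C y)]) ->
    inf_mass G A -> inf_mass G C -> ~ finite_set B -> False.
Proof.
move=> Kf K0 ABCK dA dB dC nE mA mC Binf.
have s1 : split2 (A `|` B) C K.
  split=> // [x|x|x y [Ax|Bx] Cy xy].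
  - by case: (ABCK x); [constructor 1; left|constructor 1; right|constructor 2|constructor 3].
  - split=> [[Ax|Bx]|[Ax|Bx]|Cx].
    + by case: (dA x Ax).
    + by case: (dB x Bx).
    + by case: (dA x Ax).
    + by case: (dB x Bx).
    + exact: dC.
  - by have [_ + _] := nE _ _ xy; apply.
  - by have [_ _ +] := nE _ _ xy; apply.
have s2 : split2 (C `|` B) A K.
  split=> // [x|x|x y [Cx|Bx] Ay xy].
  - by case: (ABCK x); [constructor 2|constructor 1; right|constructor 1; left|constructor 3].
  - split=> [[Cx|Bx] Ax|[Cx|Bx]|Ax].
    + by case: (dA x Ax).
    + by case: (dA x Ax).
    + exact: dC.
    + by case: (dB x Bx).
    + by case: (dA x Ax).
  - by rewrite adjC in xy; have [_ + _] := nE _ _ xy; apply.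
  - by rewrite adjC in xy; have [+ _ _] := nE _ _ xy; apply.
have nE' x y : adj G x y ->
    [/\ ~ (B x /\ A y), ~ (C x /\ A y) & ~ (C x /\ B y)].
  by rewrite adjC => /nE[h1 h2 h3]; split=> -[? ?]; [apply: h1|apply: h2|apply: h3].
have eA : endset G A K.
  split=> // [x|x y Ax xy]; first by case/dA.
  by case: (nE x y xy) => h1 h2 _; case: (ABCK y) => [|By|Cy|]; [left|case: h1|case: h2|right].
have eB : endset G B K.
  split=> // [x|x y Bx xy]; first by case/dB.
  case: (nE x y xy) => _ _ h; case: (nE' x y xy) => h' _ _.
  by case: (ABCK y) => [Ay||Cy|]; [case: h'|left|case: h|right].
have eC : endset G C K.
  split=> // x y Cx xy.
  case: (nE' x y xy) => _ h h'.
  by case: (ABCK y) => [Ay|By||]; [case: h|case: h'|left|right].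
have mAB : inf_mass G (A `|` B) by apply: inf_massS mA; left.
have mCB : inf_mass G (C `|` B) by apply: inf_massS mC; left.
have bal X Y : split2 X Y K -> inf_mass G X -> inf_mass G Y -> exists f, balanced G f X Y K.
  move=> sXY mX mY; apply: exists_balanced => //.
  - exact: split2_endset sXY.
  - exact/split2_endset/split2_sym/sXY.
  - by case: sXY => _ _ _ D _ x; case: (D x).
have [f1 b1] := bal _ _ s1 mAB mC.
have [f2 b2] := bal _ _ s2 mCB mA.
have [h1 [h1L h10 h1P]] := exists_harmonic s1 mAB mC b1.
have [h2 [h2L h20 h2P]] := exists_harmonic s2 mCB mA b2.
have := three_ends_step eA eB eC _ _ _ (split2_endset s2) Binf b1 h1P h2L h20.
move=> /(_ _ _ _)/wrap[x /dA[]//|x /dA[]//|x|step1].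
  by case: (ABCK x); [constructor 1|constructor 2; right|constructor 2; left|constructor 3].
have := three_ends_step eC eB eA _ _ _ (split2_endset s1) Binf b2 h2P h1L h10.
move=> /(_ _ _ _)/wrap[x Cx /dB[]//|x Cx /dA[]//|x|step2].
  by case: (ABCK x); [constructor 2; left|constructor 2; right|constructor 1|constructor 3].
move: step1 step2; move: (flux G _ h1) (flux G _ h2) => a b; move: eps_gt0; lra.
Qed.

End Ends.

(** * Vertex counts, dead ends and the maximum principle *)

Section Levels.
Context (R : realType) (V : countType) (G : graph R V).
Context (conn : connected_graph G) (lfin : locally_finite G).
Context (eps : R) (eps_gt0 : 0 < eps).
Context (weps : forall x y, adj G x y -> eps <= weight G x y).

Local Notation fl := (flux G).

Section OneEnd.
Context (f : V -> R) (X K : set V).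
Context (sf : slope G f X K) (f0 : forall x, X x -> mlap G f x <= 0).

Lemma flux_level_le_indic r : fl (level X f 1 r) f <= fl \1_X f.
Proof.
have [_ e _] := sf; have cl := level_cutoff conn lfin r sf.
apply: flux_mono e (@cutoff_indic R V X) cl _ f0 => // x.
have [Xx|nXx] := pselect (X x); last by rewrite level_out // indicE.
by rewrite level_in // indicE mem_set // clamp_le.
Qed.

(* Each vertex of the slab has a neighbour one unit below; the flux through
   the two unit slabs bounds the number of such edges. *)
Lemma level_count : exists r0 : R, exists N : nat, forall r (Z : {fset V}), r0 <= r ->
  (forall x, x \in Z -> X x /\ r < f x <= r + 1) -> (#|` Z| <= N)%N.
Proof.
have [fL e fX] := sf; have [Kf XK nX] := e.
have [B fB] := finite_set_bound f Kf.
exists (B + 1), (Num.bound (`|2 * fl \1_X f| / eps)) => r Z rB ZX.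
have fK k : K k -> f k <= r - 1.
  by move=> /fB; rewrite ler_norml => /andP[_]; lra.
set C := level X f 2%:R (r - 1).
have [Z0 CZ0] : fingrad G C by exact: level_gradn sf.
have flC : fl C f <= 2 * fl \1_X f.
  rewrite /C (flux_levelS conn lfin _ _ _ sf).
  have := flux_level_le_indic (r - 1); have := flux_level_le_indic (r - 1 + 1); lra.
have Cdown x : x \in Z -> exists y, [/\ adj G x y, C x != C y & (C y - C x) * (f y - f x) = 1].
  move=> /ZX[Xx /andP[f1 f2]]; have [y [xy XKy fy]] := slope_down conn sf Xx.
  have Xy : X y by case: XKy => // /fK; lra.
  have Cxy : C y - C x = -1.
    rewrite /C !level_in //.
    case: (@clampP _ 2 (f y - (r - 1))) => // [[? ->]|[? ? ->]|[? ->]];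
    case: (@clampP _ 2 (f x - (r - 1))) => // [[? ->]|[? ? ->]|[? ->]]; lra.
  exists y; split=> //; last by rewrite Cxy fy; lra.
  by apply/eqP => E; move: Cxy; rewrite E subrr; lra.
have ZZ0 : (Z `<=` Z0)%fset.
  by apply/fsubsetP => x /Cdown[y [xy Cxy _]]; exact: CZ0 xy Cxy.
pose F x y := weight G x y * ((C y - C x) * (f y - f x)).
have F0 x y : 0 <= F x y.
  rewrite /F; have [xy|/weight_nadj ->] := boolP (adj G x y); last by rewrite mul0r.
  by rewrite mulr_ge0 ?weight_ge0 // (level_grad_ge0 _ sf).
have : \sum_(x <- Z) eps <= fl C f.
  rewrite (flux_energy lfin _ CZ0) /energy.
  apply: (@le_trans _ _ (\sum_(x <- Z) \sum_(y <- Z0) F x y)).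
    rewrite big_seq [leRHS]big_seq; apply: ler_sum => x /Cdown[y [xy Cxy e1]].
    rewrite (big_fsetD1 y) /=; last exact: grad_in_sym CZ0 xy Cxy.
    rewrite {1}/F e1 mulr1 -[leLHS]addr0 lerD ?weps // sumr_ge0 //.
  by apply: ler_sum_fsubset => // x _; exact: sumr_ge0.
rewrite big_const_seq count_predT iter_addr_0 => cF.
have : eps *+ size Z <= `|2 * fl \1_X f|.
  by apply: le_trans cF (le_trans flC _); exact: ler_norm.
rewrite -[eps *+ _]mulr_natr [X in X <= _]mulrC -ler_pdivlMr // => h.
have := archi_boundP (divr_ge0 (normr_ge0 (2 * fl \1_X f)) (ltW eps_gt0)).
by move/(le_lt_trans h); rewrite ltr_nat => /ltnW.
Qed.

(* A finite component above a level would absorb flux at least [2 * eps]. *)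
Lemma no_dead_end : exists n0 : R, forall n (D : set V), n0 <= n -> finite_set D ->
  (forall x, D x -> X x /\ n < f x) ->
  (forall x y, D x -> adj G x y -> X y -> n < f y -> D y) -> D = set0.
Proof.
have [fL e fX] := sf; have [Kf XK nX] := e.
have [B fB] := finite_set_bound f Kf.
have fK k : K k -> f k <= B by move=> /fB; rewrite ler_norml => /andP[].
pose phi (j : nat) := fl (level X f 1 (B + j%:R)) f.
have phi0 j : 0 <= phi j.
  apply: (flux_level_ge0 conn lfin sf) => k /fK h.
  by rewrite (le_trans h) // lerDl.
(* The fluxes through the levels are non-negative, so beyond an almost minimal one less than
   [2 * eps] is left to absorb. *)
have [j0 hj0] : exists j0, forall j, phi j0 - 2 * eps < phi j.
  have lb : has_lbound (range phi) by exists 0 => _ [j _ <-].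
  have hi : has_inf (range phi) by split=> //; exists (phi 0%N), 0%N.
  have e2 : 0 < 2 * eps by rewrite mulr_gt0.
  have [_ [j0 _ <-] h] := inf_adherent e2 hi.
  exists j0 => j; rewrite ltrBlDr (lt_le_trans h) // lerD2r.
  by apply: ge_inf => //; exists j.
exists (B + j0%:R + 1) => n D nj Df DX Dcl.
rewrite -subset0 => x0 Dx0.
have [x Dx xmin] := finite_argmin f Df Dx0.
have [Xx nx] := DX x Dx.
have [y [xy XKy fy]] := slope_down conn sf Xx.
have nDy : ~ D y by move=> /xmin; rewrite fy; lra.
have Bn : B <= n by have := ler0n R j0; lra.
have suppD : supp_in (\1_D : V -> R) (fset_set D).
  move=> z; rewrite indicE; case: (boolP (z \in D)) => [/set_mem Dz _|_]; last by rewrite eqxx.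
  exact/in_fset_setP.
have [ZD gD] := supp_fingrad lfin suppD.
(* No edge leaving [D] leads upwards, since a higher neighbour would belong to [D]. *)
have monD a b : adj G a b -> 0 <= ((\1_D b : R) - \1_D a) * (f b - f a).
  have mon a' b' : adj G a' b' -> D a' -> ~ D b' -> f b' <= f a'.
    move=> ab Da nDb; have [Xa na] := DX _ Da.
    case: (nX _ _ Xa ab) => [Xb|/fK]; last lra.
    by rewrite leNgt; apply/negP => fab; apply: nDb; apply: Dcl Da ab Xb _; lra.
  move=> ab; rewrite !indicE.
  have [Da|nDa] := pselect (D a); have [Db|nDb] := pselect (D b).
  - by rewrite !mem_set // subrr mul0r.
  - rewrite (mem_set Da) (memNset nDb) sub0r mulN1r oppr_ge0 subr_le0; exact: mon nDb.
  - rewrite (memNset nDa) (mem_set Db) subr0 mul1r subr_ge0; apply: mon => //.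
    by rewrite adjC.
  - by rewrite !memNset // subrr mul0r.
have h1 : 2 * eps <= fl \1_D f.
  apply: le_trans (_ : 2 * (weight G x y * (((\1_D y : R) - \1_D x) * (f y - f x))) <= _).
    rewrite !indicE (mem_set Dx) (memNset nDy) fy ler_pM2l //.
    by rewrite sub0r mulN1r (_ : - _ = 1) ?mulr1 ?weps //; lra.
  apply: flux_ge_term => //; first by exists ZD.
  by rewrite !indicE (mem_set Dx) (memNset nDy) oner_eq0.
have [B2 fB2] := finite_set_bound f Df.
(* [D] lies between the levels [j0] and [j1], so the difference of the two cutoffs is 1 on [D], and
   at least the flux of [\1_D] is absorbed there. *)
have [j1 [j01 fj1]] : exists j1, (j0 <= j1)%N /\ forall z, D z -> f z <= B + j1%:R.
  exists (maxn j0 (Num.bound (`|B2 - B|))); split; first exact: leq_maxl.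
  move=> z /fB2; rewrite ler_norml => /andP[_ h].
  have := archi_boundP (normr_ge0 (B2 - B)); have := ler_norm (B2 - B).
  have : (Num.bound `|B2 - B|)%:R <= (maxn j0 (Num.bound `|B2 - B|))%:R :> R.
    by rewrite ler_nat leq_maxr.
  lra.
have := hj0 j1; apply/negP; rewrite -leNgt lerBrDr addrC -lerBrDr.
apply: le_trans h1 _.
have c0 := level_cutoff conn lfin (B + j0%:R) sf.
have c1 := level_cutoff conn lfin (B + j1%:R) sf.
have g0 := cutoff_fingrad conn lfin e c0; have g1 := cutoff_fingrad conn lfin e c1.
rewrite /phi -fluxNl // -fluxDl //; last exact: fingradN.
have [Z TZ ZX] := cutoff_diff_supp c0 c1.
have DC z : D z -> level X f 1 (B + j0%:R) z - level X f 1 (B + j1%:R) z = 1.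
  move=> Dz; have [Xz nz] := DX z Dz; rewrite !level_in //.
  have := fj1 z Dz.
  case: (@clampP _ 1 (f z - (B + j0%:R))) => // [[? ->]|[? ? ->]|[? ->]];
  case: (@clampP _ 1 (f z - (B + j1%:R))) => // [[? ->]|[? ? ->]|[? ->]]; lra.
have DZ : (fset_set D `<=` Z)%fset.
  by apply/fsubsetP => z /(in_fset_setP _ Df) Dz; apply: TZ; rewrite DC // oner_eq0.
rewrite (flux_supp lfin _ TZ) (flux_supp lfin _ suppD) -!mulrN ler_pM2l // -!sumrN.
apply: le_trans (_ : \sum_(z <- fset_set D)
    - ((level X f 1 (B + j0%:R) z - level X f 1 (B + j1%:R) z) *
      mlap G f z) <= _).
  rewrite big_seq [leRHS]big_seq; apply: ler_sum => z /(in_fset_setP _ Df) Dz.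
  by rewrite DC // indicE mem_set.
apply: ler_sum_fsubset => // z /ZX Xz; rewrite -mulrN mulr_ge0 ?oppr_ge0 ?f0 //.
rewrite subr_ge0 !level_in // clamp_homo // lerB // lerD2l ler_nat //.
Qed.

End OneEnd.

(** At a positive maximum over [Z] the terms of the Laplacian have one sign, so the value spreads
    along edges and, by connectedness, out of [Z]. *)
Lemma max_principle (Z : set V) u : finite_set Z -> (exists x, ~ Z x) ->
    (forall x, Z x -> mlap G u x = 0) ->
    (forall x y, Z x -> adj G x y -> ~ Z y -> u y <= 0) ->
  forall x, Z x -> u x <= 0.
Proof.
move=> Zf [x1 nZx1] u0 ub x0 Zx0.
have [x Zx xmax] := finite_argmin (\- u) Zf Zx0.
have {}xmax l : Z l -> u l <= u x by move=> /xmax; rewrite lerN2.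
rewrite leNgt; apply/negP => ux0.
have M0 : 0 < u x := lt_le_trans ux0 (xmax _ Zx0).
pose Q z := Z z /\ u z = u x.
suff : Q x1 by case.
apply: (adj_ind conn (x0 := x)) => // a b ab [Za ua].
have le_u c : adj G a c -> u c <= u a.
  move=> ac; rewrite ua; have [/xmax//|nZc] := pselect (Z c).
  by apply: le_trans (ub _ _ Za ac nZc) (ltW M0).
have term c : c \in nbr G a -> 0 <= weight G a c * (u a - u c).
  by rewrite in_nbr // => ac; rewrite mulr_ge0 ?weight_ge0 // subr_ge0 le_u.
have sum0 : \sum_(c <- nbr G a) weight G a c * (u a - u c) = 0.
  transitivity (- mlap G u a); last by rewrite u0 ?oppr0.
  by rewrite /mlap -sumrN; apply: eq_bigr => c _; rewrite -mulrN opprB.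
have bn : b \in nbr G a by rewrite in_nbr.
have : weight G a b * (u a - u b) <= 0.
  rewrite -sum0 (big_fsetD1 b) //= lerDl big_seq sumr_ge0 // => c.
  by rewrite in_fsetD1 => /andP[_ /term].
rewrite pmulr_rle0 //  subr_le0 => ab'.
have ubx : u b = u x by rewrite -ua; apply/eqP; rewrite eq_le ab' le_u.
split=> //; apply: contrapT => nZb; have := ub _ _ Za ab nZb; rewrite ubx; lra.
Qed.

End Levels.

(** * The double cover and connectedness of slabs *)

Section Cover.
Context (R : realType) (V : countType) (G : graph R V).
Context (c : V -> V -> bool) (cC : forall x y, c x y = c y x).

Definition cover_weight (p q : V * bool) : R :=
  if c p.1 q.1 == p.2 (+) q.2 then weight G p.1 q.1 else 0.

Fact cover_weight_ge0 p q : 0 <= cover_weight p q.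
Proof. by rewrite /cover_weight; case: ifP; rewrite ?weight_ge0. Qed.

Fact cover_weight_sym p q : cover_weight p q = cover_weight q p.
Proof. by rewrite /cover_weight cC addbC weight_sym. Qed.

Fact cover_weight_diag p : cover_weight p p = 0.
Proof. by rewrite /cover_weight weight_diag if_same. Qed.

(* The double cover in which crossing an edge marked by [c] switches sheets. *)
Definition cover : graph R (V * bool)%type :=
  @Graph R (V * bool)%type cover_weight (fun p => vmeas G p.1)
    cover_weight_ge0 cover_weight_sym cover_weight_diag
    (fun p => vmeas_gt0 G p.1).

Lemma cover_adj p q : adj cover p q = adj G p.1 q.1 && (c p.1 q.1 == p.2 (+) q.2).
Proof.
by rewrite /adj /= /cover_weight; case: ifP => _; rewrite ?andbT // ltxx andbF.
Qed.

Lemma cover_weightE p q : adj cover p q -> weight cover p q = weight G p.1 q.1.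
Proof. by rewrite cover_adj => /andP[_ h]; rewrite /= /cover_weight h. Qed.

Lemma cover_adj_lift x y i : adj G x y -> adj cover (x, i) (y, i (+) c x y).
Proof. by move=> xy; rewrite cover_adj /= xy addbA addbb eqxx. Qed.

Context (conn : connected_graph G) (lfin : locally_finite G).

Lemma cover_lfin : locally_finite cover.
Proof.
move=> [x i]; apply: (@sub_finite_set _ _
  ((fun y => (y, true)) @` [set y | adj G x y] `|`
   (fun y => (y, false)) @` [set y | adj G x y])).
  move=> [y []]; rewrite /= cover_adj /= => /andP[xy _]; [left|right];
  by exists y.
by rewrite finite_setU; split; apply: finite_image.
Qed.

Lemma cover_mlap F x i : mlap cover F (x, i) =
  \sum_(z <- nbr G x) weight G x z * (F (z, i (+) c x z) - F (x, i)).
Proof.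
rewrite /mlap.
have -> : nbr cover (x, i) = ((fun z => (z, i (+) c x z)) @` nbr G x)%fset.
  apply/fsetP => -[y j]; rewrite (in_nbr cover_lfin) cover_adj /=.
  apply/idP/imfsetP => [/andP[xy /eqP e]|[z /=]].
    by exists y; rewrite /= ?in_nbr // e addbA addbb.
  by rewrite in_nbr // => xz [-> ->]; rewrite xz addbA addbb eqxx.
rewrite big_imfset /=; last by move=> a b _ _ [].
rewrite big_seq [RHS]big_seq; apply: eq_bigr => z; rewrite in_nbr // => xz.
by rewrite /cover_weight /= addbA addbb eqxx.
Qed.

Lemma cover_walk_flip n x i y j : walk cover n (x, i) (y, j) ->
  walk cover n (x, ~~ i) (y, ~~ j).
Proof.
elim: n x i => [|n IH] x i.
  by move=> [[|? ?] []//= _ _ [-> ->]]; exact: walk0.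
move=> /walkS[[z k] xz /IH zy]; apply/walkS; exists (z, ~~ k) => //.
by move: xz; rewrite !cover_adj /= addNb addbN negbK.
Qed.

(** If both lifts of some vertex can be reached, exchanging the sheets connects everything;
    otherwise the sheet of the unique reachable lift is a potential for [c]. *)
Lemma cover_connected (x0 : V) :
  connected_graph cover \/
  exists tau : V -> bool, forall x y, adj G x y -> c x y = tau x (+) tau y.
Proof.
pose Rch p q := exists n, walk cover n p q.
have Rsym p q : Rch p q -> Rch q p by move=> [n pq]; exists n; exact: walk_sym.
have Rtrans q p r : Rch p q -> Rch q r -> Rch p r.
  by move=> [n pq] [m qr]; exists (n + m)%N; exact: walk_cat qr.
have Rflip x i y j : Rch (x, i) (y, j) -> Rch (x, ~~ i) (y, ~~ j).
  by move=> [n pq]; exists n; exact: cover_walk_flip.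
have Radj p q r : Rch p q -> adj cover q r -> Rch p r.
  by move=> pq qr; apply: Rtrans pq _; exists 1%N; exact: walk1.
have lift x : exists b, Rch (x0, false) (x, b).
  apply: (@adj_ind _ _ _ conn (fun x => exists b, Rch (x0, false) (x, b)) x0) => [|y z yz [b yb]].
    by exists false, 0%N; exact: walk0.
  by exists (b (+) c y z); apply: Radj yb (cover_adj_lift _ yz).
have [[x [xt xf]]|uniq_lift] := pselect (exists x, Rch (x0, false) (x, true) /\
    Rch (x0, false) (x, false)).
  left; have R0 : Rch (x0, false) (x0, true).
    by apply: Rtrans xt _; apply: Rsym; exact: (Rflip _ _ _ _ xf).
  have all p : Rch (x0, false) p.
    case: p => y b; have [b' yb'] := lift y.
    have [<-//|/negPf nb] := eqVneq b' b.
    have -> : b = ~~ b' by case: b b' nb {yb'} => -[].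
    exact: Rtrans R0 (Rflip _ _ _ _ yb').
  by move=> p q; exact: Rtrans (Rsym _ _ (all p)) (all q).
right; exists (fun x => `[< Rch (x0, false) (x, true) >]) => x y xy.
have tauE z b : Rch (x0, false) (z, b) -> `[< Rch (x0, false) (z, true) >] = b.
  case: b => zb; first exact/asboolP.
  by apply/asboolPn => zt; apply: uniq_lift; exists z.
have [b xb] := lift x; have yb := Radj _ _ _ xb (cover_adj_lift b xy).
by rewrite (tauE _ _ xb) (tauE _ _ yb) addbA addbb.
Qed.

Context (curv : curv_ge0 G).
Context (loc : forall x, exists tau : V -> bool, forall y z, adj G y z ->
  (dist G x y <= 5)%N -> c y z = tau y (+) tau z).

(* Curvature only sees the ball of radius [2], in which the cover is trivial. *)
Lemma cover_curv : connected_graph cover -> curv_ge0 cover.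
Proof.
move=> conn' F [x i] [y j] FL; rewrite cover_adj /= => /andP[xy /eqP cxy] Fxy.
have [tau htau] := loc x.
pose lift z := (z, i (+) tau x (+) tau z).
have liftx : lift x = (x, i) by rewrite /lift -addbA addbb addbF.
have lifty : lift y = (y, j).
  have e : tau x (+) tau y = i (+) j by rewrite -cxy htau ?distxx.
  rewrite /lift -addbA e.
  by rewrite addbA addbb.
(* Points of the ball of radius 2 are at distance at most 4, so the edges of a geodesic between them
   start within distance 5 of [x]: hence the radius in [loc]. *)
have lift_walk n k l : walk G n k l -> (dist G x k + n <= 6)%N ->
    walk cover n (lift k) (lift l).
  elim: n k => [|n IH] k; first by move=> [[|? ?] []//= _ _ ->] _; exact: walk0.
  move=> /walkS[z kz zl] kn; apply/walkS; exists (lift z).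
    rewrite cover_adj /= kz htau //; last by rewrite -ltnS (leq_trans _ kn) // addnS ltnS leq_addr.
    by case: (tau k); case: (tau z); case: (i); case: (tau x).
  apply: IH => //; apply: leq_trans kn; rewrite addnS -addSn leq_add2r.
  by have := dist_triangle conn k x z; rewrite (dist_adj conn kz) addn1.
pose B := [set z | (dist G x z <= 2)%N]; have Bf := finite_ball conn lfin x 2.
have Bx : B x by rewrite /B /= distxx.
have nB z : adj G x z -> B z by move=> xz; rewrite /B /= (dist_adj conn xz).
have nyB z : adj G y z -> B z.
  move=> yz; rewrite /B /=; apply: leq_trans (dist_triangle conn y x z) _.
  by rewrite (dist_adj conn xy) (dist_adj conn yz).
pose g0 z := F (lift z).
have g0L : LipK G B g0.
  move=> k l Bk Bl; apply: le_trans (FL _ _) _; rewrite ler_nat.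
  apply/dist_le_walk/lift_walk; first exact: walk_dist.
  rewrite (_ : 6 = 2 + (2 + 2))%N // leq_add //.
  apply: leq_trans (dist_triangle conn x k l) _.
  by rewrite (dist_sym conn k x) leq_add.
(* Extending from the ball gives a globally 1-Lipschitz function on [G] with the Laplacians of [F]
   at the two vertices. *)
pose g := mcshane G B g0.
have gE z : B z -> g z = g0 z by move=> Bz; exact: (mcshane_id conn Bf Bx).
have gL : Lip1 G g by exact: (mcshane_Lip1 conn Bf Bx).
have := curv gL xy; rewrite (gE y (nB _ xy)) (gE x Bx).
rewrite /g0 lifty liftx => /(_ Fxy).
rewrite !(laplacian_mlap lfin) !(laplacian_mlap cover_lfin) !cover_mlap /=.
have -> : mlap G g y = \sum_(z <- nbr G y) weight G y z * (F (z, j (+) c y z) - F (y, j)).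
  rewrite /mlap big_seq [RHS]big_seq; apply: eq_bigr => z; rewrite in_nbr // => yz.
  rewrite (gE z (nyB _ yz)) (gE y (nB _ xy)) /g0 lifty; congr (_ * (F _ - _)).
  rewrite /lift htau ?(dist_adj conn xy) //; congr (_, _).
  case: lifty => <-.
  by case: (i); case: (tau x); case: (tau y); case: (tau z).
have -> // : mlap G g x = \sum_(z <- nbr G x) weight G x z * (F (z, i (+) c x z) - F (x, i)).
rewrite /mlap big_seq [RHS]big_seq; apply: eq_bigr => z; rewrite in_nbr // => xz.
rewrite (gE z (nB _ xz)) (gE x Bx) /g0 liftx; congr (_ * (F _ - _)).
by rewrite /lift htau ?distxx // addbA.
Qed.

Lemma cover_inf_mass A b : inf_mass G A -> inf_mass cover [set p | A p.1 /\ p.2 = b].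
Proof.
move=> mA M; have [Z [ZA ZM]] := mA M.
exists ((fun z => (z, b)) @` Z)%fset; split.
  by move=> p /imfsetP[z /= /ZA Az ->].
by rewrite big_imfset //= => a a' _ _ [].
Qed.

End Cover.

Section Slab.
Context (R : realType) (V : countType) (G : graph R V).
Context (conn : connected_graph G) (lfin : locally_finite G).
Context (curv : curv_ge0 G).
Context (eps : R) (eps_gt0 : 0 < eps).
Context (weps : forall x y, adj G x y -> eps <= weight G x y).
Context (f : V -> R) (X Y K : set V).
Context (sXY : split2 G X Y K) (mX : inf_mass G X) (mY : inf_mass G Y).
Context (sf : slope G f X K) (f0 : forall x, X x -> mlap G f x <= 0).

(** A marked edge starts at a height within 1 of [r], and vertices up to 12 steps away from there
    must still lie in the slab; 15 leaves room for both. *)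
Let slab (r : R) : set V := [set z | X z /\ r - 15 < f z < r + 15].

Lemma two_ends_above r W W' :
    (forall x, X x -> r < f x -> W x \/ W' x) ->
    (forall x, W x -> [/\ X x, r < f x & ~ W' x]) ->
    (forall x, W' x -> X x /\ r < f x) ->
    (forall x y, W x -> W' y -> ~ adj G x y) ->
    inf_mass G W -> ~ finite_set W' -> False.
Proof.
move=> XW WX WX' WW' mW W'inf; have [Kf [k0 Kk0] XYK D E] := sXY.
apply: (@no_three_ends _ _ G conn lfin curv _ eps_gt0 weps W W' Y
  (K `|` [set x | X x /\ f x <= r])) => //.
- by rewrite finite_setU; split=> //; exact: (slope_sublevel conn lfin _ sf).
- by exists k0; left.
- move=> x; case: (XYK x) => [Xx|Yx|Kx]; [|by constructor 3|by constructor 4; left].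
  case: (leP (f x) r) => fx; first by constructor 4; right.
  by case: (XW x Xx fx); [constructor 1|constructor 2].
- move=> x Wx; have [Xx fx nW'] := WX x Wx; have [XY XK _] := D x.
  split=> // [/XY//|[/XK//|[_]]]; by rewrite leNgt fx.
- move=> x /WX'[Xx fx]; have [XY XK _] := D x.
  split=> // [/XY//|[/XK//|[_]]]; by rewrite leNgt fx.
- move=> x Yx; have [XY _ YK] := D x.
  by move=> [/(YK Yx)//|[Xx _]]; exact: XY Xx Yx.
- move=> x y xy; split=> [[Wx W'y]|[Wx Yy]|[W'x Yy]].
  + exact: WW' Wx W'y xy.
  + by have [Xx _ _] := WX x Wx; exact: E Xx Yy xy.
  + by have [Xx _] := WX' x W'x; exact: E Xx Yy xy.
Qed.

(* Otherwise cut the graph along [P] at height [r]. The double cover along this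
   cut has four ends if it is connected; if not, the cut separates the part of
   [X] above [r] into two pieces. *)
Lemma slab_clopen : exists n0 : R, forall r (P : set V), n0 <= r ->
  P `<=` slab r ->
  (forall x y, P x -> adj G x y -> slab r y -> P y) ->
  forall x y, P x -> r < f x -> X y -> r < f y < r + 15 -> P y.
Proof.
have [fL e fX] := sf; have [Kf XK nX] := e.
have [_ [k0 Kk0] XYK D E] := sXY.
have [B fB] := finite_set_bound f Kf.
have fK k : K k -> f k <= B by move=> /fB; rewrite ler_norml => /andP[].
have [D0 hD0] := finite_set_bound (fun k => (dist G k0 k)%:R : R) Kf.
have {}hD0 k : K k -> (dist G k0 k)%:R <= D0 by move=> /hD0; rewrite ger0_norm.
have D00 : 0 <= D0 by apply: le_trans (hD0 _ Kk0).
have [n1 dead] := no_dead_end conn lfin eps_gt0 weps sf f0.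
exists (Num.max n1 (B + D0 + 20)) => r P; rewrite ge_max => /andP[rn rB].
move=> PS Pcl x y Px rx Xy /andP[ry1 ry2].
apply: contrapT => nPy.
pose sg z := `[< r < f z >].
have sgT z : r < f z -> sg z = true by move=> h; exact/asboolP.
have sgF z : f z <= r -> sg z = false by move=> h; apply/asboolPn/negP; rewrite -leNgt.
pose c a b := [&& `[< P a >], `[< P b >] & sg a (+) sg b].
have cC a b : c a b = c b a by rewrite /c andbCA addbC.
have fL1 := (Lip1P conn f).1 fL.
have flip a b : adj G a b -> `|f a - f b| <= 1.
  by move=> ab; have := Lip1_normB conn a b fL; rewrite dist_adj.
have c_near a b : adj G a b -> c a b -> P a /\ `|f a - r| <= 1.
  move=> ab /and3P[/asboolP Pa _ sab]; split=> //.
  move: sab (flip _ _ ab); rewrite /sg !ler_norml.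
  by case: (asboolP (r < f a)) => ha; case: (asboolP (r < f b)) => hb //= _ /andP[h1 h2];
    move/negP: hb ha || move/negP: ha hb; rewrite -?leNgt => *; apply/andP; split; lra.
have loc z0 : exists tau : V -> bool, forall a b, adj G a b ->
    (dist G z0 a <= 5)%N -> c a b = tau a (+) tau b.
  (* Near the cut every vertex in reach lies in [P], so [sg] trivialises [c]; elsewhere no edge is
     marked. *)
  have [[z [Pz zz0 zr]]|nz] :=
      pselect (exists z, [/\ P z, (dist G z0 z <= 6)%N & `|f z - r| <= 1]).
    exists sg => a b ab za.
    have walkP n a' : walk G n z a' -> `|f z - r| + n%:R < 14 -> P a'.
      elim: n a' => [|n IH] a'; first by move=> [[|? ?] []//= _ _ <-].
      move/walk_sym/walkS => [a'' a'a'' /walk_sym wz] hn.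
      move: hn; rewrite -natr1 => hn.
      have Pa'' : P a'' by apply: IH => //; lra.
      have a''a' : adj G a'' a' by rewrite adjC.
      apply: (Pcl _ _ Pa'' a''a').
      have fa : `|f z - f a'| <= n%:R + 1.
        apply: le_trans (Lip1_normB conn z a' fL) _; rewrite natr1 ler_nat.
        by rewrite -addn1; exact: dist_le_walk (walk_cat wz (walk1 a''a')).
      have [Xa''  _] := PS _ Pa''; split.
        case: (nX _ _ Xa'' a''a') => // /fK fa'; exfalso; move: fa'.
        move: fa hn; rewrite !ler_norml => /andP[h1 h2].
        have := ler_norm (r - f z); rewrite (distrC r); lra.
      move: fa hn; rewrite !ler_norml => /andP[h1 h2].
      have := ler_norm (r - f z); rewrite (distrC r); have := ler_norm (f z - r).
      by move=> ? ? ?; apply/andP; split; lra.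
    have near a' : (dist G z0 a' <= 6)%N -> P a'.
      move=> h; apply: (walkP _ _ (walk_dist conn z a')).
      have : (dist G z a')%:R <= 12 :> R.
        rewrite (ler_nat R _ 12); apply: leq_trans (dist_triangle conn z0 z a') _.
        by rewrite (dist_sym conn z z0) (leq_add zz0 h).
      lra.
    have Pa : P a by apply: near; exact: leq_trans za _.
    have Pb : P b.
      apply: near; apply: leq_trans (dist_triangle conn a z0 b) _.
      by rewrite (dist_adj conn ab) addn1.
    by rewrite /c !asboolT.
  exists (fun=> false) => a b ab za; apply/negP => /(c_near _ _ ab)[Pa ar].
  by apply: nz; exists a; split=> //; exact: leq_trans za _.
have slabr z : P z -> r - 15 < f z < r + 15 by move=> /PS[].
have [conn'|[tau htau]] := cover_connected cC conn k0.
  (* The two lifts of the part of [X] above [r + 15] have infinite mass, and the whole preimage of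
     [Y] serves as third end. Marked edges lie near height [r], so no edge joins the two lifts. *)
  pose Ab b := [set p : V * bool | [set z | X z /\ r + 15 <= f z] p.1 /\ p.2 = b].
  have mAb b : inf_mass (cover G cC) (Ab b).
    apply: cover_inf_mass.
    apply: inf_massS (inf_mass_diff mX (slope_sublevel conn lfin (r + 15) sf)).
    move=> z [Xz nz]; split=> //; rewrite leNgt; apply/negP => /ltW fz.
    by apply: nz.
  have lfin' := cover_lfin cC lfin.
  have curv' := cover_curv conn lfin curv loc conn'.
  have weps' p q : adj (cover G cC) p q -> eps <= weight (cover G cC) p q.
    by move=> pq; rewrite cover_weightE //; move: pq; rewrite cover_adj => /andP[/weps].
  apply: (@no_three_ends _ _ _ conn' lfin' curv' _ eps_gt0 weps'
     (Ab false) [set p | Y p.1] (Ab true) [set p | K p.1 \/ (X p.1 /\ f p.1 < r + 15)]) => //.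
  - have Ff : finite_set (K `|` [set z | X z /\ f z <= r + 15]).
      by rewrite finite_setU; split=> //; exact: (slope_sublevel conn lfin _ sf).
    apply: (@sub_finite_set _ _ ((fun y => (y, true)) @` (K `|` [set z | X z /\ f z <= r + 15])
      `|` (fun y => (y, false)) @` (K `|` [set z | X z /\ f z <= r + 15]))).
      move=> [z b] /= h; have h' : (K `|` [set z | X z /\ f z <= r + 15]) z.
        by case: h => [|[? /ltW ?]]; [left|right].
      by case: b; [left|right]; exists z.
    by rewrite finite_setU; split; apply: finite_image.
  - by exists (k0, true); left.
  - move=> [z b]; case: (XYK z) => [Xz|Yz|Kz]; [|by constructor 2|by constructor 4; left].
    case: (ltP (f z) (r + 15)) => fz; first by constructor 4; right.
    by case: b; [constructor 3|constructor 1].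
  - move=> [z b] [/= [Xz fz] ->]; have [XY XK' _] := D z.
    split=> [/XY//|[_]//|[/XK'//|[_ /=]]]; by rewrite ltNge fz.
  - move=> [z b] /= Yz; have [XY _ YK] := D z.
    by split=> [[[/= /XY //]]|[/(YK Yz)//|[/XY]]].
  - move=> [z b] [/= [Xz fz] _] [/=|[_]]; [exact: XK|by rewrite ltNge fz].
  - move=> [z b] [z' b']; rewrite cover_adj /= => /andP[zz' /eqP cz].
    split.
    + by move=> [[/= [Xz _] _] Yz']; exact: E Xz Yz' zz'.
    + move=> [[/= [Xz fz] bf] [/= _ bt]].
      have [|Pz _] := c_near z z' zz'; first by rewrite cz bf bt.
      by have /andP[_] := slabr z Pz; rewrite ltNge fz.
    + by move=> [/= Yz [[/= Xz' _] _]]; move: zz'; rewrite adjC; exact: E Xz' Yz.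
  - apply: (@inf_mass_infinite _ _ (cover G cC)).
    by apply: inf_massS (cover_inf_mass cC false mY) => -[z b] [].
have c_low a b : f a <= r - 15 -> c a b = false.
  move=> fa; apply/negP => /and3P[/asboolP Pa _ _]; have /andP[] := slabr a Pa; lra.
(* A geodesic from [k0] to a point of [K] has length at most [D0] and so stays at heights up to
   [r - 15], where no edge is marked. *)
have tauK k : K k -> tau k = tau k0.
  move=> Kk; have : f k0 + (dist G k0 k)%:R <= r - 15.
    by have := hD0 k Kk; have := fK k0 Kk0; lra.
  have := walk_dist conn k0 k; move: (dist G k0 k) => n.
  elim: n (k0) => [|n IH] a; first by move=> [[|? ?] []//= _ _ ->].
  move=> /walkS[z az zk]; rewrite -natr1 => h.
  have n0 : 0 <= n%:R :> R by [].
  rewrite (IH z) //; last by have := fL1 _ _ az; lra.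
  by have := htau _ _ az; rewrite c_low; [case: (tau a); case: (tau z)|lra].
have low z : X z -> f z <= r -> tau z = tau k0.
  move: z; apply: (slope_ind conn sf) => [k Kk _|z y' Xz zy XKy fy IH fz]; first exact: tauK.
  have fy' : f y' <= r by lra.
  have := htau _ _ zy; rewrite /c (sgF _ fz) (sgF _ fy') !andbF IH //.
  by case: (tau z); case: (tau k0).
(* Unit descents from outside [P] do not enter [P], and those from [P] above [r] cross the cut once.
   So between [r] and [r + 15] the potential [tau] tells [P] from the rest. *)
have side z : X z -> ~ P z -> f z < r + 15 -> tau z = tau k0.
  move: z; apply: (slope_ind conn sf) => [k Kk _ _|z y' Xz zy XKy fy IH nPz fz]; first exact: tauK.
  have := htau _ _ zy; rewrite /c (asboolF nPz) /= IH; first by case: (tau z); case: (tau k0).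
    move=> Py; apply: nPz; apply: (Pcl _ _ Py); first by rewrite adjC.
    by split=> //; have /andP[] := slabr _ Py; rewrite fy => ? ?; apply/andP; split; lra.
  by rewrite fy; lra.
have high z : X z -> P z -> r < f z -> tau z <> tau k0.
  move: z; apply: (slope_ind conn sf) => [k Kk /PS[/XK]//|z y' Xz zy XKy fy IH Pz rz].
  have Xy' : X y' by case: XKy => // /fK; lra.
  have Py : P y'.
    apply: (Pcl _ _ Pz zy); split=> //; have /andP[] := slabr _ Pz; rewrite fy => ? ?.
    by apply/andP; split; lra.
  have := htau _ _ zy; rewrite /c (asboolT Pz) (asboolT Py) (sgT _ rz) /=.
  have [ry'|ry'] := ltP r (f y').
    by rewrite (sgT _ ry') /=; have := IH Py ry'; case: (tau z); case: (tau y'); case: (tau k0).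
  rewrite (sgF _ ry').
  by rewrite (low _ Xy' ry'); case: (tau z); case: (tau k0).
pose W b := [set z | [/\ X z, r < f z & (tau z == tau k0) = b]].
have Wedge b a a' : W b a -> adj G a a' -> X a' -> r < f a' -> W b a'.
  move=> [Xa ra ta] aa' Xa' ra'; split=> //; rewrite -ta.
  have := htau _ _ aa'; rewrite /c (sgT _ ra) (sgT _ ra') !andbF.
  by case: (tau a); case: (tau a').
(* Both pieces are infinite, as neither can be a dead end; infinite mass is only obtained for one of
   them. *)
have Winf b a : W b a -> ~ finite_set (W b).
  move=> Wa Wf; have : W b = set0.
    by apply: (dead r) => // [z []//|z z' Wz zz' Xz' rz']; exact: Wedge Wz zz' Xz' rz'.
  by move=> W0; rewrite W0 in Wa.
have [Xx _] := PS _ Px.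
have Wx : W false x by split=> //; apply/negP => /eqP; exact: high.
have Wy : W true y by split=> //; apply/eqP/side.
have WW b a : W b a -> ~ W (~~ b) a by move=> [_ _ h] [_ _]; rewrite h; case: b {h}.
have Wn b a a' : W b a -> W (~~ b) a' -> ~ adj G a a'.
  by move=> Wa Wa' aa'; have [Xa' ra' _] := Wa'; apply: (WW _ _ (Wedge _ _ _ Wa aa' Xa' ra')).
have cov b z : X z -> r < f z -> W b z \/ W (~~ b) z.
  move=> Xz rz; case h : ((tau z == tau k0) == b); [left|right];
  by split=> //; move: h; case: (tau z == tau k0); case: (b).
have [m|m] : inf_mass G (W true) \/ inf_mass G (W false).
  apply: inf_mass_union (inf_mass_diff mX (slope_sublevel conn lfin r sf)).
  move=> z [Xz nz]; apply: (cov true) => //; rewrite ltNge; apply/negP => fz.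
  by apply: nz.
- apply: (@two_ends_above r (W true) (W false)) => //;
    [exact: (cov true)| | |exact: (Wn true)|exact: Winf Wx].
    by move=> z Wz; have [? ? _] := Wz; split=> //; exact: (WW true).
  by move=> z [].
- apply: (@two_ends_above r (W false) (W true)) => //;
    [exact: (cov false)| | |exact: (Wn false)|exact: Winf Wy].
    by move=> z Wz; have [? ? _] := Wz; split=> //; exact: (WW false).
  by move=> z [].
Qed.

End Slab.

(** * Short paths in slabs and the quasi-isometry *)

Section SlabPath.
Context (R : realType) (V : countType) (G : graph R V).
Context (conn : connected_graph G) (lfin : locally_finite G).
Context (curv : curv_ge0 G).
Context (eps : R) (eps_gt0 : 0 < eps).
Context (weps : forall x y, adj G x y -> eps <= weight G x y).

Lemma descend f X K t x : slope G f X K -> (forall k, K k -> f k < t) ->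
  X x -> t <= f x ->
  exists x', [/\ X x', t <= f x' < t + 1 & (dist G x x')%:R <= f x - f x'].
Proof.
move=> sf fK; move: x; apply: (slope_ind conn sf) => [k /fK|x y Xx xy XKy fy IH tx].
  by move=> + tk; rewrite ltNge tk.
have [xt|tx1] := ltP (f x) (t + 1).
  by exists x; rewrite distxx // subrr tx xt.
have [|x' [Xx' x't dx']] := IH; first by lra.
exists x'; split=> //; have := dist_triangleR conn y x x'.
by rewrite (dist_adj conn xy); lra.
Qed.

Section OneEnd.
Context (f : V -> R) (X Y K : set V).
Context (sXY : split2 G X Y K) (mX : inf_mass G X) (mY : inf_mass G Y).
Context (sf : slope G f X K) (f0 : forall x, X x -> mlap G f x <= 0).

Lemma slab_count : exists r0 : R, exists N : nat, forall n r (Z : {fset V}), r0 <= r ->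
  (forall x, x \in Z -> X x /\ r < f x <= r + n%:R) -> (#|` Z| <= n * N)%N.
Proof.
have [r0 [N hN]] := level_count conn lfin eps_gt0 weps sf f0.
exists r0, N; elim=> [|n IH] r Z r0r ZX.
  rewrite leqn0 cardfs_eq0; apply/eqP/fsetP => x; rewrite in_fset0; apply/negP => /ZX[_].
  by rewrite addr0 => /andP[h /(lt_le_trans h)]; rewrite ltxx.
pose Z1 := [fset x in Z | (f x <= r + n%:R)%R]%fset.
pose Z2 := [fset x in Z | (r + n%:R < f x)%R]%fset.
have ZU : (Z `<=` Z1 `|` Z2)%fset.
  by apply/fsubsetP => x xZ; rewrite !inE /= xZ /=; case: (leP (f x)).
apply: leq_trans (fsubset_leq_card ZU) _; apply: leq_trans (leq_card_fsetU _ _) _.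
rewrite mulSn addnC leq_add //.
  apply: (hN (r + n%:R)); first by rewrite (le_trans r0r) // lerDl.
  move=> x; rewrite !inE /= => /andP[/ZX[Xx /andP[_ h]] ->]; split=> //.
  by rewrite -addrA natr1.
by apply: (IH r) => // x; rewrite !inE /= => /andP[/ZX[Xx /andP[-> _]] ->].
Qed.

(** [slab_clopen] applies to the set of vertices reachable from [x] inside the slab. A path without
    repetitions is no longer than the number of vertices available, at most [N] in each of 30 unit
    slabs. *)
Lemma slab_path : exists (n0 : R) (l : nat), forall r x y, n0 <= r ->
  X x -> X y -> r < f x < r + 15 -> r < f y < r + 15 ->
  exists s, [/\ path (adj G) x s, last x s = y, (size s <= l)%N &
    forall z, z \in x :: s -> X z /\ r - 15 < f z < r + 15].
Proof.
have [n1 clo] := slab_clopen conn lfin curv eps_gt0 weps sXY mX mY sf f0.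
have [r0 [N cnt]] := slab_count.
exists (Num.max n1 (r0 + 15)), (30 * N)%N => r x y; rewrite ge_max => /andP[n1r r0r].
move=> Xx Xy /andP[fx1 fx2] /andP[fy1 fy2].
pose S z := X z /\ r - 15 < f z < r + 15.
pose P := [set z | exists s, [/\ path (adj G) x s, last x s = z &
  forall z', z' \in x :: s -> S z']].
have Sx : S x by split=> //; apply/andP; split; lra.
have Px : P x by exists [::]; split=> // z'; rewrite inE => /eqP ->.
have [s [ps ls sS]] : P y.
  apply: (clo r P _ _ _ x) => //; last by rewrite fy1 fy2.
  - by move=> z [s [_ <- h]]; apply: h; exact: mem_last.
  - move=> a b [s [ps ls h]] ab Sb; exists (rcons s b); split.
    + by rewrite rcons_path ps ls.
    + by rewrite last_rcons.
    + by move=> z'; rewrite -rcons_cons mem_rcons inE => /orP[/eqP ->|/h].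
move: ls; case/shortenP: ps => s' ps' us' s's ls'; exists s'; split=> //; last first.
  by move=> z; rewrite inE => /orP[/eqP ->|/s's zs] //; apply: sS; rewrite inE zs orbT.
have <- : #|` [fset z in s']%fset| = size s'.
  by rewrite card_fseq undup_id //; case/andP: us'.
apply: (cnt 30 (r - 15)); first by lra.
move=> z; rewrite inE => /s's zs; have [|Xz /andP[z1 z2]] := sS z.
  by rewrite inE zs orbT.
by split=> //; rewrite z1 /= ltW // (lt_le_trans z2) //; lra.
Qed.

(** Descend from the higher vertex to within 1 of the height of the lower one, using no more steps
    than height lost, then join the two inside one slab. *)
Lemma end_lower_bound : exists (n0 l : R), forall x y, X x -> X y ->
  n0 <= f x -> n0 <= f y -> (dist G x y)%:R <= `|f x - f y| + l.
Proof.
have [n1 [l hl]] := slab_path; have [_ [Kf _ _] _] := sf.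
have [B fB] := finite_set_bound f Kf.
have fK k : K k -> f k <= B by move=> /fB; rewrite ler_norml => /andP[].
exists (Num.max (n1 + 1) (B + 1)), l%:R.
have ordered x y : X x -> X y -> Num.max (n1 + 1) (B + 1) <= f y -> f y <= f x ->
    (dist G x y)%:R <= `|f x - f y| + l%:R :> R.
  move=> Xx Xy; rewrite ge_max => /andP[n1y By] xy.
  have [k /fK|x' [Xx' /andP[x'1 x'2] dx']] := @descend f X K (f y) x sf _ Xx xy; first lra.
  have r1 : n1 <= f y - 1 by lra.
  have rx : f y - 1 < f x' < f y - 1 + 15 by apply/andP; split; lra.
  have ry : f y - 1 < f y < f y - 1 + 15 by apply/andP; split; lra.
  have [s [ps ls sl _]] := hl _ _ _ r1 Xx' Xy rx ry.
  have : (dist G x' y)%:R <= l%:R :> R.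
    by rewrite ler_nat; apply: leq_trans sl; apply: dist_le_walk; exists s.
  have := dist_triangleR conn x' x y; have := ler_norm (f x - f y); lra.
move=> x y Xx Xy nx ny; have [xy|/ltW xy] := leP (f y) (f x); first exact: ordered.
by rewrite (dist_sym conn) distrC; exact: ordered.
Qed.

End OneEnd.

(** For two vertices moved towards [K] from opposite sides, the changes of [f] add up. *)
Lemma opp_normD (a b : R) : a * b <= 0 -> `|a| + `|b| = `|a - b|.
Proof.
have [a0|a0] := leP 0 a; have [b0|b0] := leP 0 b => ab.
- have : a * b = 0 by apply/eqP; rewrite eq_le ab mulr_ge0.
  by move/eqP; rewrite mulf_eq0 => /orP[] /eqP ->;
    rewrite normr0 ?subr0 ?sub0r ?normrN ?addr0 ?add0r.
- by rewrite (ger0_norm a0) (ltr0_norm b0) ger0_norm //; lra.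
- by rewrite (ltr0_norm a0) (ger0_norm b0) ltr0_norm; lra.
- have : 0 < a * b by rewrite nmulr_rgt0.
  by move/(lt_le_trans)/(_ ab); rewrite ltxx.
Qed.

Lemma balanced_quasi_isometry f X Y K : split2 G X Y K ->
    inf_mass G X -> inf_mass G Y -> balanced G f X Y K ->
  quasi_isometry (fun x y : V => (dist G x y)%:R) (fun s t : R => `|s - t|) f.
Proof.
move=> sXY mX mY [sX sY fX0 fY0 _].
have [Kf [k0 Kk0] XYK D E] := sXY; have [fL _ _] := sX.
have [n1 [l1 h1]] := end_lower_bound sXY mX mY sX fX0.
have fY0' y : Y y -> mlap G (fun x => - f x) y <= 0.
  by move=> /fY0; rewrite mlapN oppr_le0.
have [n2 [l2 h2]] := end_lower_bound (split2_sym sXY) mY mX sY fY0'.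
have [B fB] := finite_set_bound f Kf.
have fK k : K k -> - B <= f k <= B by move=> /fB; rewrite ler_norml.
have [n [nB nn1 nn2]] : exists n : R, [/\ B + 1 <= n, n1 <= n & n2 <= n].
  by exists (Num.max (B + 1) (Num.max n1 n2)); rewrite !le_max !lexx !orbT.
pose Z := K `|` ([set x | X x /\ f x <= n + 1] `|` [set x | Y x /\ - f x <= n + 1]).
have Zf : finite_set Z.
  rewrite !finite_setU; split=> //; split; first exact: (slope_sublevel conn lfin _ sX).
  exact: (slope_sublevel conn lfin _ sY).
have [D0 hD0] := finite_set_bound (fun z => (dist G k0 z)%:R : R) Zf.
have diam a b : Z a -> Z b -> (dist G a b)%:R <= 2 * D0.
  move=> /hD0 ha /hD0 hb; have := dist_triangleR conn k0 a b.
  by rewrite (dist_sym conn a k0); move: ha hb; rewrite !ger0_norm //; lra.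
(* Vertices far out are moved into the finite set [Z] along descents. Unless both lie far out in the
   same end, their changes of [f] do not have the same strict sign, and [opp_normD] applies. *)
have retract x : exists x', [/\ Z x', (dist G x x')%:R <= `|f x - f x'| &
    [\/ x' = x, [/\ X x, n <= f x & f x' <= f x] | [/\ Y x, n <= - f x & f x <= f x']]].
  have [Zx|nZx] := pselect (Z x).
    by exists x; rewrite distxx // subrr normr0 lexx; split=> //; constructor 1.
  case: (XYK x) => [Xx|Yx|Kx]; last by case: nZx; left.
    have fx : n + 1 < f x.
      by rewrite ltNge; apply/negP => fx; apply: nZx; right; left.
    have [k /fK /andP[]|x' [Xx' /andP[x'1 x'2] dx']] :=
      @descend f X K n x sX _ Xx (ltW (lt_trans (ltr_pwDr ltr01 (lexx n)) fx)); first lra.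
    exists x'; split; first by right; left; split=> //; rewrite ltW.
      exact: le_trans dx' (ler_norm _).
    by constructor 2; split=> //; lra.
  have fx : n + 1 < - f x.
    by rewrite ltNge; apply/negP => fx; apply: nZx; right; right.
  have [k /fK /andP[]|x' [Yx' /andP[x'1 x'2] dx']] :=
    @descend _ Y K n x sY _ Yx (ltW (lt_trans (ltr_pwDr ltr01 (lexx n)) fx)); first lra.
  exists x'; split; first by right; right; split=> //; rewrite ltW.
    by rewrite distrC; apply: le_trans (ler_norm _); lra.
  by constructor 3; split=> //; lra.
have D00 : 0 <= D0.
  by have := hD0 k0; rewrite ger0_norm // distxx; apply; left.
pose b := `|l1| + `|l2| + 4 * D0.
have low x y : (dist G x y)%:R <= `|f x - f y| + b.
  have [[Xx Xy nx ny]|nXX] := pselect [/\ X x, X y, n <= f x & n <= f y].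
    have := h1 x y Xx Xy (le_trans nn1 nx) (le_trans nn1 ny).
    rewrite /b; have := ler_norm l1; have := normr_ge0 l2; lra.
  have [[Yx Yy nx ny]|nYY] := pselect [/\ Y x, Y y, n <= - f x & n <= - f y].
    have := h2 x y Yx Yy (le_trans nn2 nx) (le_trans nn2 ny).
    rewrite -opprD normrN; rewrite /b; have := ler_norm l2; have := normr_ge0 l1; lra.
  have [x' [Zx' dx px]] := retract x; have [y' [Zy' dy py]] := retract y.
  have opp : (f x - f x') * (f y - f y') <= 0.
    case: px => [->|[Xx nx fx]|[Yx nx fx]]; first by rewrite subrr mul0r.
      case: py => [->|[Xy ny fy]|[Yy ny fy]]; first by rewrite subrr mulr0.
        by case: nXX.
      by rewrite mulr_ge0_le0 ?subr_ge0 ?subr_le0.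
    case: py => [->|[Xy ny fy]|[Yy ny fy]]; first by rewrite subrr mulr0.
      by rewrite mulr_le0_ge0 ?subr_ge0 ?subr_le0.
    by case: nYY.
  have e := opp_normD opp.
  have tri : `|f x - f x' - (f y - f y')| <= `|f x - f y| + 2 * D0.
    have -> : f x - f x' - (f y - f y') = (f x - f y) - (f x' - f y') by ring.
    apply: le_trans (ler_normB _ _) _; rewrite lerD2l.
    exact: le_trans (Lip1_normB conn x' y' fL) (diam _ _ Zx' Zy').
  have t1 := dist_triangleR conn x' x y; have t2 := dist_triangleR conn y' x' y.
  have t3 := diam _ _ Zx' Zy'; rewrite (dist_sym conn y' y) in t2.
  by rewrite /b; have := normr_ge0 l1; have := normr_ge0 l2; lra.
(* Heights beyond [B] or below [- B] are attained up to 1 by descending; the others are within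
   [2 * B] of [f k0]. *)
exists 1, b, (2 * B + 2); split=> //.
- by rewrite /b; have := normr_ge0 l1; have := normr_ge0 l2; lra.
- by have := fB k0 Kk0; have := normr_ge0 (f k0); lra.
- move=> x y; rewrite invr1 !mul1r; apply/andP; split; first by have := low x y; lra.
  have := Lip1_normB conn x y fL; have : 0 <= b.
    by rewrite /b; have := normr_ge0 l1; have := normr_ge0 l2; lra.
  lra.
have unbounded W g M : slope G g W K -> ~ finite_set W -> exists2 x, W x & M <= g x.
  move=> sg Winf; apply: contrapT => h; apply: Winf.
  apply: sub_finite_set (slope_sublevel conn lfin M sg) => x Wx; split=> //.
  by rewrite ltW // ltNge; apply/negP => gx; apply: h; exists x.
move=> z; have /andP[fk1 fk2] := fK k0 Kk0.
have [zB|zB] := ltP B z.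
  have [x Xx zx] := unbounded X f z sX (inf_mass_infinite mX).
  have [k /fK /andP[]|x' [Xx' /andP[x'1 x'2] _]] := @descend f X K z x sX _ Xx zx; first lra.
  by exists x'; rewrite ler_norml; apply/andP; split; lra.
have [zB'|zB'] := ltP z (- B).
  have [x Yx zx] := unbounded Y _ (- z) sY (inf_mass_infinite mY).
  have [k /fK /andP[]|x' [Yx' /andP[x'1 x'2] _]] := @descend _ Y K (- z) x sY _ Yx zx; first lra.
  by exists x'; rewrite ler_norml; apply/andP; split; lra.
by exists k0; rewrite ler_norml; apply/andP; split; lra.
Qed.

End SlabPath.

(** * Dimension of spaces of harmonic functions *)

Section FiniteDim.
Context (R : realType) (V : choiceType).

(** Functions dual to point evaluations: independence is automatic, and coefficients are values at
    the points [p j]. *)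
Definition delta_system (S : set (V -> R^o)) (k : nat) : Prop :=
  exists (b : 'I_k -> V -> R^o) (p : 'I_k -> V),
    (forall i, S (b i)) /\ forall i j, b i (p j) = (i == j)%:R.

Lemma fun_sumE (k : nat) (c : 'I_k -> R) (b : 'I_k -> V -> R^o) x :
  (\sum_i c i *: b i) x = \sum_i c i * b i x.
Proof. by rewrite fct_sumE. Qed.

Context (S : set (V -> R^o)).
Context (S_lin : forall (a : R) u v, S u -> S v -> S (a *: u + v)).
Context (S0 : S 0).

Lemma lin_sum (k : nat) (c : 'I_k -> R) (b : 'I_k -> V -> R^o) :
  (forall i, S (b i)) -> S (\sum_i c i *: b i).
Proof.
move=> Sb; elim/big_ind: _ => // [u v Su Sv|i _].
  by rewrite -[u]scale1r; exact: S_lin.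
by rewrite -[_ *: _]addr0; exact: S_lin.
Qed.

Lemma delta_system_extend k (b : 'I_k -> V -> R^o) (p : 'I_k -> V) v x :
    (forall i, S (b i)) -> (forall i j, b i (p j) = (i == j)%:R) ->
    S v -> (forall j, v (p j) = 0) -> v x != 0 ->
  delta_system S k.+1.
Proof.
move=> Sb bp Sv vp vx; pose v1 : V -> R^o := (v x)^-1 *: v.
have Sv1 : S v1 by rewrite /v1 -[_ *: _]addr0; exact: S_lin.
have v1p j : v1 (p j) = 0 by rewrite /v1 /= fctE vp scaler0.
have v1x : v1 x = 1 by rewrite /v1 fctE; exact: mulVf.
exists (fun i => if unlift ord_max i is Some j then (- b j x) *: v1 + b j else v1).
exists (fun i => if unlift ord_max i is Some j then p j else x).
split=> [i|i j]; first by case: (unlift _ _) => // l; exact: S_lin.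
case: (unliftP ord_max i) => [i' ->|->]; case: (unliftP ord_max j) => [j' ->|->].
- by rewrite (inj_eq lift_inj) !fctE v1p scaler0 add0r bp.
- rewrite eq_sym (negPf (neq_lift _ _)) !fctE v1x.
  by rewrite [_ *: _]mulr1 addNr.
- by rewrite v1p (negPf (neq_lift _ _)).
- by rewrite v1x eqxx.
Qed.

(** In a delta system with more than [N] members some nontrivial combination vanishes on [Q], hence
    at all [p i], which kills its coefficients. So a maximal system exists, and it spans by
    [delta_system_extend]. The set [Q] may depend on [P]; only the bound on its size is uniform. *)
Lemma finite_dim_of_eval (N : nat) :
    (forall P : {fset V}, exists Q : {fset V}, (#|` Q| <= N)%N /\
      forall u, S u -> (forall q, q \in Q -> u q = 0) -> forall p, p \in P -> u p = 0) ->
  finite_dim S.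
Proof.
move=> evalS.
have bound k : delta_system S k -> (k <= N)%N.
  move=> [b [p [Sb bp]]].
  have [Q [QN Qv]] := evalS [fset p i | i in 'I_k]%fset.
  rewrite leqNgt; apply/negP => Nk.
  pose q (j : 'I_(size Q)) := tnth (in_tuple Q) j.
  pose A : 'M[R]_(k, size Q) := \matrix_(i, j) b i (q j).
  have kerA : kermx A != 0.
    rewrite -mxrank_eq0 mxrank_ker subn_eq0 -ltnNge.
    by apply: leq_ltn_trans (rank_leq_col _) _; exact: leq_ltn_trans QN Nk.
  have /rowV0Pn[v /sub_kermxP vA v0] := kerA.
  pose u : V -> R^o := \sum_i v 0 i *: b i.
  have Su : S u by exact: lin_sum.
  have uq x : x \in Q -> u x = 0.
    move=> xQ; have xs : (index x Q < size Q)%N by rewrite index_mem.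
    have := congr1 (fun M : 'rV_(size Q) => M 0 (Ordinal xs)) vA.
    rewrite !mxE /u fun_sumE => {2}<-; apply: eq_bigr => i _.
    by rewrite mxE /q (tnth_nth x) /= nth_index.
  case/eqP: v0; apply/rowP => i; rewrite mxE.
  have := Qv u Su uq (p i); rewrite in_imfset // => /(_ isT).
  rewrite /u fun_sumE (bigD1 i) //= bp eqxx mulr1 big1 ?addr0 // => j ji.
  by rewrite bp (negPf ji) mulr0.
have ex0 : exists k, `[< delta_system S k >].
  exists 0%N; apply/asboolP.
  by exists (fun=> 0), (fun i : 'I_0 => False_rect V (notF (ltn_ord i))); split=> -[].
have bound' k : `[< delta_system S k >] -> (k <= N)%N by move=> /asboolP/bound.
case: (ex_maxnP ex0 bound') => k /asboolP[b [p [Sb bp]]] kmax.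
exists k, b; split=> [c c0 i|].
  have := congr1 (@^~ (p i)) c0; rewrite /= fun_sumE (bigD1 i) //= bp eqxx mulr1.
  by rewrite big1 ?addr0 // => j ji; rewrite bp (negPf ji) mulr0.
apply/seteqP; split=> [u Su|_ [c _ <-]]; last exact: lin_sum.
exists (fun i => u (p i)) => //.
pose v : V -> R^o := u - \sum_i u (p i) *: b i.
have Sv : S v.
  rewrite /v addrC -scaleN1r; apply: S_lin => //; exact: lin_sum.
suff v0 : v = 0 by apply/eqP; rewrite eq_sym -subr_eq0; apply/eqP.
apply/funext => x; apply/eqP; apply/negPn/negP => vx.
have vp j : v (p j) = 0.
  rewrite /v !fctE fun_sumE (bigD1 j) //= bp eqxx mulr1 big1 ?addr0 ?subrr // => l lj.
  by rewrite bp (negPf lj) mulr0.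
have /kmax : `[< delta_system S k.+1 >].
  by apply/asboolP; exact: delta_system_extend Sb bp Sv vp vx.
by rewrite ltnn.
Qed.

End FiniteDim.

(** * Finite dimension and energy estimates on bands *)

Section Band.
Context (R : realType) (V : countType) (G : graph R V).
Context (conn : connected_graph G) (lfin : locally_finite G).
Context (curv : curv_ge0 G).
Context (eps : R) (eps_gt0 : 0 < eps).
Context (weps : forall x y, adj G x y -> eps <= weight G x y).
Context (f : V -> R) (X Y K : set V).
Context (sXY : split2 G X Y K) (mX : inf_mass G X) (mY : inf_mass G Y).
Context (bf : balanced G f X Y K).

Local Notation w := (weight G).

Let sX : slope G f X K. Proof. by case: bf. Qed.
Let sY : slope G (fun x => - f x) Y K. Proof. by case: bf. Qed.
Let fX0 x : X x -> mlap G f x <= 0. Proof. by case: bf => _ _ + _ _; apply. Qed.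
Let fY0 x : Y x -> mlap G (fun x => - f x) x <= 0.
Proof. by case: bf => _ _ _ h _ /h; rewrite mlapN oppr_le0. Qed.
Let eX : endset G X K := split2_endset sXY.
Let eY : endset G Y K := split2_endset (split2_sym sXY).

Definition band (n : R) : set V :=
  K `|` ([set x | X x /\ f x <= n] `|` [set x | Y x /\ - f x <= n]).

Lemma band_finite n : finite_set (band n).
Proof.
have [Kf _ _] := eX; rewrite !finite_setU; split=> //.
by split; [exact: (slope_sublevel conn lfin n sX)|exact: (slope_sublevel conn lfin n sY)].
Qed.

Lemma band_mono (n n' : R) : n <= n' -> band n `<=` band n'.
Proof.
move=> nn' x [Kx|[[Xx h]|[Yx h]]]; [by left|right; left|right; right];
by split=> //; exact: le_trans nn'.
Qed.

Lemma in_band x : exists n : R, band n x.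
Proof.
have [_ _ XYK _ _] := sXY.
by case: (XYK x) => [Xx|Yx|Kx];
  [exists (f x); right; left|exists (- f x); right; right|exists 0; left].
Qed.

Lemma bandNX (n : R) x : X x -> n < f x -> ~ band n x.
Proof.
have [_ _ _ D _] := sXY; have [XY XK _] := D x.
by move=> Xx nx [/(XK Xx)//|[[_]|[/(XY Xx)//]]]; rewrite leNgt nx.
Qed.

Lemma bandNY (n : R) x : Y x -> n < - f x -> ~ band n x.
Proof.
have [_ _ _ D _] := sXY; have [XY XK YK] := D x.
by move=> Yx nx [/(YK Yx)//|[[/XY//]|[_]]]; rewrite leNgt nx.
Qed.

Lemma band_fset (P : {fset V}) (n0 : R) :
  exists2 n : R, n0 <= n & forall p, p \in P -> band n p.
Proof.
have [h hP] := choice in_band.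
exists (`|n0| + \sum_(p <- P) `|h p|) => [|p pP].
  by rewrite (le_trans (ler_norm n0)) // lerDl sumr_ge0.
apply: band_mono (hP p); rewrite (big_fsetD1 p) //= addrCA.
by rewrite (le_trans (ler_norm _)) // lerDl addr_ge0 // sumr_ge0.
Qed.

Lemma bounds_K : exists2 B : R, 0 <= B & forall k, K k -> - B <= f k <= B.
Proof.
have [Kf [k0 Kk0] _ _ _] := sXY; have [B fB] := finite_set_bound f Kf.
exists B => [|k /fB]; last by rewrite ler_norml.
by apply: le_trans (fB k0 Kk0).
Qed.

Lemma bandN_finite n : exists x, ~ band n x.
Proof.
apply: contrapT => h; apply: (inf_mass_infinite mX).
by apply: sub_finite_set (band_finite n) => x _; apply: contrapT => nx; apply: h; exists x.
Qed.

(** By the maximum principle the values on the two unit slabs bordering a band determine [u] inside,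
    and their number of vertices is bounded uniformly in [n]. *)
Lemma harmonic_finite_dim : finite_dim (harmonic_functions G).
Proof.
have harmP u : harmonic_functions G u -> forall x, mlap G u x = 0.
  move=> hu x; have := hu x; rewrite laplacian_mlap // => /eqP.
  by rewrite mulf_eq0 invr_eq0 gt_eqF ?vmeas_gt0 //= => /eqP.
have Pharm u : (forall x, mlap G u x = 0) -> harmonic_functions G u.
  by move=> hu x; rewrite laplacian_mlap // hu mulr0.
have [r1 [N1 c1]] := level_count conn lfin eps_gt0 weps sX fX0.
have [r2 [N2 c2]] := level_count conn lfin eps_gt0 weps sY fY0.
have [B B0 fB] := bounds_K.
apply: (@finite_dim_of_eval _ _ _ _ _ (N1 + N2)%N).
- move=> a u v /harmP hu /harmP hv; apply: Pharm => x.
  have -> : mlap G (a *: u + v) x = mlap G (fun z => a * u z + v z) x by [].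
  by rewrite (mlapD G (fun z => a * u z)) mlapZ hu hv mulr0 addr0.
- by apply: Pharm => x; exact: (mlap_cst G 0).
move=> P; have [n hn Pn] := band_fset P (Num.max B (Num.max r1 r2)).
move: hn; rewrite !ge_max => /and3P[Bn r1n r2n].
pose QX := [set x | X x /\ n < f x <= n + 1].
pose QY := [set x | Y x /\ n < - f x <= n + 1].
have QXf : finite_set QX.
  by apply: sub_finite_set (slope_sublevel conn lfin (n + 1) sX) => x [Xx /andP[]].
have QYf : finite_set QY.
  by apply: sub_finite_set (slope_sublevel conn lfin (n + 1) sY) => x [Yx /andP[]].
exists (fset_set QX `|` fset_set QY)%fset; split.
  apply: leq_trans (leq_card_fsetU _ _) _; rewrite leq_add //.
    by apply: (c1 n) => // x /(in_fset_setP _ QXf).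
  by apply: (c2 n) => // x /(in_fset_setP _ QYf).
move=> u /harmP hu uQ p /Pn pn.
have fL1 := (Lip1P conn f).1 (let: And3 h _ _ := sX in h).
have [_ _ XYK D E] := sXY.
have bd x y : band n x -> adj G x y -> ~ band n y -> u y = 0.
  move=> nx xy nny; apply: uQ; rewrite inE; apply/orP.
  have yx : adj G y x by rewrite adjC.
  have := fL1 _ _ xy; have := fL1 _ _ yx => h1 h2.
  case: (XYK y) => [Xy|Yy|Ky]; last by case: nny; left.
    left; apply/in_fset_setP => //; split=> //.
    have -> /= : n < f y by rewrite ltNge; apply/negP => ?; apply: nny; right; left.
    case: nx => [/fB|[[_]|[Yx]]]; try lra.
    by case: (E y x Xy Yx).
  right; apply/in_fset_setP => //; split=> //.
  have -> /= : n < - f y by rewrite ltNge; apply/negP => ?; apply: nny; right; right.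
  case: nx => [/fB|[[Xx]|[_]]]; try lra.
  by case: (E x y Xx Yy).
apply/eqP; rewrite eq_le; apply/andP; split.
  apply: (max_principle conn lfin (band_finite n) (bandN_finite n)) pn => // x y nx xy ny.
  by rewrite (bd x y).
rewrite -oppr_le0.
apply: (max_principle conn lfin (u := fun z => - u z) (band_finite n) (bandN_finite n)) pn
  => [x _|x y nx xy ny].
  by rewrite mlapN hu oppr0.
by rewrite (bd x y) // oppr0.
Qed.

(** Caccioppoli's inequality on one edge: the product is a square minus an error that lives where
    the cutoff [a] varies. *)
Lemma weighted_edge_ge (ax ay px py M g : R) : 0 <= g -> (ay - ax) ^+ 2 <= g ->
    (ax != ay -> `|px| <= M /\ `|py| <= M) ->
  - (M ^+ 2 * g) <= (ay ^+ 2 * py - ax ^+ 2 * px) * (py - px).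
Proof.
move=> g0 ag h.
have -> : (ay ^+ 2 * py - ax ^+ 2 * px) * (py - px) =
    (ay * py - ax * px) ^+ 2 - px * py * (ay - ax) ^+ 2 by ring.
have s0 : 0 <= (ay * py - ax * px) ^+ 2 := sqr_ge0 _.
have M0 : 0 <= M ^+ 2 * g by rewrite mulr_ge0 ?sqr_ge0.
have [e|/h[hx hy]] := eqVneq ax ay.
  by move: s0; rewrite e subrr expr0n mulr0 subr0; lra.
have : px * py * (ay - ax) ^+ 2 <= M ^+ 2 * g.
  apply: le_trans (ler_wpM2l (sqr_ge0 M) ag).
  rewrite ler_wpM2r ?sqr_ge0 //; apply: le_trans (ler_norm _) _.
  by rewrite normrM expr2 ler_pM.
lra.
Qed.

(** A clamp is monotone and 1-Lipschitz. The squared gradient of the cutoff is thus dominated by a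
    term of the flux of [g], which bounds the error uniformly in [n]. *)
Lemma level_sq_le (W : set V) (g : V -> R) n x y : W x -> W y ->
  (level W g 1 n y - level W g 1 n x) ^+ 2 <=
  (level W g 1 n y - level W g 1 n x) * (g y - g x).
Proof.
move=> Wx Wy; rewrite !level_in //.
have [xy|/ltW xy] := leP (g x) (g y).
  have t : g x - n <= g y - n by lra.
  have h1 := clamp_homo ler01 t; have h2 := clamp_lip ler01 t.
  rewrite expr2 ler_wpM2l ?subr_ge0 //; lra.
have t : g y - n <= g x - n by lra.
have h1 := clamp_homo ler01 t; have h2 := clamp_lip ler01 t.
rewrite expr2 -mulrNN -[leRHS]mulrNN ler_wpM2l ?oppr_ge0 ?subr_le0 //; lra.
Qed.

(** [b] stands for edges inside the band: there the test function is [u] itself and the full energy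
    is kept. Any other edge costs at most the error term. *)
Lemma level_edge_ge (W : set V) (g u : V -> R) n x y c M (b : bool) :
    W x -> W y -> `|g y - g x| <= 1 -> (b -> g x <= n /\ g y <= n) ->
    (forall z, W z -> n - 1 < g z < n + 2 -> `|u z - c| <= M) ->
  (if b then (u y - u x) ^+ 2 else 0) <=
    ((1 - level W g 1 n y) ^+ 2 * (u y - c) + c -
     ((1 - level W g 1 n x) ^+ 2 * (u x - c) + c)) * (u y - u x) +
    M ^+ 2 * ((level W g 1 n y - level W g 1 n x) * (g y - g x)).
Proof.
move=> Wx Wy gxy hb hM; have le := level_sq_le g n Wx Wy.
have g0 := le_trans (sqr_ge0 _) le.
case: b hb => [/(_ isT)[gx gy]|_].
  have z0 z : W z -> g z <= n -> level W g 1 n z = 0.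
    by move=> Wz gz; rewrite level_in //; case: (clampP (g z - n) ler01) => [[]|[]|[]]; lra.
  by rewrite !z0 // subrr mul0r mulr0; lra.
have := @weighted_edge_ge (1 - level W g 1 n x) (1 - level W g 1 n y) (u x - c) (u y - c) M _ g0.
have -> : 1 - level W g 1 n y - (1 - level W g 1 n x) =
  - (level W g 1 n y - level W g 1 n x) by ring.
rewrite sqrrN => /(_ le); move/(_ _)/wrap => -[ne|]; last lra.
have {}ne : level W g 1 n x <> level W g 1 n y by move=> e; rewrite e eqxx in ne.
move: gxy; rewrite ler_norml => /andP[g1 g2].
suff /andP[/andP[? ?] /andP[? ?]] : (n - 1 < g x < n + 2) && (n - 1 < g y < n + 2).
  by split; apply: hM => //; apply/andP.
move: ne; rewrite !level_in //.
case: (clampP (g x - n) ler01) => [[? ->]|[? ? ->]|[? ->]];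
case: (clampP (g y - n) ler01) => [[? ->]|[? ? ->]|[? ->]] ne;
apply/andP; split; apply/andP; split; try lra; by case: ne; lra.
Qed.

Section Harmonic.
Context (v : V -> R) (v0 : forall x, mlap G v x = 0).

Definition band_energy (n : R) : R :=
  \sum_(x <- fset_set (band n)) \sum_(y <- fset_set (band n)) w x y * (v y - v x) ^+ 2.

Lemma band_fsetS (n n' : R) : n <= n' -> (fset_set (band n) `<=` fset_set (band n'))%fset.
Proof.
move=> nn'; apply/fsubsetP => x /(in_fset_setP _ (band_finite n)) nx.
by apply/in_fset_setP; [exact: band_finite|exact: band_mono nx].
Qed.

Let term_ge0 x y : 0 <= w x y * (v y - v x) ^+ 2.
Proof. by rewrite mulr_ge0 ?weight_ge0 ?sqr_ge0. Qed.

Lemma band_energy_ge0 n : 0 <= band_energy n.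
Proof. by apply: sumr_ge0 => x _; apply: sumr_ge0. Qed.

Lemma band_energy_mono (n n' : R) : n <= n' -> band_energy n <= band_energy n'.
Proof.
move=> nn'; have S := band_fsetS nn'.
apply: (@le_trans _ _
  (\sum_(x <- fset_set (band n)) \sum_(y <- fset_set (band n')) w x y * (v y - v x) ^+ 2)).
  by apply: ler_sum => x _; apply: ler_sum_fsubset.
by apply: ler_sum_fsubset => // x _; exact: sumr_ge0.
Qed.

Lemma band_energy_edge (n n' : R) x y : n <= n' -> adj G x y -> band n' x -> band n' y ->
  ~ band n x -> band_energy n + eps * (v y - v x) ^+ 2 <= band_energy n'.
Proof.
move=> nn' xy n'x n'y nnx; have S := band_fsetS nn'.
have xn' : x \in fset_set (band n') by apply/in_fset_setP => //; exact: band_finite.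
have yn' : y \in fset_set (band n') by apply/in_fset_setP => //; exact: band_finite.
have xn : x \notin fset_set (band n).
  by apply/negP => /(in_fset_setP _ (band_finite n)).
rewrite [leRHS]/band_energy (big_fsetD1 x) //= [leRHS]addrC lerD //; last first.
  rewrite (big_fsetD1 y) //= -[leLHS]addr0 lerD ?sumr_ge0 //.
  by rewrite ler_wpM2r ?sqr_ge0 ?weps.
apply: (@le_trans _ _
  (\sum_(x <- fset_set (band n)) \sum_(y <- fset_set (band n')) w x y * (v y - v x) ^+ 2)).
  by apply: ler_sum => z _; apply: ler_sum_fsubset.
apply: ler_sum_fsubset => [|z _]; last exact: sumr_ge0.
by rewrite fsubsetD1 S.
Qed.

(* Tested against [eta^2 (v - c) + c], where [eta] is the cutoff that leaves
   the band and [c] is constant on each end, the energy of [v] in the band is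
   controlled by its oscillation on the two slabs where [eta] varies. *)
Lemma band_energy_le (n cX cY M : R) : flux G \1_X v = 0 ->
    (forall k, K k -> - n + 1 <= f k <= n - 1) ->
    (forall x, X x -> n - 1 < f x < n + 2 -> `|v x - cX| <= M) ->
    (forall x, Y x -> n - 1 < - f x < n + 2 -> `|v x - cY| <= M) ->
  band_energy n <= M ^+ 2 * (flux G \1_X f + flux G \1_Y (fun x => - f x)).
Proof.
move=> vX fK hX hY.
have [_ _ XYK D E] := sXY.
have vY : flux G \1_Y v = 0.
  have := flux_opp conn lfin eX eY XYK _ (@cutoff_indic R V X) (@cutoff_indic R V Y) v0.
  by rewrite vX add0r; apply => x; case: (D x).
pose TX := level X f 1 n; pose TY := level Y (fun x => - f x) 1 n.
have cTX : cutoff X TX := level_cutoff conn lfin n sX.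
have cTY : cutoff Y TY := level_cutoff conn lfin n sY.
(* This writes $(1-T)^2$ as 1 minus another cutoff of the same end, through which the flux of [v] is
   also zero. *)
pose sq (t : R) := 1 - (1 - t) ^+ 2.
have sq_cut (W : set V) T : cutoff W T -> cutoff W (fun x => sq (T x)).
  move=> [T01 T0 T1]; split=> [x|x nWx|].
  - have /andP[t0 t1] := T01 x; rewrite /sq subr_ge0 gerBl sqr_ge0 andbT.
    by rewrite expr_le1 ?subr_ge0 // gerBl.
  - by rewrite /sq T0 // subr0 expr1n subrr.
  - apply: sub_finite_set T1 => x [Wx sT]; split=> // Tx; apply: sT.
    by rewrite /sq Tx subrr expr0n subr0.
have cSX := sq_cut _ _ cTX; have cSY := sq_cut _ _ cTY.
have gSX := cutoff_fingrad conn lfin eX cSX; have gSY := cutoff_fingrad conn lfin eY cSY.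
have gTX := cutoff_fingrad conn lfin eX cTX; have gTY := cutoff_fingrad conn lfin eY cTY.
have fSX : flux G (fun x => sq (TX x)) v = 0.
  by rewrite -vX; apply: (flux_harmonic conn lfin eX (@cutoff_indic R V X) cSX) => x _.
have fSY : flux G (fun x => sq (TY x)) v = 0.
  by rewrite -vY; apply: (flux_harmonic conn lfin eY (@cutoff_indic R V Y) cSY) => x _.
pose phi x := (1 - sq (TX x) - sq (TY x)) * v x.
have phi_supp : supp_in phi (fset_set (band (n + 1))).
  move=> x; apply: contraNT => nx.
  have {}nx : ~ band (n + 1) x by move=> /(in_fset_setP _ (band_finite _)); exact/negP.
  rewrite /phi; case: (XYK x) => [Xx|Yx|Kx]; last by case: nx; left.
    have fx : n + 1 < f x by rewrite ltNge; apply/negP => ?; apply: nx; right; left.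
    rewrite /TX /TY level_in // level_out; last by case: (D x) => XY _ _ /XY.
    have -> : clamp 1 (f x - n) = 1.
      by case: (clampP (f x - n) ler01) => [[]|[]|[]]; lra.
    by rewrite /sq; apply/eqP; ring.
  have fx : n + 1 < - f x by rewrite ltNge; apply/negP => ?; apply: nx; right; right.
  rewrite /TX /TY level_out; last by case: (D x) => XY _ _ /XY.
  rewrite level_in //.
  have -> : clamp 1 (- f x - n) = 1.
    by case: (clampP (- f x - n) ler01) => [[]|[]|[]]; lra.
  by rewrite /sq; apply/eqP; ring.
have fphi : flux G phi v = 0.
  rewrite (flux_supp lfin _ phi_supp) big1 ?mulr0 ?oppr0 // => x _.
  by rewrite v0 mulr0.
have gphi := supp_fingrad lfin phi_supp.
(* The constants of the two ends are inserted by cutoffs through which [v] has zero flux, while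
   [phi] has finite support; so [zeta] has zero flux as well. *)
pose zeta x := phi x + (cX * sq (TX x) + cY * sq (TY x)).
have gzeta : fingrad G zeta.
  by apply: fingradD => //; apply: fingradD; exact: fingradZ.
have fzeta : flux G zeta v = 0.
  rewrite /zeta (fluxDl lfin) //; last by apply: fingradD; exact: fingradZ.
  rewrite (fluxDl lfin); [|exact: fingradZ|exact: fingradZ].
  by rewrite !(fluxZl lfin) // fphi fSX fSY !mulr0 !addr0.
have [Z1 [Z2 [Z3 [g1 g2 g3]]]] : exists Z1 Z2 Z3,
    [/\ grad_in G zeta Z1, grad_in G TX Z2 & grad_in G TY Z3].
  by have [Z1 g1] := gzeta; have [Z2 g2] := gTX; have [Z3 g3] := gTY; exists Z1, Z2, Z3.
pose Z := (Z1 `|` Z2 `|` Z3 `|` fset_set (band n))%fset.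
have {}g1 : grad_in G zeta Z.
  by apply: grad_inS g1; rewrite /Z -!fsetUA fsubsetUl.
have {}g2 : grad_in G TX Z.
  apply: grad_inS g2; apply/fsubsetP => x; rewrite /Z !inE => ->.
  by rewrite ?orbT.
have {}g3 : grad_in G TY Z.
  apply: grad_inS g3; apply/fsubsetP => x; rewrite /Z !inE => ->.
  by rewrite ?orbT.
have bZ : (fset_set (band n) `<=` Z)%fset by apply: fsubsetUr.
pose H x y := if (x \in fset_set (band n)) && (y \in fset_set (band n))
  then w x y * (v y - v x) ^+ 2 else 0.
have H0 x y : 0 <= H x y by rewrite /H; case: ifP.
have EH : band_energy n <= \sum_(x <- Z) \sum_(y <- Z) H x y.
  apply: (@le_trans _ _ (\sum_(x <- fset_set (band n)) \sum_(y <- fset_set (band n)) H x y)).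
    rewrite /band_energy big_seq [leRHS]big_seq; apply: ler_sum => x xn.
    rewrite big_seq [leRHS]big_seq; apply: ler_sum => y yn.
    by rewrite /H xn yn.
  apply: (@le_trans _ _ (\sum_(x <- fset_set (band n)) \sum_(y <- Z) H x y)).
    by apply: ler_sum => x _; apply: ler_sum_fsubset.
  by apply: ler_sum_fsubset => // x _; exact: sumr_ge0.
apply: le_trans EH _.
have fX1 : flux G TX f <= flux G \1_X f by exact: (flux_level_le_indic conn lfin sX fX0).
have fY1 : flux G TY (fun x => - f x) <= flux G \1_Y (fun x => - f x).
  exact: (flux_level_le_indic conn lfin sY fY0).
apply: (@le_trans _ _
  (flux G zeta v + M ^+ 2 * (flux G TX f + flux G TY (fun x => - f x)))); last first.
  by rewrite fzeta add0r ler_wpM2l ?sqr_ge0 ?lerD.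
rewrite (flux_energy lfin _ g1) (flux_energy lfin _ g2) (flux_energy lfin _ g3).
rewrite /energy -big_split /= mulr_sumr -big_split /=; apply: ler_sum => x _.
rewrite -big_split /= mulr_sumr -big_split /=; apply: ler_sum => y _.
rewrite [leRHS](_ : _ = w x y * ((zeta y - zeta x) * (v y - v x) + M ^+ 2 *
  ((TX y - TX x) * (f y - f x) + (TY y - TY x) * (- f y - - f x)))); last by ring.
have [xy|/weight_nadj w0] := boolP (adj G x y); last first.
  by rewrite /H w0 !mul0r if_same.
pose b := (x \in fset_set (band n)) && (y \in fset_set (band n)).
have -> : H x y = w x y * (if b then (v y - v x) ^+ 2 else 0).
  by rewrite /H -/b; case: b; rewrite ?mulr0.
apply: ler_wpM2l; first exact: weight_ge0.
have hb : b -> band n x /\ band n y.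
  by move=> /andP[/(in_fset_setP _ (band_finite n)) ? /(in_fset_setP _ (band_finite n)) ?].
have yx : adj G y x by rewrite adjC.
have fL := (Lip1P conn f).1 (let: And3 h _ _ := sX in h).
have fxy := fL _ _ xy; have fyx := fL _ _ yx.
have sq0 : sq 0 = 0 by rewrite /sq; ring.
have zX z : X z -> TY z = 0 /\ zeta z = (1 - TX z) ^+ 2 * (v z - cX) + cX.
  move=> Xz; have TYz : TY z = 0 by apply: level_out; case: (D z) => XY _ _ /XY.
  by split=> //; rewrite /zeta /phi TYz sq0 /sq; ring.
have zY z : Y z -> TX z = 0 /\ zeta z = (1 - TY z) ^+ 2 * (v z - cY) + cY.
  move=> Yz; have TXz : TX z = 0 by apply: level_out; case: (D z) => XY _ _ /XY.
  by split=> //; rewrite /zeta /phi TXz sq0 /sq; ring.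
pose low z := [/\ TX z = 0, TY z = 0 & zeta z = v z].
have lowK z : K z -> low z.
  move=> Kz; have [_ XK YK] := D z.
  have TXz : TX z = 0 by apply: level_out => /XK.
  have TYz : TY z = 0 by apply: level_out => /YK.
  by split=> //; rewrite /zeta /phi TXz TYz sq0; ring.
have lowX z : X z -> f z <= n -> low z.
  move=> Xz fz; have [TYz ez] := zX z Xz.
  have TXz : TX z = 0.
    by rewrite /TX level_in //; case: (clampP (f z - n) ler01) => [[]|[]|[]]; lra.
  by split=> //; rewrite ez TXz; ring.
have lowY z : Y z -> - f z <= n -> low z.
  move=> Yz fz; have [TXz ez] := zY z Yz.
  have TYz : TY z = 0.
    by rewrite /TY level_in //; case: (clampP (- f z - n) ler01) => [[]|[]|[]]; lra.
  by split=> //; rewrite ez TYz; ring.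
have both : low x -> low y -> (if b then (v y - v x) ^+ 2 else 0) <=
    (zeta y - zeta x) * (v y - v x) +
    M ^+ 2 * ((TX y - TX x) * (f y - f x) + (TY y - TY x) * (- f y - - f x)).
  move=> [-> -> ->] [-> -> ->]; rewrite !subrr !mul0r addr0 mulr0 addr0 -expr2.
  by case: (b) => //; exact: sqr_ge0.
have [Xx|nXx] := pselect (X x).
  have [Xy|Ky] : X y \/ K y by have [_ _ nX] := eX; exact: nX Xx xy.
    have [TYx ->] := zX x Xx; have [TYy ->] := zX y Xy.
    rewrite TYx TYy subrr mul0r addr0.
    apply: level_edge_ge => //; first by rewrite ler_norml; apply/andP; split; lra.
    move=> /hb[nx ny]; split; rewrite leNgt; apply/negP => fn.
      exact: bandNX Xx fn nx.
    exact: bandNX Xy fn ny.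
  apply: both; last exact: lowK.
  by apply: lowX => //; have /andP[] := fK y Ky; lra.
have [Yx|nYx] := pselect (Y x).
  have [Yy|Ky] : Y y \/ K y by have [_ _ nY] := eY; exact: nY Yx xy.
    have [TXx ->] := zY x Yx; have [TXy ->] := zY y Yy.
    rewrite TXx TXy subrr mul0r add0r.
    apply: (@level_edge_ge Y (fun z => - f z)) => //.
      by rewrite ler_norml; apply/andP; split; lra.
    move=> /hb[nx ny]; split; rewrite leNgt; apply/negP => fn.
      exact: bandNY Yx fn nx.
    exact: bandNY Yy fn ny.
  apply: both; last exact: lowK.
  by apply: lowY => //; have /andP[] := fK y Ky; lra.
have Kx : K x by case: (XYK x).
apply: both; first exact: lowK.
have /andP[fk1 fk2] := fK x Kx.
case: (XYK y) => [Xy|Yy|Ky]; [apply: lowX|apply: lowY|exact: lowK] => //; lra.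
Qed.

End Harmonic.
End Band.

(** * Subexponential growth *)

Section Subexponential.
Context (R : realType) (V : countType) (G : graph R V).
Context (conn : connected_graph G) (lfin : locally_finite G).

Definition subexp (x0 : V) (v : V -> R) : Prop := forall de : R, 0 < de ->
  exists R0 : R, forall r x, R0 <= r -> (dist G x0 x)%:R <= r -> `|v x| <= expR (de * r).

Lemma gball_finite x0 r : finite_set (gball G x0 r).
Proof.
apply: sub_finite_set (finite_ball conn lfin x0 (Num.bound `|r|)) => x /=.
move=> h; rewrite -(ler_nat R); apply: le_trans h _.
by apply: le_trans (ler_norm r) _; rewrite ltW // archi_boundP.
Qed.

Lemma subexpP x0 u : subexponential_functions G x0 u <-> subexp x0 u.
Proof.
split=> [su de de0|su de de0].
  have [M [Mreal hM]] := su de de0; exists (M + 1) => r x Mr xr.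
  apply: le_trans (hM r _); last by rewrite (lt_le_trans _ Mr) // ltrDl.
  apply: ub_le_sup; last by exists x.
  have [B hB] := finite_set_bound u (gball_finite x0 r).
  by exists B => _ [y /hB yB <-].
have [R0 hR] := su de de0; exists (Num.max 0 R0); split; first exact: num_real.
move=> r; rewrite gt_max => /andP[/ltW r0 /ltW r1].
apply: ge_sup; first by exists `|u x0|; exists x0 => //; rewrite /gball /= distxx.
by move=> _ [x xr <-]; exact: hR.
Qed.

Lemma subexp_lin x0 u v a : subexp x0 u -> subexp x0 v ->
  subexp x0 (fun x => u x + a * v x).
Proof.
move=> su sv de de0; have de2 : 0 < de / 2 by rewrite divr_gt0.
have [R1 h1] := su _ de2; have [R2 h2] := sv _ de2.
exists (Num.max (`|a| / (de / 2)) (Num.max R1 R2)) => r x; rewrite !ge_max => /and3P[r0 r1 r2] xr.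
have := h1 r x r1 xr; have := h2 r x r2 xr; set q := expR (de / 2 * r) => hv hu.
have q1 : 1 + `|a| <= q.
  apply: le_trans (expR_ge1Dx _); rewrite lerD2l.
  by move: r0; rewrite ler_pdivrMr // mulrC.
have -> : expR (de * r) = q * q by rewrite /q -expRD; congr expR; lra.
apply: le_trans (ler_normD _ _) _; rewrite normrM.
have q0 : 0 <= q by rewrite expR_ge0.
apply: le_trans (_ : (1 + `|a|) * q <= _); last by rewrite ler_wpM2r.
by rewrite mulrDl mul1r lerD // ler_wpM2l.
Qed.

Lemma Lip1_subexp x0 h : Lip1 G h -> subexp x0 h.
Proof.
(* In [expR (de * r) >= (1 + de * r / 2) ^+ 2] the linear term absorbs [h x0] and the quadratic one
   absorbs [r]. *)
move=> hL de de0; exists (Num.max (`|h x0| / de) (4 / de ^+ 2)) => r x.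
rewrite ge_max => /andP[r1 r2] xr.
have d2 : 0 < de ^+ 2 by rewrite exprn_gt0.
move: r1 r2; rewrite !ler_pdivrMr // => r1 r2.
have r0 : 0 <= r by apply: le_trans xr.
have hx : `|h x| <= `|h x0| + r.
  have := Lip1_normB conn x x0 hL; rewrite (dist_sym conn x x0) => hh.
  have := ler_normD (h x0) (h x - h x0); rewrite addrC subrK; lra.
apply: le_trans hx _.
have -> : expR (de * r) = expR (de * r / 2) * expR (de * r / 2).
  by rewrite -expRD; congr expR; lra.
have e1 := expR_ge1Dx (de * r / 2).
have p0 : 0 <= 1 + de * r / 2 by rewrite addr_ge0 // divr_ge0 // mulr_ge0 // ltW.
apply: le_trans (ler_pM p0 p0 e1 e1).
have : 4 * r <= r * de ^+ 2 * r by rewrite ler_wpM2r.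
rewrite expr2; lra.
Qed.

End Subexponential.

(** * Exponential growth of the energy *)

Section Growth.
Context (R : realType) (V : countType) (G : graph R V).
Context (conn : connected_graph G) (lfin : locally_finite G).
Context (curv : curv_ge0 G).
Context (eps : R) (eps_gt0 : 0 < eps).
Context (weps : forall x y, adj G x y -> eps <= weight G x y).

Lemma path_osc (v : V -> R) e x s : path (adj G) x s ->
    (forall a b, a \in x :: s -> b \in x :: s -> adj G a b -> `|v b - v a| <= e) ->
  `|v (last x s) - v x| <= (size s)%:R * e.
Proof.
elim: s x => [|z s IH] x /=; first by rewrite subrr normr0 mul0r.
move=> /andP[xz zs] h.
have h1 : `|v z - v x| <= e by apply: h => //; rewrite !inE eqxx ?orbT.
have h2 : `|v (last z s) - v z| <= (size s)%:R * e.
  by apply: IH => // a b az bz; apply: h; rewrite inE ?az ?bz orbT.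
have -> : v (last z s) - v x = (v (last z s) - v z) + (v z - v x) by ring.
by apply: le_trans (ler_normD _ _) _; rewrite -natr1 mulrDl mul1r lerD.
Qed.

Context (f : V -> R) (X Y K : set V).
Context (sXY : split2 G X Y K) (mX : inf_mass G X) (mY : inf_mass G Y).
Context (bf : balanced G f X Y K).
Context (v : V -> R) (v0 : forall x, mlap G v x = 0) (vX : flux G \1_X v = 0).

Local Notation en := (band_energy G f X Y K v).

Let sX : slope G f X K. Proof. by case: bf. Qed.
Let sY : slope G (fun x => - f x) Y K. Proof. by case: bf. Qed.
Let fX0 x : X x -> mlap G f x <= 0. Proof. by case: bf => _ _ + _ _; apply. Qed.
Let fY0 x : Y x -> mlap G (fun x => - f x) x <= 0.
Proof. by case: bf => _ _ _ h _ /h; rewrite mlapN oppr_le0. Qed.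

Lemma slab_osc (W : set V) (g : V -> R) (n : R) (l : nat) e :
    (forall x y, W x -> W y -> n - 1 < g x < n - 1 + 15 -> n - 1 < g y < n - 1 + 15 ->
      exists s, [/\ path (adj G) x s, last x s = y, (size s <= l)%N &
        forall z, z \in x :: s -> W z /\ n - 1 - 15 < g z < n - 1 + 15]) ->
    0 <= e ->
    (forall a b, W a -> W b -> n - 16 < g a < n + 14 -> n - 16 < g b < n + 14 ->
      adj G a b -> `|v b - v a| <= e) ->
  exists c, forall x, W x -> n - 1 < g x < n + 2 -> `|v x - c| <= l%:R * e.
Proof.
move=> hp e0 he.
have [[x0 [Wx0 gx0]]|nx0] := pselect (exists x, W x /\ n - 1 < g x < n + 2); last first.
  by exists 0 => x Wx gx; case: nx0; exists x.
have wide x : n - 1 < g x < n + 2 -> n - 1 < g x < n - 1 + 15.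
  by move=> /andP[? ?]; apply/andP; split; lra.
exists (v x0) => x Wx gx; have [s [ps <- sl hs]] := hp _ _ Wx0 Wx (wide _ gx0) (wide _ gx).
have : (size s)%:R * e <= l%:R * e by rewrite ler_wpM2r // ler_nat.
apply: le_trans; apply: path_osc ps _ => a b /hs[Wa /andP[a1 a2]] /hs[Wb /andP[b1 b2]].
by apply: he => //; apply/andP; split; lra.
Qed.

(** Around height [n + 16], the paths of [slab_path] based at [n + 15] stay between [n] and
    [n + 30]. Each edge there has squared gradient at most [(en (n + 30) - en n) / eps], which
    bounds the oscillation in [band_energy_le]. *)
Lemma band_energy_growth : exists m0 C : R, 1 <= C /\
  forall n, m0 <= n -> en n <= C * (en (n + 30) - en n).
Proof.
have [n1 [l1 h1]] := slab_path conn lfin curv eps_gt0 weps sXY mX mY sX fX0.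
have [n2 [l2 h2]] := slab_path conn lfin curv eps_gt0 weps (split2_sym sXY) mY mX sY fY0.
have [B B0 fB] := bounds_K f sXY.
pose l := (l1 + l2)%N.
pose D := flux G \1_X f + flux G \1_Y (fun x => - f x).
exists (`|n1| + `|n2| + B + 1), (Num.max 1 (l%:R ^+ 2 / eps * D)); split.
  by rewrite le_max lexx.
move=> n hn; set de := en (n + 30) - en n.
have de0 : 0 <= de by rewrite subr_ge0; apply: (band_energy_mono conn lfin sXY bf); lra.
pose e := Num.sqrt (de / eps).
have e0 : 0 <= e by exact: sqrtr_ge0.
have n1n : n1 <= n + 16 - 1.
  by have := ler_norm n1; have := normr_ge0 n2; lra.
have n2n : n2 <= n + 16 - 1.
  by have := ler_norm n2; have := normr_ge0 n1; lra.
have edge a b : adj G a b -> band f X Y K (n + 30) a -> band f X Y K (n + 30) b ->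
    ~ band f X Y K n a -> `|v b - v a| <= e.
  move=> ab na nb nna.
  have n30 : n <= n + 30 by lra.
  have := band_energy_edge conn lfin weps sXY bf v n30 ab na nb nna.
  rewrite /e -sqrtr_sqr => h; apply: ler_wsqrtr.
  by rewrite ler_pdivlMr // mulrC /de; lra.
have [cX hX] : exists c, forall x, X x -> n + 16 - 1 < f x < n + 16 + 2 -> `|v x - c| <= l%:R * e.
  apply: slab_osc => // [x y Xx Xy gx gy|a b Xa Xb /andP[a1 a2] /andP[b1 b2] ab].
    have [s [ps ls sl hs]] := h1 _ _ _ n1n Xx Xy gx gy; exists s; split=> //.
    by apply: leq_trans sl _; rewrite leq_addr.
  apply: edge ab _ _ _; [right; left; split=> //; lra|right; left; split=> //; lra|].
  by apply: (bandNX sXY) => //; lra.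
have [cY hY] : exists c, forall x, Y x -> n + 16 - 1 < - f x < n + 16 + 2 -> `|v x - c| <= l%:R * e.
  apply: (@slab_osc Y (fun x => - f x)) => //
    [x y Yx Yy gx gy|a b Ya Yb /andP[a1 a2] /andP[b1 b2] ab].
    have [s [ps ls sl hs]] := h2 _ _ _ n2n Yx Yy gx gy; exists s; split=> //.
    by apply: leq_trans sl _; rewrite leq_addl.
  apply: edge ab _ _ _; [right; right; split=> //; lra|right; right; split=> //; lra|].
  by apply: (bandNY sXY) => //; lra.
have hK k : K k -> - (n + 16) + 1 <= f k <= n + 16 - 1.
  move=> /fB /andP[k1 k2]; have := normr_ge0 n1; have := normr_ge0 n2 => ? ?.
  by apply/andP; split; lra.
have := band_energy_le conn lfin sXY bf v0 vX hK hX hY; rewrite -/D.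
have -> : (l%:R * e) ^+ 2 * D = l%:R ^+ 2 / eps * D * de.
  by rewrite exprMn /e sqr_sqrtr ?divr_ge0 ?(ltW eps_gt0) //; ring.
have n16 : n <= n + 16 by lra.
have m1 := band_energy_mono conn lfin sXY bf v n16 => m2.
apply: (le_trans m1); apply: (le_trans m2); rewrite ler_wpM2r //.
by rewrite le_max lexx orbT.
Qed.

Lemma zero_flux_const x0 : subexp G x0 v -> forall x y, v x = v y.
Proof.
move=> sv; have [m0 [C [C1 grow]]] := band_energy_growth.
have [B B0 fB] := bounds_K f sXY; have [Kf _ XYK _ _] := sXY.
have [D1 hD1] := finite_set_bound (fun k => (dist G x0 k)%:R : R) Kf.
pose A := B + D1.
have dX x : X x -> (dist G x0 x)%:R <= f x + A.
  have [_ _ fX] := sX; move=> /fX[k Kk ->]; have := dist_triangleR conn k x0 x.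
  rewrite (dist_sym conn k x); have /andP[? ?] := fB k Kk.
  by have := hD1 k Kk; rewrite ger0_norm // /A; lra.
have dY x : Y x -> (dist G x0 x)%:R <= - f x + A.
  have [_ _ fY] := sY; move=> /fY[k Kk ->]; have := dist_triangleR conn k x0 x.
  rewrite (dist_sym conn k x); have /andP[? ?] := fB k Kk.
  by have := hD1 k Kk; rewrite ger0_norm // /A; lra.
pose D := flux G \1_X f + flux G \1_Y (fun x => - f x).
have C0 : 0 < C by lra.
(* Chosen so that [q ^+ 2 <= 1 + C^-1]: the energy gains [q ^+ 2] per step of 30, one factor [q]
   more than the upper bound below. *)
pose q := 1 + (3 * C)^-1.
have i0 : 0 < (3 * C)^-1 by rewrite invr_gt0 mulr_gt0.
have q1 : 1 < q by rewrite /q; lra.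
have q0 : 0 < q by lra.
have iC : (3 * C)^-1 = C^-1 / 3 by rewrite invfM mulrC.
have qq : q ^+ 2 <= 1 + C^-1.
  have c1 : C^-1 <= 1 by rewrite invf_le1.
  have c0 : 0 <= C^-1 by rewrite invr_ge0 ltW.
  have : C^-1 * C^-1 <= C^-1 by rewrite ler_piMl.
  by rewrite /q iC expr2; lra.
have step n : m0 <= n -> q ^+ 2 * en n <= en (n + 30).
  move=> hn; have e0 := band_energy_ge0 G f X Y K v n.
  apply: le_trans (ler_wpM2r e0 qq) _; rewrite mulrDl mul1r.
  have := grow n hn; rewrite mulrC -ler_pdivrMr // mulrC; lra.
have iter m (k : nat) : m0 <= m -> q ^+ (2 * k) * en m <= en (m + 30 * k%:R).
  move=> hm; elim: k => [|k IH]; first by rewrite muln0 expr0 mul1r mulr0 addr0.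
  have -> : m + 30 * k.+1%:R = m + 30 * k%:R + 30 by rewrite -natr1; lra.
  rewrite mulnS exprD -mulrA; apply: le_trans (step _ _); last first.
    by rewrite (le_trans hm) // lerDl mulr_ge0.
  by rewrite ler_wpM2l // exprn_ge0 // ltW.
(* The energy is quadratic in [v] and a step has length 30, so this rate allows growth by [q] per
   step. *)
pose de := ln q / 60.
have de0 : 0 < de by rewrite divr_gt0 // ln_gt0.
have [R0 hR] := sv de de0.
have en0 m : Num.max m0 (B + 1) <= m -> en m = 0.
  rewrite ge_max => /andP[hm Bm].
  pose C' := expR (de * (m + 2 + A)) ^+ 2 * D.
  pose k0 := Num.bound (`|R0 - (m + 2 + A)|).
  have upper k : (k0 <= k)%N -> en (m + 30 * k%:R) <= C' * q ^+ k.
    move=> kk; have kR : (k0%:R : R) <= k%:R by rewrite ler_nat.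
    have k00 : 0 <= k%:R :> R by [].
    set n := m + 30 * k%:R.
    have nR : R0 <= n + 2 + A.
      have := archi_boundP (normr_ge0 (R0 - (m + 2 + A))); rewrite -/k0.
      have := ler_norm (R0 - (m + 2 + A)); rewrite /n; lra.
    have hK x : K x -> - n + 1 <= f x <= n - 1.
      by move=> /fB /andP[? ?]; apply/andP; split; rewrite /n; lra.
    have hX x : X x -> n - 1 < f x < n + 2 -> `|v x - 0| <= expR (de * (n + 2 + A)).
      by move=> Xx /andP[_ fx]; rewrite subr0; apply: hR => //; have := dX x Xx; lra.
    have hY x : Y x -> n - 1 < - f x < n + 2 -> `|v x - 0| <= expR (de * (n + 2 + A)).
      by move=> Yx /andP[_ fx]; rewrite subr0; apply: hR => //; have := dY x Yx; lra.
    apply: le_trans (band_energy_le conn lfin sXY bf v0 vX hK hX hY) _.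
    rewrite -/D le_eqVlt; apply/orP; left; apply/eqP.
    have -> : q ^+ k = expR (de * 30 * k%:R) ^+ 2.
      rewrite -expRM_natl -[in LHS](@lnK _ q) ?posrE // -expRM_natl; congr expR.
      by rewrite /de; lra.
    have -> : expR (de * (n + 2 + A)) = expR (de * (m + 2 + A)) * expR (de * 30 * k%:R).
      by rewrite -expRD; congr expR; rewrite /n; ring.
    by rewrite /C'; ring.
  apply/eqP; rewrite eq_le band_energy_ge0 andbT leNgt; apply/negP => epos.
  have iq1 : q^-1 < 1 by rewrite invf_lt1.
  have iq0 : 0 <= q^-1 by rewrite invr_ge0 ltW.
  have e2 : 0 < en m / 2 by rewrite divr_gt0.
  have [k1 hk1] := geometric_small `|C'| iq0 iq1 e2.
  pose k := (k0 + k1)%N.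
  have qk : 0 < q ^+ k by rewrite exprn_gt0.
  have := le_trans (iter m k hm) (upper k (leq_addr _ _)).
  rewrite mul2n -addnn exprD -mulrA [C' * _]mulrC ler_pM2l // => h.
  have : en m <= q^-1 ^+ k * C'.
    by rewrite exprVn mulrC ler_pdivlMr // mulrC.
  have : q^-1 ^+ k * C' <= q^-1 ^+ k1 * `|C'|.
    apply: le_trans (ler_wpM2l (exprn_ge0 _ iq0) (ler_norm C')) _.
    by rewrite ler_wpM2r // ler_wiXn2l ?(ltW iq1) // leq_addl.
  lra.
have edge x y : adj G x y -> v x = v y.
  move=> xy; have [n hn Pn] := band_fset f sXY [fset x; y]%fset (Num.max m0 (B + 1)).
  have nx : band f X Y K n x by apply: Pn; rewrite !inE eqxx.
  have ny : band f X Y K n y by apply: Pn; rewrite !inE eqxx orbT.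
  have xn : x \in fset_set (band f X Y K n).
    by apply/in_fset_setP => //; apply: (band_finite conn lfin sXY bf).
  have yn : y \in fset_set (band f X Y K n).
    by apply/in_fset_setP => //; apply: (band_finite conn lfin sXY bf).
  have t0 a b : 0 <= weight G a b * (v b - v a) ^+ 2.
    by rewrite mulr_ge0 ?weight_ge0 ?sqr_ge0.
  have : weight G x y * (v y - v x) ^+ 2 <= 0.
    rewrite -(en0 n hn) /band_energy (big_fsetD1 x) //=.
    have r0 : 0 <= \sum_(i <- (fset_set (band f X Y K n) `\ x)%fset)
        \sum_(z <- fset_set (band f X Y K n)) weight G i z * (v z - v i) ^+ 2.
      by apply: sumr_ge0 => a _; apply: sumr_ge0.
    rewrite -[leLHS]addr0 lerD // (big_fsetD1 y) //= lerDl.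
    exact: sumr_ge0.
  rewrite pmulr_rle0 // => h; have /eqP : (v y - v x) ^+ 2 = 0.
    by apply/eqP; rewrite eq_le h sqr_ge0.
  by rewrite sqrf_eq0 subr_eq0 => /eqP.
move=> x y; apply: (@adj_ind _ _ _ conn (fun z => v z = v y) y) => // a b ab <-.
exact/esym/edge.
Qed.

End Growth.

(** * From salami partitions to the theorem *)

Lemma inf_massP (R : realType) (V : countType) (G : graph R V) (X : set V) :
  set_mass G X = +oo%E -> inf_mass G X.
Proof.
move=> mX M; apply: contrapT => h.
have : (set_mass G X <= M%:E)%E.
  apply: ge_ereal_sup => _ [A [Af AX] <-]; rewrite fsbig_finite // sumEFin lee_fin.
  rewrite leNgt; apply/negP => MA; apply: h; exists (fset_set A); split; last exact: ltW.
  by move=> x /(in_fset_setP _ Af)/AX.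
by rewrite mX leye_eq.
Qed.

Lemma salami_split (R : realType) (V : countType) (G : graph R V) :
    connected_graph G -> (exists X Y K, salami_partition G X Y K) ->
  exists X Y K, [/\ split2 G X Y K, inf_mass G X & inf_mass G Y].
Proof.
move=> conn [X [Y [K [XYK [XY0 XK0 YK0] Kf E [mX mY]]]]]; exists X, Y, K.
have {}mX := inf_massP mX; have {}mY := inf_massP mY.
have dis (A B : set V) : A `&` B = set0 -> forall x, A x -> ~ B x.
  by move=> AB x Ax Bx; have : (A `&` B) x by []; rewrite AB.
have cov x : [\/ X x, Y x | K x].
  by have : (X `|` Y `|` K) x;
    [rewrite XYK|move=> [[]|]; [constructor 1|constructor 2|constructor 3]].
have nE x y : X x -> Y y -> ~ adj G x y.
  by move=> Xx Yy xy; have : edges_between G X Y (x, y) by []; rewrite E.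
have nonempty W : inf_mass G W -> exists x, W x.
  move=> mW; have [Z [ZW Z1]] := mW 1; apply: contrapT => h.
  move: Z1; rewrite big_seq big1 ?ler10 // => x xZ.
  by case: h; exists x; exact: ZW.
split=> //; split=> //; last by move=> x; split; exact: dis.
have [x1 Xx1] := nonempty _ mX; have [y1 Yy1] := nonempty _ mY.
(* With [K] empty, [X] would be closed under adjacency, hence all of [V]. *)
apply/set0P/negP => /eqP K0.
suff : X y1 by move=> /(dis _ _ XY0).
apply: (@adj_ind _ _ _ conn X x1) => // a b ab Xa.
by case: (cov b) => // [Yb|]; [case: (nE a b)|rewrite K0].
Qed.

Theorem theorem1p3 (R : realType) (V : countType) (G : graph R V)
    (HG : salami G) (eps : R) (eps_gt0 : 0 < eps)
    (Hw : forall x y : V, edges G (x, y) -> eps <= weight G x y) :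
  [/\ quasi_isometric (fun x y : V => (dist G x y)%:R)
        (fun s t : R => `|s - t|),
      finite_dim (harmonic_functions G) &
      forall x0 : V, has_dim (harmonic_functions G `&` subexponential_functions G x0) 2].
Proof.
have [conn lfin /(ollivier_curv_ge0 conn lfin) curv /(salami_split conn)] := HG.
move=> [X [Y [K [sXY mX mY]]]].
have weps x y : adj G x y -> eps <= weight G x y by move=> xy; exact: Hw.
have eX := split2_endset sXY; have eY := split2_endset (split2_sym sXY).
have [Kf K0 XYK D _] := sXY.
have [f bf] : exists f, balanced G f X Y K.
  by apply: exists_balanced => // x; case: (D x).
split.
- exists f; exact: (balanced_quasi_isometry conn lfin curv eps_gt0 weps sXY mX mY bf).
- exact: (harmonic_finite_dim conn lfin eps_gt0 weps sXY mX bf).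
move=> x0.
have [h [hL h0 hflux]] := exists_harmonic conn lfin curv sXY mX mY bf.
have [sX _ fX0 _ _] := bf.
(* The flux of [f] is at least [2 * eps] through every cutoff of [X], and [h] inherits this
   bound. *)
have Fh : 0 < flux G \1_X h.
  apply: (@lt_le_trans _ _ (2 * eps)); first by rewrite mulr_gt0.
  apply: hflux => T cT.
  exact: (slope_flux_ge conn lfin sX fX0 weps (inf_mass_infinite mX) cT).
have fg : fingrad G \1_X := cutoff_fingrad conn lfin eX (@cutoff_indic R V X).
have harmP u : harmonic_functions G u <-> forall x, mlap G u x = 0.
  split=> hu x; last by rewrite laplacian_mlap // hu mulr0.
  have := hu x; rewrite laplacian_mlap // => /eqP.
  by rewrite mulf_eq0 invr_eq0 gt_eqF ?vmeas_gt0 //= => /eqP.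
have sub_cst c : subexp G x0 (fun=> c) by apply: Lip1_subexp => // x y; rewrite subrr.
have sub_h : subexp G x0 h by exact: Lip1_subexp.
pose b (i : 'I_2) : V -> R^o := if i == 0 then fun=> 1 else h.
have bE (c : 'I_2 -> R) x : (\sum_i c i *: b i) x = c 0 + c 1 * h x.
  rewrite fun_sumE !big_ord_recl big_ord0 addr0 /b /= mulr1.
  by rewrite (_ : lift ord0 ord0 = 1) //; exact: val_inj.
exists b; split.
- move=> c c0; have c0x x : c 0 + c 1 * h x = 0 by rewrite -bE c0.
  (* Constants have no flux, so the flux reads off the coefficient of [h]. *)
  have c1 : c 1 = 0.
    have : flux G \1_X (fun x => c 1 * h x + c 0) = 0.
      rewrite (_ : (fun x => _) = fun=> 0) ?flux_cstr //.
      by apply/funext => x; rewrite addrC.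
    rewrite fluxDr // flux_cstr // addr0 fluxZr // => /eqP.
    by rewrite mulf_eq0 (gt_eqF Fh) orbF => /eqP.
  have [x1 _] := K0; have := c0x x1; rewrite c1 mul0r addr0 => c00.
  by move=> i; case: (unliftP 0 i) => [j ->|-> //]; rewrite (ord1 j) -[RHS]c1;
    congr c; exact: val_inj.
- apply/seteqP; split=> [u [/harmP hu /(subexpP conn lfin) su]|_ [c _ <-]].
    pose be := flux G \1_X u / flux G \1_X h.
    pose v x := u x + (- be) * h x.
    have v0 x : mlap G v x = 0 by rewrite /v mlapD mlapZ hu h0 mulr0 addr0.
    have vX : flux G \1_X v = 0.
      by rewrite /v fluxDr // fluxZr // /be mulNr divfK ?subrr // gt_eqF.
    have sv : subexp G x0 v by exact: subexp_lin.
    have vc := zero_flux_const conn lfin curv eps_gt0 weps sXY mX mY bf v0 vX sv.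
    exists (fun i => if i == 0 then v x0 else be) => //.
    apply/funext => x; rewrite bE /= (vc x0 x) /v; lra.
  split; last first.
    apply/(subexpP conn lfin).
    have -> : (\sum_i c i *: b i) = (fun x => c 0 + c 1 * h x).
      by apply/funext => x; exact: bE.
    exact: subexp_lin.
  apply/harmP => x.
  have -> : (\sum_i c i *: b i) = (fun x => c 0 + c 1 * h x).
    by apply/funext => z; exact: bE.
  by rewrite mlapD mlap_cst mlapZ h0 mulr0 addr0.
Qed.
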